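(* Let $R$ be a ring, let $(P,Q,\psi)$ be an $R$-system satisfying condition (FS), and let $J$ be a faithful $\psi$-compatible ideal in $R$. Then the following three conditions are equivalent: (1) Every ideal of $\mathcal{O}_{(P,Q,\psi)}(J)$ is graded. (2) The ideal $J$ satisfies condition (K) with respect to $(P,Q,\psi)$. (3) If $(S',T',\sigma',B)$ is a covariant representation of $(P,Q,\psi)$ which is Cuntz-Pimsner invariant relative to $J$, and $(I,J')=\omega_{(S',T',\sigma',B)}$, then the ring homomorphism $\eta^{(I,J')}_{(S',T',\sigma',B)}:\mathcal{O}_{({}_IP,Q_I,\psi_I)}(J'_I)\to B$ is injective.
   Context: Conventions. Rings are associative, not necessarily commutative or unital. ''Ideal'' means two-sided ideal. ''span'' means additive span. $\mathbb{N}=\{1,2,\dots\}$. The definitions below are for an arbitrary ring $R$ and are also applied with $R$ replaced by a quotient $R_I$. $R$-systems. An $R$-system is a triple $(P,Q,\psi)$ with $P,Q$ $R$-bimodules and $\psi:P\otimes_R Q\to R$ an $R$-bimodule homomorphism. For $p\in P$, $q\in Q$ let $\theta_{q,p}:Q\to Q$, $\theta_{q,p}(x)=q\psi(p\otimes x)$, and $\theta_{p,q}:P\to P$, $\theta_{p,q}(y)=\psi(y\otimes q)p$. Let $\mathcal{F}_P(Q)=\mathrm{span}\{\theta_{q,p}\}$ and $\mathcal{F}_Q(P)=\mathrm{span}\{\theta_{p,q}\}$. Condition (FS): for all finite subsets $\{q_1,\dots,q_n\}\subseteq Q$ and $\{p_1,\dots,p_m\}\subseteq P$ there are $\Theta\in\mathcal{F}_P(Q)$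 and $\Theta'\in\mathcal{F}_Q(P)$ with $\Theta q_i=q_i$ and $\Theta' p_j=p_j$ for all $i,j$. Tensor powers $P^{\otimes n},Q^{\otimes n}$ are over $R$. Covariant representations. A covariant representation of $(P,Q,\psi)$ is $(S,T,\sigma,B)$ with $B$ a ring, $S:P\to B$, $T:Q\to B$ additive, $\sigma:R\to B$ a ring homomorphism, such that $S(pr)=S(p)\sigma(r)$, $S(rp)=\sigma(r)S(p)$, $T(qr)=T(q)\sigma(r)$, $T(rq)=\sigma(r)T(q)$ and $\sigma(\psi(p\otimes q))=S(p)T(q)$. It is injective if $\sigma$ is injective. Put $S^n(p_1\otimes\cdots\otimes p_n)=S(p_1)\cdots S(p_n)$ and $T^n(q_1\otimes\cdots\otimes q_n)=T(q_1)\cdots T(q_n)$. Under (FS) there is a well-defined ring homomorphism $\pi_{T,S}:\mathcal{F}_P(Q)\to B$ with $\pi_{T,S}(\theta_{q,p})=T(q)S(p)$. Relative Cuntz-Pimsner rings. For $r\in R$ let $\Delta(r):Q\to Q$, $\Delta(r)q=rq$. An ideal $J$ of $R$ is $\psi$-compatible if $\Delta(J)\subseteq\mathcal{F}_P(Q)$, and faithful if also $J\cap\ker\Delta=\{0\}$. A covariant representation $(S,T,\sigma,B)$ is Cuntz-Pimsner invariant relative to $J$ if $\pi_{T,S}(\Delta(x))=\sigma(x)$ for all $x\in J$. For $J$ faithful and $\psi$-compatible, $\mathcal{O}_{(P,Q,\psi)}(J)$ with maps $(\iota_P^J,\iota_Q^J,\iota_R^J)$ (abbreviated $(S,T,\sigma)$)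 denotes the universal covariant representation that is Cuntz-Pimsner invariant relative to $J$: it is injective, the ring is generated by $\sigma(R)\cup S(P)\cup T(Q)$, and every covariant representation $(S',T',\sigma',B)$ Cuntz-Pimsner invariant relative to $J$ factors through a unique ring homomorphism $\eta:\mathcal{O}_{(P,Q,\psi)}(J)\to B$ with $\eta\circ S=S'$, $\eta\circ T=T'$, $\eta\circ\sigma=\sigma'$. Grading. $\mathcal{O}_{(P,Q,\psi)}(J)=\bigoplus_{n\in\mathbb{Z}}\mathcal{O}_{(P,Q,\psi)}(J)^{(n)}$ is $\mathbb{Z}$-graded, with degree $0$ part the span of $\sigma(R)$ and all $T^k(q)S^k(p)$ ($k\in\mathbb{N}$), degree $n>0$ part the span of all $T^n(q)$ and $T^{n+k}(q)S^k(p)$ ($k\in\mathbb{N}$), and degree $-n<0$ part the span of all $S^n(p)$ and $T^k(q)S^{n+k}(p)$ ($k\in\mathbb N$). An ideal $H$ is graded if it is the direct sum of its intersections with the graded parts. $T$-pairs. An ideal $I$ of $R$ is $\psi$-invariant if $\psi(px\otimes q)\in I$ for all $p\in P$, $x\in I$, $q\in Q$. For such $I$ put $R_I=R/I$, $Q_I=Q/QI$, ${}_IP=P/IP$ (where $QI=\mathrm{span}\{qx\}$, $IP=\mathrm{span}\{xp\}$, $x\in I$), with quotient maps all denoted $\wp_I$; then $({}_IP,Q_I,\psi_I)$ with $\psi_I(\wp_I(p)\otimes\wp_I(q))=\wp_I(\psi(p\otimes q))$ is an $R_I$-system satisfying (FS). A $T$-pair of $(P,Q,\psi)$ is a pair $(I,J')$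 of ideals of $R$ with $I\subseteq J'$, $I$ $\psi$-invariant, and $J'_I:=\wp_I(J')$ a faithful $\psi_I$-compatible ideal of $R_I$. For a covariant representation put $\omega_{(S',T',\sigma',B)}=(I,J')$ with $I=\ker\sigma'$ and $J'=\{x\in R\mid\sigma'(x)\in\pi_{T',S'}(\mathcal{F}_P(Q))\}$; this is a $T$-pair, and $J\subseteq J'$ if the representation is Cuntz-Pimsner invariant relative to $J$. The maps $S',T',\sigma'$ factor through $\wp_I$ to give an injective covariant representation $(S_I,T_I,\sigma_I,B)$ of $({}_IP,Q_I,\psi_I)$ which is Cuntz-Pimsner invariant relative to $J'_I$, and $\eta^{(I,J')}_{(S',T',\sigma',B)}:\mathcal{O}_{({}_IP,Q_I,\psi_I)}(J'_I)\to B$ is the unique ring homomorphism with $\eta\circ\iota^{J'_I}_{{}_IP}\circ\wp_I=S'$, $\eta\circ\iota^{J'_I}_{Q_I}\circ\wp_I=T'$, $\eta\circ\iota^{J'_I}_{R_I}\circ\wp_I=\sigma'$. Condition (L). For $p\in P$, $S_p:Q^{\otimes n+1}\to Q^{\otimes n}$ is the right $R$-module homomorphism with $S_p(q\otimes q_n)=\psi(p\otimes q)q_n$ ($q\in Q$, $q_n\in Q^{\otimes n}$); for $q_n\in Q^{\otimes n}$, $T_{q_n}:Q\to Q^{\otimes n+1}$ is $T_{q_n}(q)=q_n\otimes q$. A $\psi$-invariant ideal $I$ is a $\psi$-invariant cycle if there are $n\in\mathbb{N}$ and an injective $R$-bimodule homomorphism $\eta:I\to Q^{\otimes n}$ with $S_pT_{\eta(x)}(q)=\eta(\psi(px\otimes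 q))$ for all $p\in P$, $x\in I$, $q\in Q$. For an ideal $I$ put $\psi^{-1}(I)=\{x\in R\mid\psi(px\otimes q)\in I\ \forall p\in P,q\in Q\}$, $I^{[1]}=I$, $I^{[k]}=\psi^{-1}(I^{[k-1]})\cap I$ for $k>1$, and $I^{[\infty]}=\bigcap_{k\ge1}I^{[k]}$. A faithful $\psi$-compatible ideal $J$ satisfies condition (L) with respect to $(P,Q,\psi)$ if there is no non-zero $\psi$-invariant cycle $I$ in $R$ with $I\subseteq J^{[\infty]}$. Condition (K). $J$ satisfies condition (K) with respect to $(P,Q,\psi)$ if $J'_I$ satisfies condition (L) with respect to the $R_I$-system $({}_IP,Q_I,\psi_I)$ whenever $(I,J')$ is a $T$-pair of $(P,Q,\psi)$ with $J\subseteq J'$. *)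

(* Defs.v *)
From HB Require Import structures.
From mathcomp Require Import all_boot all_algebra.
From mathcomp Require Import boolp functions.

Set Implicit Arguments.
Unset Strict Implicit.
Unset Printing Implicit Defensive.

Import GRing.Theory.
Local Open Scope quotient_scope.
Local Open Scope ring_scope.

(* The ring structures of MathComp are unital, hence this structure. *)
HB.mixin Record Zmodule_isRng R of GRing.Zmodule R := {
  rmul : R -> R -> R;
  rmulA : associative rmul;
  rmulDl : left_distributive rmul +%R;
  rmulDr : right_distributive rmul +%R }.

#[short(type="rngType")]
HB.structure Definition Rng := {R of Zmodule_isRng R & GRing.Zmodule R}.

Notation "x · y" := (rmul x y) (at level 40, left associativity) : ring_scope.

HB.mixin Record Zmodule_isBimod (R : rngType) M of GRing.Zmodule M := {
  lact : R -> M -> M;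
  ract : M -> R -> M;
  lactDl : forall r s x, lact (r + s) x = lact r x + lact s x;
  lactDr : forall r x y, lact r (x + y) = lact r x + lact r y;
  lactA : forall r s x, lact (r · s) x = lact r (lact s x);
  ractDl : forall x y r, ract (x + y) r = ract x r + ract y r;
  ractDr : forall x r s, ract x (r + s) = ract x r + ract x s;
  ractA : forall x r s, ract x (r · s) = ract (ract x r) s;
  lractA : forall r x s, ract (lact r x) s = lact r (ract x s) }.

#[short(type="bimodType")]
HB.structure Definition Bimod (R : rngType) :=
  {M of Zmodule_isBimod R M & GRing.Zmodule M}.

Notation "r ·> x" := (lact r x) (at level 39, left associativity) : ring_scope.
Notation "x <· r" := (ract x r) (at level 39, left associativity) : ring_scope.

Section Additivity.
Variables (U V : zmodType) (f : U -> V).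
Hypothesis fD : {morph f : x y / x + y}.

Lemma morphD0 : f 0 = 0.
Proof. by apply: (addIr (f 0)); rewrite -fD !add0r. Qed.

Lemma morphDN x : f (- x) = - f x.
Proof. by apply: (addIr (f x)); rewrite -fD !addNr morphD0. Qed.

Lemma morphDB x y : f (x - y) = f x - f y.
Proof. by rewrite fD morphDN. Qed.

Lemma morphD_sum T (s : seq T) (g : T -> U) :
  f (\sum_(t <- s) g t) = \sum_(t <- s) f (g t).
Proof. by apply: (big_morph f fD morphD0). Qed.

End Additivity.

Section RngTheory.
Variable R : rngType.
Implicit Types x y : R.

Lemma rmul0l x : 0 · x = 0.
Proof. exact: (@morphD0 _ _ (fun a : R => a · x) (fun a b => rmulDl a b x)). Qed.
Lemma rmul0r x : x · 0 = 0.
Proof. exact: (@morphD0 _ _ (fun a : R => x · a) (rmulDr x)). Qed.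
Lemma rmulNl x y : (- x) · y = - (x · y).
Proof. exact: (@morphDN _ _ (fun a : R => a · y) (fun a b => rmulDl a b y)). Qed.
Lemma rmulNr x y : x · (- y) = - (x · y).
Proof. exact: (@morphDN _ _ (fun a : R => x · a) (rmulDr x)). Qed.
Lemma rmulBl x y z : (x - y) · z = x · z - y · z.
Proof. by rewrite rmulDl rmulNl. Qed.
Lemma rmulBr x y z : x · (y - z) = x · y - x · z.
Proof. by rewrite rmulDr rmulNr. Qed.
Lemma rmul_suml T (s : seq T) (g : T -> R) y :
  (\sum_(t <- s) g t) · y = \sum_(t <- s) (g t · y).
Proof. exact: (@morphD_sum _ _ (fun a : R => a · y) (fun a b => rmulDl a b y)). Qed.
Lemma rmul_sumr T (s : seq T) (g : T -> R) y :
  y · (\sum_(t <- s) g t) = \sum_(t <- s) (y · g t).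
Proof. exact: (@morphD_sum _ _ (fun a : R => y · a) (rmulDr y)). Qed.

Variable M : bimodType R.
Implicit Types m : M.

Lemma lact0l m : (0 : R) ·> m = 0.
Proof. exact: (@morphD0 _ _ (fun a : R => a ·> m) (fun a b => lactDl a b m)). Qed.
Lemma lact0r x : x ·> (0 : M) = 0.
Proof. exact: (@morphD0 _ _ (fun a : M => x ·> a) (lactDr x)). Qed.
Lemma lactNl x m : (- x) ·> m = - (x ·> m).
Proof. exact: (@morphDN _ _ (fun a : R => a ·> m) (fun a b => lactDl a b m)). Qed.
Lemma lactNr x m : x ·> (- m) = - (x ·> m).
Proof. exact: (@morphDN _ _ (fun a : M => x ·> a) (lactDr x)). Qed.
Lemma lactBl x y m : (x - y) ·> m = x ·> m - y ·> m.
Proof. by rewrite lactDl lactNl. Qed.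
Lemma lactBr x m n : x ·> (m - n) = x ·> m - x ·> n.
Proof. by rewrite lactDr lactNr. Qed.
Lemma lact_sumr T (s : seq T) (g : T -> M) x :
  x ·> (\sum_(t <- s) g t) = \sum_(t <- s) (x ·> g t).
Proof. exact: (@morphD_sum _ _ (fun a : M => x ·> a) (lactDr x)). Qed.

Lemma ract0l x : (0 : M) <· x = 0.
Proof. exact: (@morphD0 _ _ (fun a : M => a <· x) (fun a b => ractDl a b x)). Qed.
Lemma ract0r m : m <· (0 : R) = 0.
Proof. exact: (@morphD0 _ _ (fun a : R => m <· a) (ractDr m)). Qed.
Lemma ractNl m x : (- m) <· x = - (m <· x).
Proof. exact: (@morphDN _ _ (fun a : M => a <· x) (fun a b => ractDl a b x)). Qed.
Lemma ractNr m x : m <· (- x) = - (m <· x).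
Proof. exact: (@morphDN _ _ (fun a : R => m <· a) (ractDr m)). Qed.
Lemma ractBl m n x : (m - n) <· x = m <· x - n <· x.
Proof. by rewrite ractDl ractNl. Qed.
Lemma ractBr m x y : m <· (x - y) = m <· x - m <· y.
Proof. by rewrite ractDr ractNr. Qed.
Lemma ract_suml T (s : seq T) (g : T -> M) x :
  (\sum_(t <- s) g t) <· x = \sum_(t <- s) (g t <· x).
Proof. exact: (@morphD_sum _ _ (fun a : M => a <· x) (fun a b => ractDl a b x)). Qed.

End RngTheory.

HB.instance Definition _ (R : rngType) := Zmodule_isBimod.Build R R
  (@rmulDl R) (@rmulDr R) (fun r s x => esym (rmulA r s x))
  (@rmulDl R) (@rmulDr R) (fun r s x => (rmulA r s x))
  (fun r s x => esym (rmulA r s x)).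

Record bimod_hom (R : rngType) (M N : bimodType R) (f : M -> N) : Prop := {
  bimod_homD : {morph f : x y / x + y};
  bimod_homl : forall r x, f (r ·> x) = r ·> f x;
  bimod_homr : forall x r, f (x <· r) = f x <· r }.

Record rng_hom (B C : rngType) (f : B -> C) : Prop := {
  rng_homD : {morph f : x y / x + y};
  rng_homM : {morph f : x y / x · y} }.

Inductive in_span (V : zmodType) (X : V -> Prop) : V -> Prop :=
| in_span0 : in_span X 0
| in_span_gen x : X x -> in_span X x
| in_spanB x y : in_span X x -> in_span X y -> in_span X (x - y).

Definition span_pred (V : zmodType) (X : V -> Prop) (x : V) : bool :=
  `[< in_span X x >].

Fact span_zmod_closed (V : zmodType) (X : V -> Prop) :
  zmod_closed (span_pred X).
Proof.
split=> [|x y]; rewrite !unfold_in; first by apply/asboolP; exact: in_span0.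
by move=> /asboolP hx /asboolP hy; apply/asboolP; exact: in_spanB.
Qed.
HB.instance Definition _ (V : zmodType) (X : V -> Prop) :=
  GRing.isZmodClosed.Build V (span_pred X) (span_zmod_closed X).

Definition span (V : zmodType) (X : V -> Prop) : zmodClosed V :=
  GRing.ZmodClosed.clone V (span_pred X) _.

Lemma spanP (V : zmodType) (X : V -> Prop) x :
  reflect (in_span X x) (x \in span X).
Proof. exact: asboolP. Qed.

Lemma mem_span (V : zmodType) (X : V -> Prop) x : X x -> x \in span X.
Proof. by move=> hx; apply/spanP/in_span_gen. Qed.

Lemma span_sub (V : zmodType) (X : V -> Prop) (K : zmodClosed V) :
  (forall x, X x -> x \in K) -> {subset span X <= K}.
Proof.
move=> h x /spanP; elim=> {x} [|x /h //|x y _ hx _ hy]; first exact: rpred0.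
exact: rpredB.
Qed.

Lemma span_map (V W : zmodType) (f : V -> W) (X : V -> Prop) (K : zmodClosed W) :
  {morph f : x y / x + y} ->
  (forall x, X x -> f x \in K) -> forall x, x \in span X -> f x \in K.
Proof.
move=> fD h x /spanP; elim=> {x} [|x /h //|x y _ hx _ hy].
  by rewrite morphD0 ?rpred0.
by rewrite morphDB // rpredB.
Qed.

Record ideal (R : rngType) := Ideal {
  ideal_pred :> zmodClosed R;
  idealMl : forall r x, x \in ideal_pred -> r · x \in ideal_pred;
  idealMr : forall r x, x \in ideal_pred -> x · r \in ideal_pred }.

Definition nonzero_ideal (R : rngType) (I : ideal R) :=
  exists2 x, x \in I & x != 0.

Section IdealBimod.
Variables (R : rngType) (I : ideal R).

Definition ideal_sort := {x : R | x \in I}.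
HB.instance Definition _ := SubChoice.on ideal_sort.
HB.instance Definition _ := [SubChoice_isSubZmodule of ideal_sort by <:].

Definition ideal_lact (r : R) (x : ideal_sort) : ideal_sort :=
  exist _ (r · val x) (idealMl r (valP x)).
Definition ideal_ract (x : ideal_sort) (r : R) : ideal_sort :=
  exist _ (val x · r) (idealMr r (valP x)).

Fact ideal_lactDl r s x :
  ideal_lact (r + s) x = ideal_lact r x + ideal_lact s x.
Proof. by apply: val_inj; rewrite raddfD /= rmulDl. Qed.
Fact ideal_lactDr r x y :
  ideal_lact r (x + y) = ideal_lact r x + ideal_lact r y.
Proof. by apply: val_inj; rewrite !raddfD /= rmulDr. Qed.
Fact ideal_lactA r s x :
  ideal_lact (r · s) x = ideal_lact r (ideal_lact s x).
Proof. by apply: val_inj; rewrite /= rmulA. Qed.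
Fact ideal_ractDl x y r :
  ideal_ract (x + y) r = ideal_ract x r + ideal_ract y r.
Proof. by apply: val_inj; rewrite !raddfD /= rmulDl. Qed.
Fact ideal_ractDr x r s :
  ideal_ract x (r + s) = ideal_ract x r + ideal_ract x s.
Proof. by apply: val_inj; rewrite raddfD /= rmulDr. Qed.
Fact ideal_ractA x r s :
  ideal_ract x (r · s) = ideal_ract (ideal_ract x r) s.
Proof. by apply: val_inj; rewrite /= rmulA. Qed.
Fact ideal_lractA r x s :
  ideal_ract (ideal_lact r x) s = ideal_lact r (ideal_ract x s).
Proof. by apply: val_inj; rewrite /= rmulA. Qed.

HB.instance Definition _ := Zmodule_isBimod.Build R ideal_sort
  ideal_lactDl ideal_lactDr ideal_lactA
  ideal_ractDl ideal_ractDr ideal_ractA ideal_lractA.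
End IdealBimod.

Section QuotientMap.
Variables (V : zmodType) (K : zmodClosed V).

Definition wp (x : V) : Quotient.quot K := \pi_(Quotient.quot K) x.

Lemma wpD : {morph wp : x y / x + y}.
Proof. exact: raddfD. Qed.

Lemma wp_eqP x y : reflect (wp x = wp y) (x - y \in K).
Proof. by rewrite Quotient.idealrBE; exact: eqP. Qed.

Lemma wpK x : wp (repr x) = x.
Proof. exact: reprK. Qed.

Lemma wp0P x : reflect (wp x = 0) (x \in K).
Proof. by rewrite -(morphD0 wpD) -[x in X in reflect _ X]subr0; exact: wp_eqP. Qed.

Lemma repr_wp x : repr (wp x) - x \in K.
Proof. by apply/wp_eqP; rewrite wpK. Qed.

Lemma quot_ind (p : Quotient.quot K -> Prop) : (forall x, p (wp x)) -> forall x, p x.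
Proof. by move=> h x; rewrite -[x]wpK. Qed.

Lemma lift_wp (W : zmodType) (f : V -> W) :
  {morph f : x y / x + y} -> (forall x, x \in K -> f x = 0) ->
  forall x, f (repr (wp x)) = f x.
Proof.
move=> fD h x; apply/eqP; rewrite -subr_eq0 -morphDB //; apply/eqP/h.
exact: repr_wp.
Qed.
End QuotientMap.
Arguments wp {V} K x.

Section QuotientRing.
Variables (R : rngType) (I : ideal R).

Definition rquot := Quotient.quot I.
HB.instance Definition _ := GRing.Zmodule.on rquot.

Definition rquot_mul (x y : rquot) : rquot := wp I (repr x · repr y).

Lemma rquot_mulE x y : rquot_mul (wp I x) (wp I y) = wp I (x · y).
Proof.
apply/wp_eqP; set x' := repr _; set y' := repr _.
have -> : x' · y' - x · y = (x' - x) · y' + x · (y' - y).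
  by rewrite rmulBl rmulBr addrA subrK.
by apply: rpredD; [apply/idealMr/repr_wp|apply/idealMl/repr_wp].
Qed.

Fact rquot_mulA : associative rquot_mul.
Proof.
elim/quot_ind=> x; elim/quot_ind=> y; elim/quot_ind=> z.
by rewrite !rquot_mulE rmulA.
Qed.
Fact rquot_mulDl : left_distributive rquot_mul +%R.
Proof.
elim/quot_ind=> x; elim/quot_ind=> y; elim/quot_ind=> z.
by rewrite -wpD !rquot_mulE -wpD rmulDl.
Qed.
Fact rquot_mulDr : right_distributive rquot_mul +%R.
Proof.
elim/quot_ind=> x; elim/quot_ind=> y; elim/quot_ind=> z.
by rewrite -wpD !rquot_mulE -wpD rmulDr.
Qed.
HB.instance Definition _ :=
  Zmodule_isRng.Build rquot rquot_mulA rquot_mulDl rquot_mulDr.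

Lemma wpM x y : wp I (x · y) = (wp I x : rquot) · wp I y.
Proof. by rewrite /rmul /= rquot_mulE. Qed.

Definition im_pred (J : ideal R) (y : rquot) : bool :=
  `[< exists2 x, x \in J & y = wp I x >].

Lemma im_predP (J : ideal R) y :
  reflect (exists2 x, x \in J & y = wp I x) (y \in im_pred J).
Proof. exact: asboolP. Qed.

Fact im_zmod_closed J : zmod_closed (im_pred J).
Proof.
split=> [|x y].
  by apply/im_predP; exists 0; rewrite ?rpred0 // (morphD0 (wpD _)).
move=> /im_predP[a aJ ->] /im_predP[b bJ ->]; apply/im_predP.
by exists (a - b); rewrite ?rpredB // (morphDB (wpD _)).
Qed.
HB.instance Definition _ J :=
  GRing.isZmodClosed.Build rquot (im_pred J) (im_zmod_closed J).

Fact im_idealMl J (r x : rquot) : x \in im_pred J -> r · x \in im_pred J.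
Proof.
move: r; elim/quot_ind=> r /im_predP[a aJ ->]; apply/im_predP.
by exists (r · a); rewrite ?wpM // idealMl.
Qed.
Fact im_idealMr J (r x : rquot) : x \in im_pred J -> x · r \in im_pred J.
Proof.
move: r; elim/quot_ind=> r /im_predP[a aJ ->]; apply/im_predP.
by exists (a · r); rewrite ?wpM // idealMr.
Qed.
Definition im_ideal (J : ideal R) : ideal rquot :=
  @Ideal rquot (GRing.ZmodClosed.clone rquot (im_pred J) _) (@im_idealMl J) (@im_idealMr J).
End QuotientRing.

(* [tensor M N] is the abelian group generated by the symbols [m ⊗ n], subject
   to biadditivity and to [m <· r ⊗ n = m ⊗ r ·> n]; it is built as the quotient
   of formal group expressions by the least such congruence. *)
Section Tensor.
Variables (R : rngType) (M N : bimodType R).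

Inductive tterm :=
  tgen of M & N | tzero | topp of tterm | tadd of tterm & tterm.

Inductive teqv : tterm -> tterm -> Prop :=
| teqv_refl t : teqv t t
| teqv_sym t u : teqv t u -> teqv u t
| teqv_trans t u v : teqv t u -> teqv u v -> teqv t v
| teqv_opp t u : teqv t u -> teqv (topp t) (topp u)
| teqv_add t t' u u' : teqv t t' -> teqv u u' -> teqv (tadd t u) (tadd t' u')
| teqv_addA t u v : teqv (tadd t (tadd u v)) (tadd (tadd t u) v)
| teqv_addC t u : teqv (tadd t u) (tadd u t)
| teqv_add0 t : teqv (tadd tzero t) t
| teqv_addN t : teqv (tadd (topp t) t) tzero
| teqv_genDl m m' n : teqv (tgen (m + m') n) (tadd (tgen m n) (tgen m' n))
| teqv_genDr m n n' : teqv (tgen m (n + n')) (tadd (tgen m n) (tgen m n'))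
| teqv_genA m r n : teqv (tgen (m <· r) n) (tgen m (r ·> n)).

HB.instance Definition _ := gen_eqMixin tterm.
HB.instance Definition _ := gen_choiceMixin tterm.

Definition teqvb (t u : tterm) : bool := `[< teqv t u >].

Fact teqvb_refl : reflexive teqvb.
Proof. by move=> t; apply/asboolP; exact: teqv_refl. Qed.
Fact teqvb_sym : symmetric teqvb.
Proof. by move=> t u; apply/asboolP/asboolP; exact: teqv_sym. Qed.
Fact teqvb_trans : transitive teqvb.
Proof.
by move=> t u v /asboolP h /asboolP h'; apply/asboolP; exact: teqv_trans h h'.
Qed.
Definition teqv_equiv := EquivRel teqvb teqvb_refl teqvb_sym teqvb_trans.

Definition tensor := {eq_quot teqv_equiv}.
HB.instance Definition _ := Choice.on tensor.

Definition tclass (t : tterm) : tensor := \pi_{eq_quot teqv_equiv} t.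

Lemma tclassK (x : tensor) : tclass (repr x) = x.
Proof. exact: reprK. Qed.

Lemma tclassP t u : tclass t = tclass u <-> teqv t u.
Proof.
split=> [/eqmodP/asboolP //|h].
by apply/eqmodP/asboolP.
Qed.

Lemma repr_tclass t : teqv (repr (tclass t)) t.
Proof. by apply/tclassP; rewrite tclassK. Qed.

Lemma tclass_ind (p : tensor -> Prop) : (forall t, p (tclass t)) -> forall x, p x.
Proof. by move=> h x; rewrite -[x]tclassK. Qed.

Definition tensor_add (x y : tensor) := tclass (tadd (repr x) (repr y)).
Definition tensor_opp (x : tensor) := tclass (topp (repr x)).

Lemma tensor_addE t u : tensor_add (tclass t) (tclass u) = tclass (tadd t u).
Proof. by apply/tclassP/teqv_add; exact: repr_tclass. Qed.
Lemma tensor_oppE t : tensor_opp (tclass t) = tclass (topp t).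
Proof. by apply/tclassP/teqv_opp; exact: repr_tclass. Qed.

Fact tensor_addA : associative tensor_add.
Proof.
elim/tclass_ind=> t; elim/tclass_ind=> u; elim/tclass_ind=> v.
by rewrite !tensor_addE; apply/tclassP; exact: teqv_addA.
Qed.
Fact tensor_addC : commutative tensor_add.
Proof.
elim/tclass_ind=> t; elim/tclass_ind=> u.
by rewrite !tensor_addE; apply/tclassP; exact: teqv_addC.
Qed.
Fact tensor_add0 : left_id (tclass tzero) tensor_add.
Proof.
by elim/tclass_ind=> t; rewrite tensor_addE; apply/tclassP; exact: teqv_add0.
Qed.
Fact tensor_addN : left_inverse (tclass tzero) tensor_opp tensor_add.
Proof.
elim/tclass_ind=> t; rewrite tensor_oppE tensor_addE.
by apply/tclassP; exact: teqv_addN.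
Qed.
HB.instance Definition _ := GRing.isZmodule.Build tensor
  tensor_addA tensor_addC tensor_add0 tensor_addN.

Definition tpure (m : M) (n : N) : tensor := tclass (tgen m n).

Lemma tclass0 : tclass tzero = 0. Proof. by []. Qed.
Lemma tclassD t u : tclass (tadd t u) = tclass t + tclass u.
Proof. by rewrite -tensor_addE. Qed.
Lemma tclassN t : tclass (topp t) = - tclass t.
Proof. by rewrite -tensor_oppE. Qed.

Lemma tpureDl m m' n : tpure (m + m') n = tpure m n + tpure m' n.
Proof. by rewrite -tclassD; apply/tclassP; exact: teqv_genDl. Qed.
Lemma tpureDr m n n' : tpure m (n + n') = tpure m n + tpure m n'.
Proof. by rewrite -tclassD; apply/tclassP; exact: teqv_genDr. Qed.
Lemma tpureA m r n : tpure (m <· r) n = tpure m (r ·> n).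
Proof. by apply/tclassP; exact: teqv_genA. Qed.

Lemma tensor_ind (p : tensor -> Prop) :
  p 0 -> (forall x, p x -> p (- x)) -> (forall x y, p x -> p y -> p (x + y)) ->
  (forall m n, p (tpure m n)) -> forall x, p x.
Proof.
move=> p0 pN pD pg; elim/tclass_ind.
by elim=> [m n||t /pN|t ht u hu];
  rewrite ?tclass0 ?tclassN ?tclassD //; [exact: pg|exact: pD].
Qed.

Definition balanced (V : zmodType) (f : M -> N -> V) :=
  [/\ forall m m' n, f (m + m') n = f m n + f m' n,
      forall m n n', f m (n + n') = f m n + f m n' &
      forall m r n, f (m <· r) n = f m (r ·> n)].

Fixpoint teval (V : zmodType) (f : M -> N -> V) (t : tterm) : V :=
  match t with
  | tgen m n => f m n
  | tzero => 0
  | topp t => - teval f t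
  | tadd t u => teval f t + teval f u
  end.

(* The additive map induced by [f]; it is meaningful only when [f] is balanced
   (see [tliftE]), which is not required in order to form it. *)
Definition tlift (V : zmodType) (f : M -> N -> V) (x : tensor) : V :=
  teval f (repr x).

Section Lift.
Variables (V : zmodType) (f : M -> N -> V).
Hypothesis fb : balanced f.

Lemma teval_eqv t u : teqv t u -> teval f t = teval f u.
Proof.
case: fb => fDl fDr fA; elim=> {t u} //=.
- by move=> t u v _ -> _ ->.
- by move=> t u _ ->.
- by move=> t t' u u' _ -> _ ->.
- by move=> t u v; rewrite addrA.
- by move=> t u; rewrite addrC.
- by move=> t; rewrite add0r.
- by move=> t; rewrite addNr.
Qed.

Lemma tlift_class t : tlift f (tclass t) = teval f t.
Proof. exact/teval_eqv/repr_tclass. Qed.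

Lemma tliftE m n : tlift f (tpure m n) = f m n.
Proof. exact: tlift_class. Qed.

Lemma tliftD : {morph tlift f : x y / x + y}.
Proof.
elim/tclass_ind=> t; elim/tclass_ind=> u.
by rewrite -tclassD !tlift_class.
Qed.
End Lift.

Lemma tensor_ext (V : zmodType) (f g : tensor -> V) :
  {morph f : x y / x + y} -> {morph g : x y / x + y} ->
  (forall m n, f (tpure m n) = g (tpure m n)) -> f =1 g.
Proof.
move=> fD gD h; apply: tensor_ind => //.
- by rewrite !morphD0.
- by move=> x hx; rewrite !morphDN ?hx.
- by move=> x y hx hy; rewrite fD gD hx hy.
Qed.

Definition tensor_lact (r : R) : tensor -> tensor :=
  tlift (fun m n => tpure (r ·> m) n).
Definition tensor_ract (x : tensor) (r : R) : tensor :=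
  tlift (fun m n => tpure m (n <· r)) x.

Lemma tensor_lact_balanced r : balanced (fun m n => tpure (r ·> m) n).
Proof.
by split=> *; rewrite ?lactDr ?tpureDl ?tpureDr // -lractA tpureA.
Qed.
Lemma tensor_ract_balanced r : balanced (fun m n => tpure m (n <· r)).
Proof.
by split=> *; rewrite ?ractDl ?tpureDl ?tpureDr // lractA tpureA.
Qed.

Lemma tensor_lactE r m n : tensor_lact r (tpure m n) = tpure (r ·> m) n.
Proof. exact/tliftE/tensor_lact_balanced. Qed.
Lemma tensor_ractE r m n : tensor_ract (tpure m n) r = tpure m (n <· r).
Proof. exact: (tliftE (tensor_ract_balanced r)). Qed.

Fact tensor_lactDr r : {morph tensor_lact r : x y / x + y}.
Proof. exact/tliftD/tensor_lact_balanced. Qed.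
Fact tensor_ractDl x y r :
  tensor_ract (x + y) r = tensor_ract x r + tensor_ract y r.
Proof. exact: (tliftD (tensor_ract_balanced r)). Qed.
Fact tensor_lactDl r s x :
  tensor_lact (r + s) x = tensor_lact r x + tensor_lact s x.
Proof.
move: x; apply: tensor_ext => [|x y|m n]; first exact: tensor_lactDr.
  by rewrite !tensor_lactDr addrACA.
by rewrite !tensor_lactE lactDl tpureDl.
Qed.
Fact tensor_lactA r s x :
  tensor_lact (r · s) x = tensor_lact r (tensor_lact s x).
Proof.
move: x; apply: tensor_ext => [|x y|m n]; first exact: tensor_lactDr.
  by rewrite !tensor_lactDr.
by rewrite !tensor_lactE lactA.
Qed.
Fact tensor_ractDr x r s :
  tensor_ract x (r + s) = tensor_ract x r + tensor_ract x s.
Proof.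
move: x; apply: tensor_ext => [x y|x y|m n]; first exact: tensor_ractDl.
  by rewrite !tensor_ractDl addrACA.
by rewrite !tensor_ractE ractDr tpureDr.
Qed.
Fact tensor_ractA x r s :
  tensor_ract x (r · s) = tensor_ract (tensor_ract x r) s.
Proof.
move: x; apply: tensor_ext => [x y|x y|m n]; first exact: tensor_ractDl.
  by rewrite !tensor_ractDl.
by rewrite !tensor_ractE ractA.
Qed.
Fact tensor_lractA r x s :
  tensor_ract (tensor_lact r x) s = tensor_lact r (tensor_ract x s).
Proof.
move: x; apply: tensor_ext => [x y|x y|m n].
- by rewrite tensor_lactDr tensor_ractDl.
- by rewrite tensor_ractDl tensor_lactDr.
- by rewrite tensor_ractE !tensor_lactE tensor_ractE.
Qed.
HB.instance Definition _ := Zmodule_isBimod.Build R tensor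
  tensor_lactDl tensor_lactDr tensor_lactA
  tensor_ractDl tensor_ractDr tensor_ractA tensor_lractA.

Lemma lact_tpure r m n : r ·> tpure m n = tpure (r ·> m) n.
Proof. exact: tensor_lactE. Qed.
Lemma ract_tpure r m n : tpure m n <· r = tpure m (n <· r).
Proof. exact: tensor_ractE. Qed.
End Tensor.

Notation "x ⊗ y" := (tpure x y) (at level 40, no associativity) : ring_scope.

(* [tpow Q n] is the tensor power of exponent [n + 1], bracketed to the right. *)
Fixpoint tpow (R : rngType) (Q : bimodType R) (n : nat) : bimodType R :=
  if n is n'.+1 then tensor Q (tpow Q n') else Q.

(* [tsnoc w q] is the element [w ⊗ q] of the power of exponent [n + 2]. *)
Fixpoint tsnoc (R : rngType) (Q : bimodType R) (n : nat) :
    tpow Q n -> Q -> tpow Q n.+1 :=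
  if n is n'.+1 return tpow Q n -> Q -> tpow Q n.+1 then
    fun w q => tlift (fun q0 (w' : tpow Q n') => q0 ⊗ tsnoc w' q) w
  else fun q0 q => (q0 ⊗ q : tensor Q (tpow Q 0)).

Section Tsnoc.
Variables (R : rngType) (Q : bimodType R).

Lemma tsnoc_lin n :
  (forall q, {morph @tsnoc R Q n ^~ q : v w / v + w}) /\
  (forall r (w : tpow Q n) q, tsnoc (r ·> w) q = r ·> tsnoc w q).
Proof.
elim: n => [|n [IHD IHl]] /=.
  by split=> [q x y|r w q]; rewrite ?tpureDl ?lact_tpure.
have bal q : balanced (fun q0 (w' : tpow Q n) => q0 ⊗ tsnoc w' q).
  split=> [m m' w|m w w'|m r w]; first exact: tpureDl.
    by rewrite IHD tpureDr.
  by rewrite IHl tpureA.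
split=> [q|r w q]; first exact: tliftD.
move: w; apply: tensor_ext => [x y|x y|m w].
- by rewrite lactDr tliftD.
- by rewrite tliftD // lactDr.
- by rewrite lact_tpure !tliftE // lact_tpure.
Qed.

Lemma tsnocDl n q : {morph @tsnoc R Q n ^~ q : v w / v + w}.
Proof. exact: (tsnoc_lin n).1. Qed.
Lemma tsnocl n r (w : tpow Q n) q : tsnoc (r ·> w) q = r ·> tsnoc w q.
Proof. exact: (tsnoc_lin n).2. Qed.

Lemma tsnoc_pure n q0 (w : tpow Q n) q :
  @tsnoc R Q n.+1 (q0 ⊗ w) q = q0 ⊗ tsnoc w q.
Proof.
rewrite /= tliftE //; split=> [m m' v|m v v'|m r v]; first exact: tpureDl.
  by rewrite tsnocDl tpureDr.
by rewrite tsnocl tpureA.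
Qed.
End Tsnoc.

Record rsystem (R : rngType) := RSystem {
  sysP : bimodType R;
  sysQ : bimodType R;
  psi : tensor sysP sysQ -> R;
  psi_hom : bimod_hom psi }.

Section System.
Variables (R : rngType) (A : rsystem R).
Local Notation P := (sysP A).
Local Notation Q := (sysQ A).
Local Notation psi := (@psi R A).

Lemma psiDl p p' q : psi ((p + p') ⊗ q) = psi (p ⊗ q) + psi (p' ⊗ q).
Proof. by rewrite tpureDl (bimod_homD (psi_hom A)). Qed.
Lemma psiDr p q q' : psi (p ⊗ (q + q')) = psi (p ⊗ q) + psi (p ⊗ q').
Proof. by rewrite tpureDr (bimod_homD (psi_hom A)). Qed.
Lemma psiBl p p' q : psi ((p - p') ⊗ q) = psi (p ⊗ q) - psi (p' ⊗ q).
Proof.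
exact: (@morphDB _ _ (fun a : P => psi (a ⊗ q)) (fun a b => psiDl a b q)).
Qed.
Lemma psiBr p q q' : psi (p ⊗ (q - q')) = psi (p ⊗ q) - psi (p ⊗ q').
Proof. exact: (@morphDB _ _ (fun a : Q => psi (p ⊗ a)) (psiDr p)). Qed.
Lemma psi_suml T (s : seq T) (g : T -> P) q :
  psi ((\sum_(t <- s) g t) ⊗ q) = \sum_(t <- s) psi (g t ⊗ q).
Proof.
exact: (@morphD_sum _ _ (fun a : P => psi (a ⊗ q)) (fun a b => psiDl a b q)).
Qed.
Lemma psi_sumr T (s : seq T) (g : T -> Q) p :
  psi (p ⊗ (\sum_(t <- s) g t)) = \sum_(t <- s) psi (p ⊗ g t).
Proof. exact: (@morphD_sum _ _ (fun a : Q => psi (p ⊗ a)) (psiDr p)). Qed.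
Lemma psil r p q : psi ((r ·> p) ⊗ q) = r · psi (p ⊗ q).
Proof. by rewrite -lact_tpure (bimod_homl (psi_hom A)). Qed.
Lemma psir r p q : psi (p ⊗ (q <· r)) = psi (p ⊗ q) · r.
Proof. by rewrite -ract_tpure (bimod_homr (psi_hom A)). Qed.

Definition thetaQ (q : Q) (p : P) : Q -> Q := fun x => q <· psi (p ⊗ x).
Definition thetaP (p : P) (q : Q) : P -> P := fun y => psi (y ⊗ q) ·> p.

(* Spans in the groups of maps [Q -> Q] and [P -> P], with pointwise addition. *)
Definition FQ : zmodClosed (Q -> Q) :=
  span (fun Theta => exists q p, Theta = thetaQ q p).
Definition FP : zmodClosed (P -> P) :=
  span (fun Theta => exists p q, Theta = thetaP p q).

Definition condFS := forall (qs : seq Q) (ps : seq P),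
  (exists2 Theta, Theta \in FQ & {in qs, forall q, Theta q = q}) /\
  (exists2 Theta, Theta \in FP & {in ps, forall p, Theta p = p}).

Definition Delta (r : R) : Q -> Q := fun q => r ·> q.

Definition psi_compatible (J : ideal R) := {in J, forall x, Delta x \in FQ}.

Definition faithful (J : ideal R) :=
  psi_compatible J /\ {in J, forall x, Delta x = 0 -> x = 0}.

Lemma FQ_sumP Theta :
  Theta \in FQ <->
  exists s : seq (Q * P), Theta = \sum_(u <- s) thetaQ u.1 u.2.
Proof.
split=> [/spanP|[s ->]]; last first.
  by apply: rpred_sum => u _; apply: mem_span; exists u.1, u.2.
elim=> {Theta} [|Theta [q [p ->]]|x y _ [s ->] _ [t ->]].
- by exists [::]; rewrite big_nil.
- by exists [:: (q, p)]; rewrite big_seq1.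
- exists (s ++ [seq (- u.1, u.2) | u <- t]); rewrite big_cat big_map /=.
  rewrite -sumrN; congr (_ + _); apply: eq_bigr => u _.
  by apply/funext => z; rewrite /thetaQ ractNl.
Qed.

Lemma FP_sumP Theta :
  Theta \in FP <->
  exists s : seq (P * Q), Theta = \sum_(u <- s) thetaP u.1 u.2.
Proof.
split=> [/spanP|[s ->]]; last first.
  by apply: rpred_sum => u _; apply: mem_span; exists u.1, u.2.
elim=> {Theta} [|Theta [q [p ->]]|x y _ [s ->] _ [t ->]].
- by exists [::]; rewrite big_nil.
- by exists [:: (q, p)]; rewrite big_seq1.
- exists (s ++ [seq (- u.1, u.2) | u <- t]); rewrite big_cat big_map /=.
  rewrite -sumrN; congr (_ + _); apply: eq_bigr => u _.
  by apply/funext => z; rewrite /thetaP lactNr.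
Qed.

Lemma sum_thetaQE (s : seq (Q * P)) x :
  (\sum_(u <- s) thetaQ u.1 u.2) x = \sum_(u <- s) u.1 <· psi (u.2 ⊗ x).
Proof. by elim/big_rec2: _ => // u y f _ <-. Qed.

Lemma sum_thetaPE (s : seq (P * Q)) x :
  (\sum_(u <- s) thetaP u.1 u.2) x = \sum_(u <- s) psi (x ⊗ u.2) ·> u.1.
Proof. by elim/big_rec2: _ => // u y f _ <-. Qed.

Lemma condFS_Q : condFS -> forall qs : seq Q, exists s : seq (Q * P),
  {in qs, forall q, q = \sum_(u <- s) u.1 <· psi (u.2 ⊗ q)}.
Proof.
move=> hFS qs; case: (hFS qs [::]) => -[Theta /FQ_sumP[s ->] h] _.
by exists s => q qP; rewrite -sum_thetaQE h.
Qed.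

Lemma condFS_P : condFS -> forall ps : seq P, exists s : seq (P * Q),
  {in ps, forall p, p = \sum_(u <- s) psi (p ⊗ u.2) ·> u.1}.
Proof.
move=> hFS ps; case: (hFS [::] ps) => _ [Theta /FP_sumP[s ->] h].
by exists s => p pP; rewrite -sum_thetaPE h.
Qed.

Record inv_ideal := InvIdeal {
  inv_carrier :> ideal R;
  inv_psi : forall p x q, x \in inv_carrier -> psi ((p <· x) ⊗ q) \in inv_carrier }.

Definition Sp (p : P) (n : nat) : tpow Q n.+1 -> tpow Q n :=
  tlift (fun q (w : tpow Q n) => psi (p ⊗ q) ·> w).

Lemma SpE p n q (w : tpow Q n) : Sp p (q ⊗ w) = psi (p ⊗ q) ·> w.
Proof.
apply: tliftE; split=> [m m' v|m v v'|m r v].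
- by rewrite psiDr lactDl.
- by rewrite lactDr.
- by rewrite psir lactA.
Qed.

Definition inv_elt (I : inv_ideal) (p : P) (x : ideal_sort I) (q : Q) :
    ideal_sort I :=
  exist _ (psi ((p <· val x) ⊗ q)) (inv_psi p q (valP x)).

Definition psi_cycle (I : inv_ideal) :=
  exists (n : nat) (eta : ideal_sort I -> tpow Q n),
    [/\ bimod_hom eta, injective eta &
        forall p x q, Sp p (tsnoc (eta x) q) = eta (inv_elt p x q)].

Definition psi_preim (I : {pred R}) : {pred R} :=
  fun x => `[< forall p q, psi ((p <· x) ⊗ q) \in I >].

(* [iter_ideal I k] is the ideal written with exponent [k + 1]. *)
Fixpoint iter_ideal (I : {pred R}) (k : nat) : {pred R} :=
  if k is k'.+1 then [predI psi_preim (iter_ideal I k') & I] else I.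

Definition iter_ideal_infty (I : {pred R}) : {pred R} :=
  fun x => `[< forall k, x \in iter_ideal I k >].

Definition condL (J : ideal R) :=
  ~ exists I : inv_ideal,
      [/\ nonzero_ideal I, psi_cycle I & {subset I <= iter_ideal_infty J}].

End System.
Arguments FQ {R} A.
Arguments FP {R} A.
Arguments condFS {R} A.
Arguments Delta {R} A r.
Arguments psi_compatible {R} A J.
Arguments faithful {R} A J.
Arguments condL {R} A J.

Record covrep (R : rngType) (A : rsystem R) := Covrep {
  target : rngType;
  repP : sysP A -> target;
  repQ : sysQ A -> target;
  repR : R -> target;
  repPD : {morph repP : p p' / p + p'};
  repQD : {morph repQ : q q' / q + q'};
  repR_hom : rng_hom repR;
  repPr : forall p r, repP (p <· r) = repP p · repR r;
  repPl : forall r p, repP (r ·> p) = repR r · repP p;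
  repQr : forall q r, repQ (q <· r) = repQ q · repR r;
  repQl : forall r q, repQ (r ·> q) = repR r · repQ q;
  rep_psi : forall p q, repR (psi (p ⊗ q)) = repP p · repQ q }.

Section Representations.
Variables (R : rngType) (A : rsystem R).
Local Notation P := (sysP A).
Local Notation Q := (sysQ A).
Variable C : covrep A.
Local Notation S := (repP C).
Local Notation T := (repQ C).
Local Notation sigma := (repR C).

Lemma repRD : {morph sigma : x y / x + y}.
Proof. exact: rng_homD (repR_hom C). Qed.
Lemma repRM : {morph sigma : x y / x · y}.
Proof. exact: rng_homM (repR_hom C). Qed.

(* The value at [Theta] of the homomorphism from [FQ A] sending [thetaQ q p] to
   [T q · S p], computed on a chosen decomposition of [Theta]; by [piTS_sum] it
   does not depend on the choice. *)
Definition piTS (Theta : Q -> Q) : target C :=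
  if pselect (exists s : seq (Q * P), Theta = \sum_(u <- s) thetaQ u.1 u.2)
    is left h
  then \sum_(u <- projT1 (cid h)) T u.1 · S u.2 else 0.

Hypothesis hFS : condFS A.

Lemma sum_thetaQ_inj (s t : seq (Q * P)) :
  (forall x, \sum_(u <- s) u.1 <· psi (u.2 ⊗ x) =
             \sum_(u <- t) u.1 <· psi (u.2 ⊗ x)) ->
  \sum_(u <- s) T u.1 · S u.2 = \sum_(u <- t) T u.1 · S u.2.
Proof.
move=> h.
have [e he] := condFS_P hFS ([seq u.2 | u <- s] ++ [seq u.2 | u <- t]).
suff key (r : seq (Q * P)) :
    {subset [seq u.2 | u <- r] <= [seq u.2 | u <- s] ++ [seq u.2 | u <- t]} ->
    \sum_(u <- r) T u.1 · S u.2 =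
    \sum_(v <- e) T (\sum_(u <- r) u.1 <· psi (u.2 ⊗ v.2)) · S v.1.
  rewrite !key; first by apply: eq_bigr => v _; rewrite h.
    by move=> x hx; rewrite mem_cat hx orbT.
  by move=> x hx; rewrite mem_cat hx.
move=> hr; under [RHS]eq_bigr => v _.
  rewrite (morphD_sum (@repQD _ _ C)) rmul_suml.
  under eq_bigr => u _ do rewrite repQr -rmulA -repPl.
  over.
rewrite exchange_big /= big_seq [RHS]big_seq; apply: eq_bigr => u ur.
by rewrite -rmul_sumr -(morphD_sum (@repPD _ _ C)) -he ?hr ?map_f.
Qed.

Lemma piTS_sum (s : seq (Q * P)) :
  piTS (\sum_(u <- s) thetaQ u.1 u.2) = \sum_(u <- s) T u.1 · S u.2.
Proof.
rewrite /piTS; case: pselect => [h|[]]; last by exists s.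
case: cid => t /= ht; apply: sum_thetaQ_inj => x.
by rewrite -!sum_thetaQE ht.
Qed.

Lemma piTS_theta q p : piTS (thetaQ q p) = T q · S p.
Proof. by have := piTS_sum [:: (q, p)]; rewrite !big_seq1. Qed.

Lemma piTSM Theta Theta' : Theta \in FQ A -> Theta' \in FQ A ->
  piTS (Theta \o Theta') = piTS Theta · piTS Theta'.
Proof.
move=> /FQ_sumP[s ->] /FQ_sumP[t ->].
have -> : (\sum_(u <- s) thetaQ u.1 u.2) \o (\sum_(v <- t) thetaQ v.1 v.2) =
    \sum_(w <- [seq ((\sum_(u <- s) thetaQ u.1 u.2) v.1, v.2) | v <- t])
      thetaQ w.1 w.2.
  apply/funext => x; rewrite [LHS]/= !sum_thetaQE big_map.
  under [LHS]eq_bigr => u _ do rewrite psi_sumr.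
  under [RHS]eq_bigr => v _ do rewrite sum_thetaQE ract_suml.
  rewrite exchange_big /=; apply: eq_bigr => u _.
  rewrite (@morphD_sum _ _ (fun a : R => u.1 <· a) (ractDr u.1)).
  by apply: eq_bigr => v _; rewrite psir ractA.
rewrite !piTS_sum big_map rmul_sumr; apply: eq_bigr => v _ /=.
rewrite sum_thetaQE (morphD_sum (@repQD _ _ C)) !rmul_suml.
by apply: eq_bigr => u _; rewrite repQr rep_psi !rmulA.
Qed.

End Representations.

Arguments repP {R A} c.
Arguments repQ {R A} c.
Arguments repR {R A} c.

Definition cp_invariant (R : rngType) (A : rsystem R) (J : ideal R)
    (C : covrep A) :=
  {in J, forall x, piTS C (Delta A x) = repR C x}.

(* The additive maps with [Tpow C n (q0 ⊗ ... ⊗ qn) = T q0 · ... · T qn] and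
   [Spow C n (p0 ⊗ ... ⊗ pn) = S p0 · ... · S pn]. *)
Fixpoint Tpow (R : rngType) (A : rsystem R) (C : covrep A) (n : nat) :
    tpow (sysQ A) n -> target C :=
  if n is n'.+1 return tpow (sysQ A) n -> target C then
    tlift (fun q (w : tpow (sysQ A) n') => repQ C q · Tpow C w)
  else repQ C.

Fixpoint Spow (R : rngType) (A : rsystem R) (C : covrep A) (n : nat) :
    tpow (sysP A) n -> target C :=
  if n is n'.+1 return tpow (sysP A) n -> target C then
    tlift (fun p (w : tpow (sysP A) n') => repP C p · Spow C w)
  else repP C.

Section Powers.
Variables (R : rngType) (A : rsystem R) (C : covrep A).

Lemma Tpow_lin n : {morph @Tpow R A C n : v w / v + w} /\
  forall r (w : tpow (sysQ A) n), Tpow C (r ·> w) = repR C r · Tpow C w.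
Proof.
elim: n => [|n [IHD IHl]] /=.
  by split=> [|r w]; [exact: repQD|exact: repQl].
have bal : balanced (fun q (w : tpow (sysQ A) n) => repQ C q · Tpow C w).
  split=> [q q' w|q w w'|q r w].
  - by rewrite repQD rmulDl.
  - by rewrite IHD rmulDr.
  - by rewrite repQr IHl rmulA.
split=> [|r]; first exact: tliftD.
apply: tensor_ext => [v w|v w|q w].
- by rewrite lactDr tliftD.
- by rewrite tliftD // rmulDr.
- by rewrite lact_tpure !tliftE // repQl rmulA.
Qed.

Lemma Tpow_pure n q (w : tpow (sysQ A) n) :
  @Tpow R A C n.+1 (q ⊗ w) = repQ C q · Tpow C w.
Proof.
have [hD hl] := Tpow_lin n.
suff bal : balanced (fun q (v : tpow (sysQ A) n) => repQ C q · Tpow C v).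
  exact: (tliftE bal).
split=> [m m' v|m v v'|m r v].
- by rewrite repQD rmulDl.
- by rewrite hD rmulDr.
- by rewrite repQr hl rmulA.
Qed.

Lemma Spow_lin n : {morph @Spow R A C n : v w / v + w} /\
  forall r (w : tpow (sysP A) n), Spow C (r ·> w) = repR C r · Spow C w.
Proof.
elim: n => [|n [IHD IHl]] /=.
  by split=> [|r w]; [exact: repPD|exact: repPl].
have bal : balanced (fun p (w : tpow (sysP A) n) => repP C p · Spow C w).
  split=> [q q' w|q w w'|q r w].
  - by rewrite repPD rmulDl.
  - by rewrite IHD rmulDr.
  - by rewrite repPr IHl rmulA.
split=> [|r]; first exact: tliftD.
apply: tensor_ext => [v w|v w|q w].
- by rewrite lactDr tliftD.
- by rewrite tliftD // rmulDr.
- by rewrite lact_tpure !tliftE // repPl rmulA.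
Qed.

Lemma Spow_pure n p (w : tpow (sysP A) n) :
  @Spow R A C n.+1 (p ⊗ w) = repP C p · Spow C w.
Proof.
have [hD hl] := Spow_lin n.
suff bal : balanced (fun p (v : tpow (sysP A) n) => repP C p · Spow C v).
  exact: (tliftE bal).
split=> [m m' v|m v v'|m r v].
- by rewrite repPD rmulDl.
- by rewrite hD rmulDr.
- by rewrite repPr hl rmulA.
Qed.
End Powers.

(* [CPring A J] is the ring presented by generators [r : R], [p : P], [q : Q]
   and the relations stating that they form a covariant representation which is
   Cuntz-Pimsner invariant relative to [J]. Its universal property is given by
   [CPrep_invariant], [CPliftP], [CPring_generated] and [CPlift_unique]. *)
Section CuntzPimsner.
Variables (R : rngType) (A : rsystem R) (J : ideal R).
Local Notation P := (sysP A).
Local Notation Q := (sysQ A).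

Inductive cterm :=
  cR of R | cP of P | cQ of Q
| czero | copp of cterm | cadd of cterm & cterm | cmul of cterm & cterm.

Definition cTS_sum (s : seq (Q * P)) : cterm :=
  foldr (fun u t => cadd (cmul (cQ u.1) (cP u.2)) t) czero s.

Inductive ceqv : cterm -> cterm -> Prop :=
| ceqv_refl t : ceqv t t
| ceqv_sym t u : ceqv t u -> ceqv u t
| ceqv_trans t u v : ceqv t u -> ceqv u v -> ceqv t v
| ceqv_opp t u : ceqv t u -> ceqv (copp t) (copp u)
| ceqv_add t t' u u' : ceqv t t' -> ceqv u u' -> ceqv (cadd t u) (cadd t' u')
| ceqv_mul t t' u u' : ceqv t t' -> ceqv u u' -> ceqv (cmul t u) (cmul t' u')
| ceqv_addA t u v : ceqv (cadd t (cadd u v)) (cadd (cadd t u) v)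
| ceqv_addC t u : ceqv (cadd t u) (cadd u t)
| ceqv_add0 t : ceqv (cadd czero t) t
| ceqv_addN t : ceqv (cadd (copp t) t) czero
| ceqv_mulA t u v : ceqv (cmul t (cmul u v)) (cmul (cmul t u) v)
| ceqv_mulDl t u v : ceqv (cmul (cadd t u) v) (cadd (cmul t v) (cmul u v))
| ceqv_mulDr t u v : ceqv (cmul t (cadd u v)) (cadd (cmul t u) (cmul t v))
| ceqv_RD r s : ceqv (cR (r + s)) (cadd (cR r) (cR s))
| ceqv_RM r s : ceqv (cR (r · s)) (cmul (cR r) (cR s))
| ceqv_PD p p' : ceqv (cP (p + p')) (cadd (cP p) (cP p'))
| ceqv_QD q q' : ceqv (cQ (q + q')) (cadd (cQ q) (cQ q'))
| ceqv_Pr p r : ceqv (cP (p <· r)) (cmul (cP p) (cR r))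
| ceqv_Pl r p : ceqv (cP (r ·> p)) (cmul (cR r) (cP p))
| ceqv_Qr q r : ceqv (cQ (q <· r)) (cmul (cQ q) (cR r))
| ceqv_Ql r q : ceqv (cQ (r ·> q)) (cmul (cR r) (cQ q))
| ceqv_psi p q : ceqv (cR (psi (p ⊗ q))) (cmul (cP p) (cQ q))
| ceqv_CP x s : x \in J -> Delta A x = \sum_(u <- s) thetaQ u.1 u.2 ->
    ceqv (cR x) (cTS_sum s).

HB.instance Definition _ := gen_eqMixin cterm.
HB.instance Definition _ := gen_choiceMixin cterm.

Definition ceqvb (t u : cterm) : bool := `[< ceqv t u >].

Fact ceqvb_refl : reflexive ceqvb.
Proof. by move=> t; apply/asboolP; exact: ceqv_refl. Qed.
Fact ceqvb_sym : symmetric ceqvb.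
Proof. by move=> t u; apply/asboolP/asboolP; exact: ceqv_sym. Qed.
Fact ceqvb_trans : transitive ceqvb.
Proof.
by move=> t u v /asboolP h /asboolP h'; apply/asboolP; exact: ceqv_trans h h'.
Qed.
Definition ceqv_equiv := EquivRel ceqvb ceqvb_refl ceqvb_sym ceqvb_trans.

Definition CPring := {eq_quot ceqv_equiv}.
HB.instance Definition _ := Choice.on CPring.

Definition cclass (t : cterm) : CPring := \pi_{eq_quot ceqv_equiv} t.

Lemma cclassK (x : CPring) : cclass (repr x) = x.
Proof. exact: reprK. Qed.

Lemma cclassP t u : cclass t = cclass u <-> ceqv t u.
Proof.
split=> [/eqmodP/asboolP //|h].
by apply/eqmodP/asboolP.
Qed.

Lemma repr_cclass t : ceqv (repr (cclass t)) t.
Proof. by apply/cclassP; rewrite cclassK. Qed.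

Lemma cclass_ind (p : CPring -> Prop) : (forall t, p (cclass t)) -> forall x, p x.
Proof. by move=> h x; rewrite -[x]cclassK. Qed.

Definition CP_add (x y : CPring) := cclass (cadd (repr x) (repr y)).
Definition CP_mul (x y : CPring) := cclass (cmul (repr x) (repr y)).
Definition CP_opp (x : CPring) := cclass (copp (repr x)).

Lemma CP_addE t u : CP_add (cclass t) (cclass u) = cclass (cadd t u).
Proof. by apply/cclassP/ceqv_add; exact: repr_cclass. Qed.
Lemma CP_mulE t u : CP_mul (cclass t) (cclass u) = cclass (cmul t u).
Proof. by apply/cclassP/ceqv_mul; exact: repr_cclass. Qed.
Lemma CP_oppE t : CP_opp (cclass t) = cclass (copp t).
Proof. by apply/cclassP/ceqv_opp; exact: repr_cclass. Qed.

Fact CP_addA : associative CP_add.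
Proof.
elim/cclass_ind=> t; elim/cclass_ind=> u; elim/cclass_ind=> v.
by rewrite !CP_addE; apply/cclassP; exact: ceqv_addA.
Qed.
Fact CP_addC : commutative CP_add.
Proof.
elim/cclass_ind=> t; elim/cclass_ind=> u.
by rewrite !CP_addE; apply/cclassP; exact: ceqv_addC.
Qed.
Fact CP_add0 : left_id (cclass czero) CP_add.
Proof.
by elim/cclass_ind=> t; rewrite CP_addE; apply/cclassP; exact: ceqv_add0.
Qed.
Fact CP_addN : left_inverse (cclass czero) CP_opp CP_add.
Proof.
elim/cclass_ind=> t; rewrite CP_oppE CP_addE.
by apply/cclassP; exact: ceqv_addN.
Qed.
HB.instance Definition _ := GRing.isZmodule.Build CPring
  CP_addA CP_addC CP_add0 CP_addN.

Lemma cclass0 : cclass czero = 0. Proof. by []. Qed.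
Lemma cclassD t u : cclass (cadd t u) = cclass t + cclass u.
Proof. by rewrite -CP_addE. Qed.
Lemma cclassN t : cclass (copp t) = - cclass t.
Proof. by rewrite -CP_oppE. Qed.

Fact CP_mulA : associative CP_mul.
Proof.
elim/cclass_ind=> t; elim/cclass_ind=> u; elim/cclass_ind=> v.
by rewrite !CP_mulE; apply/cclassP; exact: ceqv_mulA.
Qed.
Fact CP_mulDl : left_distributive CP_mul +%R.
Proof.
elim/cclass_ind=> t; elim/cclass_ind=> u; elim/cclass_ind=> v.
by rewrite -cclassD !CP_mulE -cclassD; apply/cclassP; exact: ceqv_mulDl.
Qed.
Fact CP_mulDr : right_distributive CP_mul +%R.
Proof.
elim/cclass_ind=> t; elim/cclass_ind=> u; elim/cclass_ind=> v.
by rewrite -cclassD !CP_mulE -cclassD; apply/cclassP; exact: ceqv_mulDr.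
Qed.
HB.instance Definition _ := Zmodule_isRng.Build CPring CP_mulA CP_mulDl CP_mulDr.

Lemma cclassM t u : cclass (cmul t u) = cclass t · cclass u.
Proof. by rewrite -CP_mulE. Qed.

Lemma cclass_sum s :
  cclass (cTS_sum s) = \sum_(u <- s) cclass (cQ u.1) · cclass (cP u.2).
Proof.
elim: s => [|u s IH] /=; first by rewrite big_nil cclass0.
by rewrite big_cons cclassD cclassM IH.
Qed.

Definition CP_P (p : P) : CPring := cclass (cP p).
Definition CP_Q (q : Q) : CPring := cclass (cQ q).
Definition CP_R (r : R) : CPring := cclass (cR r).

Fact CP_PD : {morph CP_P : p p' / p + p'}.
Proof. by move=> p p'; rewrite -cclassD; apply/cclassP; exact: ceqv_PD. Qed.
Fact CP_QD : {morph CP_Q : q q' / q + q'}.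
Proof. by move=> q q'; rewrite -cclassD; apply/cclassP; exact: ceqv_QD. Qed.
Fact CP_R_hom : rng_hom CP_R.
Proof.
split=> r s; rewrite -?cclassD -?cclassM; apply/cclassP; first exact: ceqv_RD.
exact: ceqv_RM.
Qed.
Fact CP_Pr p r : CP_P (p <· r) = CP_P p · CP_R r.
Proof. by rewrite -cclassM; apply/cclassP; exact: ceqv_Pr. Qed.
Fact CP_Pl r p : CP_P (r ·> p) = CP_R r · CP_P p.
Proof. by rewrite -cclassM; apply/cclassP; exact: ceqv_Pl. Qed.
Fact CP_Qr q r : CP_Q (q <· r) = CP_Q q · CP_R r.
Proof. by rewrite -cclassM; apply/cclassP; exact: ceqv_Qr. Qed.
Fact CP_Ql r q : CP_Q (r ·> q) = CP_R r · CP_Q q.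
Proof. by rewrite -cclassM; apply/cclassP; exact: ceqv_Ql. Qed.
Fact CP_psi p q : CP_R (psi (p ⊗ q)) = CP_P p · CP_Q q.
Proof. by rewrite -cclassM; apply/cclassP; exact: ceqv_psi. Qed.

Definition CPrep : covrep A :=
  @Covrep R A CPring CP_P CP_Q CP_R CP_PD CP_QD CP_R_hom
    CP_Pr CP_Pl CP_Qr CP_Ql CP_psi.

Lemma CPrep_invariant : psi_compatible A J -> cp_invariant J CPrep.
Proof.
move=> hJ x xJ; rewrite /piTS; case: pselect => [h|[]]; last first.
  exact/FQ_sumP/hJ.
case: cid => s hs /=; rewrite -cclass_sum; apply/esym/cclassP.
exact: ceqv_CP.
Qed.

(* The homomorphism out of [CPring] induced by [C]; it is meaningful only when
   [C] is Cuntz-Pimsner invariant relative to [J] (see [CPliftP]). *)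
Fixpoint ceval (C : covrep A) (t : cterm) : target C :=
  match t with
  | cR r => repR C r
  | cP p => repP C p
  | cQ q => repQ C q
  | czero => 0
  | copp t => - ceval C t
  | cadd t u => ceval C t + ceval C u
  | cmul t u => ceval C t · ceval C u
  end.

Definition CPlift (C : covrep A) (x : CPring) : target C := ceval C (repr x).

Section Universal.
Hypothesis hFS : condFS A.
Variable C : covrep A.
Hypothesis hC : cp_invariant J C.

Lemma ceval_sum s : ceval C (cTS_sum s) = \sum_(u <- s) repQ C u.1 · repP C u.2.
Proof. by elim: s => [|u s IH] /=; rewrite ?big_nil // big_cons IH. Qed.

Lemma ceval_eqv t u : ceqv t u -> ceval C t = ceval C u.
Proof.
elim=> {t u} //=.
- by move=> t u v _ -> _ ->.
- by move=> t u _ ->.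
- by move=> t t' u u' _ -> _ ->.
- by move=> t t' u u' _ -> _ ->.
- by move=> t u v; rewrite addrA.
- by move=> t u; rewrite addrC.
- by move=> t; rewrite add0r.
- by move=> t; rewrite addNr.
- by move=> t u v; rewrite rmulA.
- by move=> t u v; rewrite rmulDl.
- by move=> t u v; rewrite rmulDr.
- exact: repRD.
- exact: repRM.
- exact: repPD.
- exact: repQD.
- exact: repPr.
- exact: repPl.
- exact: repQr.
- exact: repQl.
- exact: rep_psi.
- by move=> x s xJ hx; rewrite ceval_sum -piTS_sum // -hx hC.
Qed.

Lemma CPlift_class t : CPlift C (cclass t) = ceval C t.
Proof. exact/ceval_eqv/repr_cclass. Qed.

Lemma CPliftP :
  [/\ rng_hom (CPlift C),
      forall p, CPlift C (CP_P p) = repP C p,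
      forall q, CPlift C (CP_Q q) = repQ C q &
      forall r, CPlift C (CP_R r) = repR C r].
Proof.
split=> [|p|q|r]; rewrite ?CPlift_class //.
split; elim/cclass_ind=> t; elim/cclass_ind=> u.
  by rewrite -cclassD !CPlift_class.
by rewrite -cclassM !CPlift_class.
Qed.
End Universal.

Lemma CPring_hom_ext (B : rngType) (f g : CPring -> B) :
  rng_hom f -> rng_hom g ->
  f \o CP_P =1 g \o CP_P -> f \o CP_Q =1 g \o CP_Q -> f \o CP_R =1 g \o CP_R ->
  f =1 g.
Proof.
move=> [fD fM] [gD gM] hP hQ hR; elim/cclass_ind.
elim=> [r|p|q||t ht|t ht u hu|t ht u hu].
- exact: hR.
- exact: hP.
- exact: hQ.
- by rewrite cclass0 !morphD0.
- by rewrite cclassN !morphDN // ht.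
- by rewrite cclassD fD gD ht hu.
- by rewrite cclassM fM gM ht hu.
Qed.

Lemma CPring_generated (K : zmodClosed CPring) :
  (forall x y, x \in K -> y \in K -> x · y \in K) ->
  (forall p, CP_P p \in K) -> (forall q, CP_Q q \in K) ->
  (forall r, CP_R r \in K) -> forall x, x \in K.
Proof.
move=> hM hP hQ hR; elim/cclass_ind.
elim=> [r|p|q||t ht|t ht u hu|t ht u hu].
- exact: hR.
- exact: hP.
- exact: hQ.
- by rewrite cclass0 rpred0.
- by rewrite cclassN rpredN.
- by rewrite cclassD rpredD.
- by rewrite cclassM hM.
Qed.

Lemma CPlift_unique : condFS A -> forall C : covrep A, cp_invariant J C ->
  forall f : CPring -> target C, rng_hom f ->
  f \o CP_P =1 repP C -> f \o CP_Q =1 repQ C -> f \o CP_R =1 repR C ->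
  f =1 CPlift C.
Proof.
move=> hFS C hC f hf hP hQ hR; have [h1 h2 h3 h4] := CPliftP hFS hC.
apply: CPring_hom_ext => // x /=; rewrite ?h2 ?h3 ?h4; [exact: hP|exact: hQ|].
exact: hR.
Qed.

(* Recall that [Tpow CPrep n] and [Spow CPrep n] have tensor exponent [n + 1],
   and that [Negz n] is the integer [- (n + 1)]. *)
Definition CPdeg (d : int) : zmodClosed CPring :=
  match d with
  | Posz 0 => span (fun x : CPring =>
      (exists r, x = CP_R r) \/
      (exists k (q : tpow Q k) (p : tpow P k),
         x = Tpow CPrep q · Spow CPrep p))
  | Posz n.+1 => span (fun x : CPring =>
      (exists q : tpow Q n, x = Tpow CPrep q) \/
      (exists k (q : tpow Q (n + k).+1) (p : tpow P k),
         x = Tpow CPrep q · Spow CPrep p))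
  | Negz n => span (fun x : CPring =>
      (exists p : tpow P n, x = Spow CPrep p) \/
      (exists k (q : tpow Q k) (p : tpow P (n + k).+1),
         x = Tpow CPrep q · Spow CPrep p))
  end.

End CuntzPimsner.

Definition direct_sum (V : zmodType) (H : {pred V}) (G : int -> {pred V}) :=
  [/\ forall d, {subset G d <= H},
      {in H, forall x, exists (s : seq int) (f : int -> V),
        [/\ uniq s, forall d, f d \in G d & x = \sum_(d <- s) f d]} &
      forall (s : seq int) (f : int -> V), uniq s ->
        (forall d, f d \in G d) -> \sum_(d <- s) f d = 0 ->
        {in s, forall d, f d = 0}].

Definition graded_ideal (R : rngType) (A : rsystem R) (J : ideal R)
    (H : ideal (CPring A J)) :=
  direct_sum H (fun d => [predI H & CPdeg A J d]).

Section QuotientSystem.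
Variables (R : rngType) (A : rsystem R).
Local Notation P := (sysP A).
Local Notation Q := (sysQ A).
Variables (hFS : condFS A) (I : inv_ideal A).

Definition QI : zmodClosed Q :=
  span (fun y => exists q x, x \in I /\ y = q <· x).
Definition IP : zmodClosed P :=
  span (fun y => exists x p, x \in I /\ y = x ·> p).

Lemma QI_lact r q : q \in QI -> r ·> q \in QI.
Proof.
apply: span_map => [|_ [q' [x [xI ->]]]]; first exact: lactDr.
by apply: mem_span; exists (r ·> q'), x; rewrite lractA.
Qed.
Lemma QI_ract r q : q \in QI -> q <· r \in QI.
Proof.
apply: (@span_map _ _ (fun a : Q => a <· r)) => [a b|_ [q' [x [xI ->]]]].
  exact: ractDl.
by apply: mem_span; exists q', (x · r); rewrite ractA idealMr.
Qed.
Lemma IP_lact r p : p \in IP -> r ·> p \in IP.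
Proof.
apply: span_map => [|_ [x [p' [xI ->]]]]; first exact: lactDr.
by apply: mem_span; exists (r · x), p'; rewrite lactA idealMl.
Qed.
Lemma IP_ract r p : p \in IP -> p <· r \in IP.
Proof.
apply: (@span_map _ _ (fun a : P => a <· r)) => [a b|_ [x [p' [xI ->]]]].
  exact: ractDl.
by apply: mem_span; exists x, (p' <· r); rewrite lractA.
Qed.
Lemma QI_of_ract x q : x \in I -> q <· x \in QI.
Proof. by move=> xI; apply: mem_span; exists q, x. Qed.
Lemma IP_of_lact x p : x \in I -> x ·> p \in IP.
Proof. by move=> xI; apply: mem_span; exists x, p. Qed.

Lemma QI_of_lact x q : x \in I -> x ·> q \in QI.
Proof.
move=> xI; have [s hs] := condFS_Q hFS [:: x ·> q].
rewrite [x ·> q]hs ?mem_head //; apply: rpred_sum => u _.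
by apply: QI_of_ract; rewrite -tpureA inv_psi.
Qed.

Lemma IP_of_ract x p : x \in I -> p <· x \in IP.
Proof.
move=> xI; have [s hs] := condFS_P hFS [:: p <· x].
rewrite [p <· x]hs ?mem_head //; apply: rpred_sum => u _.
by apply: IP_of_lact; rewrite inv_psi.
Qed.

Lemma psi_QI p q : q \in QI -> psi (p ⊗ q) \in I.
Proof.
apply: (@span_map _ _ (fun a : Q => psi (p ⊗ a))) => [a b|_ [q' [x [xI ->]]]].
  exact: psiDr.
by rewrite psir idealMl.
Qed.
Lemma psi_IP p q : p \in IP -> psi (p ⊗ q) \in I.
Proof.
apply: (@span_map _ _ (fun a : P => psi (a ⊗ q))) => [a b|_ [x [p' [xI ->]]]].
  exact: psiDl.
by rewrite psil idealMr.
Qed.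

(* The bimodule laws on these quotients rely on [hFS], which is therefore a
   parameter of the types. *)
Definition Qquot of condFS A := Quotient.quot QI.
Definition Pquot of condFS A := Quotient.quot IP.
HB.instance Definition _ (h : condFS A) := GRing.Zmodule.on (Qquot h).
HB.instance Definition _ (h : condFS A) := GRing.Zmodule.on (Pquot h).

Definition Qquot_lact (r : rquot I) (q : Qquot hFS) : Qquot hFS :=
  wp QI (repr r ·> repr q).
Definition Qquot_ract (q : Qquot hFS) (r : rquot I) : Qquot hFS :=
  wp QI (repr q <· repr r).
Definition Pquot_lact (r : rquot I) (p : Pquot hFS) : Pquot hFS :=
  wp IP (repr r ·> repr p).
Definition Pquot_ract (p : Pquot hFS) (r : rquot I) : Pquot hFS :=
  wp IP (repr p <· repr r).

Lemma rquot_ind (p : rquot I -> Prop) : (forall r, p (wp I r)) -> forall r, p r.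
Proof. exact: quot_ind. Qed.
Lemma Qquot_ind (p : Qquot hFS -> Prop) : (forall q, p (wp QI q)) -> forall q, p q.
Proof. exact: quot_ind. Qed.
Lemma Pquot_ind (p : Pquot hFS -> Prop) : (forall q, p (wp IP q)) -> forall q, p q.
Proof. exact: quot_ind. Qed.

Lemma Qquot_lactE r q : Qquot_lact (wp I r) (wp QI q) = wp QI (r ·> q).
Proof.
apply/wp_eqP; set r' := repr _; set q' := repr _.
have -> : r' ·> q' - r ·> q = (r' - r) ·> q' + r ·> (q' - q).
  by rewrite lactBl lactBr addrA subrK.
by apply: rpredD; [apply/QI_of_lact/repr_wp|apply/QI_lact/repr_wp].
Qed.
Lemma Qquot_ractE q r : Qquot_ract (wp QI q) (wp I r) = wp QI (q <· r).
Proof.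
apply/wp_eqP; set q' := repr _; set r' := repr _.
have -> : q' <· r' - q <· r = (q' - q) <· r' + q <· (r' - r).
  by rewrite ractBl ractBr addrA subrK.
by apply: rpredD; [apply/QI_ract/repr_wp|apply/QI_of_ract/repr_wp].
Qed.
Lemma Pquot_lactE r p : Pquot_lact (wp I r) (wp IP p) = wp IP (r ·> p).
Proof.
apply/wp_eqP; set r' := repr _; set p' := repr _.
have -> : r' ·> p' - r ·> p = (r' - r) ·> p' + r ·> (p' - p).
  by rewrite lactBl lactBr addrA subrK.
by apply: rpredD; [apply/IP_of_lact/repr_wp|apply/IP_lact/repr_wp].
Qed.
Lemma Pquot_ractE p r : Pquot_ract (wp IP p) (wp I r) = wp IP (p <· r).
Proof.
apply/wp_eqP; set p' := repr _; set r' := repr _.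
have -> : p' <· r' - p <· r = (p' - p) <· r' + p <· (r' - r).
  by rewrite ractBl ractBr addrA subrK.
by apply: rpredD; [apply/IP_ract/repr_wp|apply/IP_of_ract/repr_wp].
Qed.

Fact Qquot_lactDl (r : rquot I) (s : rquot I) (x : Qquot hFS) :
  Qquot_lact (r + s) x = Qquot_lact r x + Qquot_lact s x.
Proof.
elim/rquot_ind: r => r; elim/rquot_ind: s => s; elim/Qquot_ind: x => x.
by rewrite -wpD !Qquot_lactE lactDl [LHS]wpD.
Qed.
Fact Qquot_lactDr (r : rquot I) (x : Qquot hFS) (y : Qquot hFS) :
  Qquot_lact r (x + y) = Qquot_lact r x + Qquot_lact r y.
Proof.
elim/rquot_ind: r => r; elim/Qquot_ind: x => x; elim/Qquot_ind: y => y.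
by rewrite -wpD !Qquot_lactE lactDr [LHS]wpD.
Qed.
Fact Qquot_lactA (r : rquot I) (s : rquot I) (x : Qquot hFS) :
  Qquot_lact (r · s) x = Qquot_lact r (Qquot_lact s x).
Proof.
elim/rquot_ind: r => r; elim/rquot_ind: s => s; elim/Qquot_ind: x => x.
by rewrite -wpM !Qquot_lactE lactA.
Qed.
Fact Qquot_ractDl (x : Qquot hFS) (y : Qquot hFS) (r : rquot I) :
  Qquot_ract (x + y) r = Qquot_ract x r + Qquot_ract y r.
Proof.
elim/Qquot_ind: x => x; elim/Qquot_ind: y => y; elim/rquot_ind: r => r.
by rewrite -wpD !Qquot_ractE ractDl [LHS]wpD.
Qed.
Fact Qquot_ractDr (x : Qquot hFS) (r : rquot I) (s : rquot I) :
  Qquot_ract x (r + s) = Qquot_ract x r + Qquot_ract x s.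
Proof.
elim/Qquot_ind: x => x; elim/rquot_ind: r => r; elim/rquot_ind: s => s.
by rewrite -wpD !Qquot_ractE ractDr [LHS]wpD.
Qed.
Fact Qquot_ractA (x : Qquot hFS) (r : rquot I) (s : rquot I) :
  Qquot_ract x (r · s) = Qquot_ract (Qquot_ract x r) s.
Proof.
elim/Qquot_ind: x => x; elim/rquot_ind: r => r; elim/rquot_ind: s => s.
by rewrite -wpM !Qquot_ractE ractA.
Qed.
Fact Qquot_lractA (r : rquot I) (x : Qquot hFS) (s : rquot I) :
  Qquot_ract (Qquot_lact r x) s = Qquot_lact r (Qquot_ract x s).
Proof.
elim/rquot_ind: r => r; elim/Qquot_ind: x => x; elim/rquot_ind: s => s.
by rewrite Qquot_lactE !Qquot_ractE Qquot_lactE lractA.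
Qed.
HB.instance Definition _ := Zmodule_isBimod.Build (rquot I) (Qquot hFS)
  Qquot_lactDl Qquot_lactDr Qquot_lactA
  Qquot_ractDl Qquot_ractDr Qquot_ractA Qquot_lractA.

Fact Pquot_lactDl (r : rquot I) (s : rquot I) (x : Pquot hFS) :
  Pquot_lact (r + s) x = Pquot_lact r x + Pquot_lact s x.
Proof.
elim/rquot_ind: r => r; elim/rquot_ind: s => s; elim/Pquot_ind: x => x.
by rewrite -wpD !Pquot_lactE lactDl [LHS]wpD.
Qed.
Fact Pquot_lactDr (r : rquot I) (x : Pquot hFS) (y : Pquot hFS) :
  Pquot_lact r (x + y) = Pquot_lact r x + Pquot_lact r y.
Proof.
elim/rquot_ind: r => r; elim/Pquot_ind: x => x; elim/Pquot_ind: y => y.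
by rewrite -wpD !Pquot_lactE lactDr [LHS]wpD.
Qed.
Fact Pquot_lactA (r : rquot I) (s : rquot I) (x : Pquot hFS) :
  Pquot_lact (r · s) x = Pquot_lact r (Pquot_lact s x).
Proof.
elim/rquot_ind: r => r; elim/rquot_ind: s => s; elim/Pquot_ind: x => x.
by rewrite -wpM !Pquot_lactE lactA.
Qed.
Fact Pquot_ractDl (x : Pquot hFS) (y : Pquot hFS) (r : rquot I) :
  Pquot_ract (x + y) r = Pquot_ract x r + Pquot_ract y r.
Proof.
elim/Pquot_ind: x => x; elim/Pquot_ind: y => y; elim/rquot_ind: r => r.
by rewrite -wpD !Pquot_ractE ractDl [LHS]wpD.
Qed.
Fact Pquot_ractDr (x : Pquot hFS) (r : rquot I) (s : rquot I) :
  Pquot_ract x (r + s) = Pquot_ract x r + Pquot_ract x s.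
Proof.
elim/Pquot_ind: x => x; elim/rquot_ind: r => r; elim/rquot_ind: s => s.
by rewrite -wpD !Pquot_ractE ractDr [LHS]wpD.
Qed.
Fact Pquot_ractA (x : Pquot hFS) (r : rquot I) (s : rquot I) :
  Pquot_ract x (r · s) = Pquot_ract (Pquot_ract x r) s.
Proof.
elim/Pquot_ind: x => x; elim/rquot_ind: r => r; elim/rquot_ind: s => s.
by rewrite -wpM !Pquot_ractE ractA.
Qed.
Fact Pquot_lractA (r : rquot I) (x : Pquot hFS) (s : rquot I) :
  Pquot_ract (Pquot_lact r x) s = Pquot_lact r (Pquot_ract x s).
Proof.
elim/rquot_ind: r => r; elim/Pquot_ind: x => x; elim/rquot_ind: s => s.
by rewrite Pquot_lactE !Pquot_ractE Pquot_lactE lractA.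
Qed.
HB.instance Definition _ := Zmodule_isBimod.Build (rquot I) (Pquot hFS)
  Pquot_lactDl Pquot_lactDr Pquot_lactA
  Pquot_ractDl Pquot_ractDr Pquot_ractA Pquot_lractA.

Definition wpR (r : R) : rquot I := wp I r.
Definition wpQ (q : Q) : Qquot hFS := wp QI q.
Definition wpP (p : P) : Pquot hFS := wp IP p.

Lemma wpQl r q : wpQ (r ·> q) = wpR r ·> wpQ q.
Proof. exact/esym/Qquot_lactE. Qed.
Lemma wpQr q r : wpQ (q <· r) = wpQ q <· wpR r.
Proof. exact/esym/Qquot_ractE. Qed.
Lemma wpPl r p : wpP (r ·> p) = wpR r ·> wpP p.
Proof. exact/esym/Pquot_lactE. Qed.
Lemma wpPr p r : wpP (p <· r) = wpP p <· wpR r.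
Proof. exact/esym/Pquot_ractE. Qed.

Definition psi_quot2 (p : Pquot hFS) (q : Qquot hFS) : rquot I :=
  wpR (psi (repr p ⊗ repr q)).

Lemma psi_quot2E p q : psi_quot2 (wpP p) (wpQ q) = wpR (psi (p ⊗ q)).
Proof.
apply/wp_eqP; set p' := repr _; set q' := repr _.
have -> : psi (p' ⊗ q') - psi (p ⊗ q) =
    psi ((p' - p) ⊗ q') + psi (p ⊗ (q' - q)).
  by rewrite psiBl psiBr addrA subrK.
by apply: rpredD; [apply/psi_IP/repr_wp|apply/psi_QI/repr_wp].
Qed.

Lemma psi_quot2_balanced : balanced psi_quot2.
Proof.
split.
- elim/quot_ind=> p; elim/quot_ind=> p'; elim/quot_ind=> q.
  rewrite -wpD; change (psi_quot2 (wpP (p + p')) (wpQ q) =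
    psi_quot2 (wpP p) (wpQ q) + psi_quot2 (wpP p') (wpQ q)).
  by rewrite !psi_quot2E psiDl /wpR wpD.
- elim/quot_ind=> p; elim/quot_ind=> q; elim/quot_ind=> q'.
  rewrite -wpD; change (psi_quot2 (wpP p) (wpQ (q + q')) =
    psi_quot2 (wpP p) (wpQ q) + psi_quot2 (wpP p) (wpQ q')).
  by rewrite !psi_quot2E psiDr /wpR wpD.
- elim/quot_ind=> p; elim/quot_ind=> r; elim/quot_ind=> q.
  change (psi_quot2 (wpP p <· wpR r) (wpQ q) =
    psi_quot2 (wpP p) (wpR r ·> wpQ q)).
  by rewrite -wpPr -wpQl !psi_quot2E tpureA.
Qed.

Definition psi_quot : tensor (Pquot hFS) (Qquot hFS) -> rquot I :=
  tlift psi_quot2.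

Lemma psi_quotE p q : psi_quot (wpP p ⊗ wpQ q) = wpR (psi (p ⊗ q)).
Proof. by rewrite /psi_quot (tliftE psi_quot2_balanced) psi_quot2E. Qed.

(* The codomain is the ring [rquot I] seen as a bimodule over itself. *)
Fact psi_quot_hom :
  bimod_hom (psi_quot : _ -> Rng.sort (rquot I)).
Proof.
have D := tliftD psi_quot2_balanced; split; first exact: D.
- elim/quot_ind=> r; apply: tensor_ext => [x y|x y|].
  + by rewrite lactDr [LHS]D.
  + by rewrite [X in _ ·> X]D lactDr.
  elim/quot_ind=> p; elim/quot_ind=> q.
  change (psi_quot (wpR r ·> (wpP p ⊗ wpQ q)) =
          wpR r · psi_quot (wpP p ⊗ wpQ q)).
  by rewrite lact_tpure -wpPl !psi_quotE psil /wpR wpM.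
- move=> x r; move: r x; elim/quot_ind=> r; apply: tensor_ext => [x y|x y|].
  + by rewrite ractDl [LHS]D.
  + by rewrite [X in X <· _]D ractDl.
  elim/quot_ind=> p; elim/quot_ind=> q.
  change (psi_quot ((wpP p ⊗ wpQ q) <· wpR r) =
          psi_quot (wpP p ⊗ wpQ q) · wpR r).
  by rewrite ract_tpure -wpQr !psi_quotE psir /wpR wpM.
Qed.

Definition quot_system : rsystem (rquot I) :=
  @RSystem (rquot I) (Pquot hFS) (Qquot hFS) psi_quot psi_quot_hom.

Lemma quot_thetaQE (s : seq (Q * P)) x :
  (\sum_(u <- [seq (wpQ u.1, wpP u.2) | u <- s])
     @thetaQ _ quot_system u.1 u.2) (wpQ x) =
  wpQ ((\sum_(u <- s) thetaQ u.1 u.2) x).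
Proof.
rewrite sum_thetaQE sum_thetaQE big_map [RHS](morphD_sum (@wpD _ QI)).
by apply: eq_bigr => u _; rewrite /= psi_quotE -wpQr.
Qed.

Lemma quot_thetaPE (s : seq (P * Q)) x :
  (\sum_(u <- [seq (wpP u.1, wpQ u.2) | u <- s])
     @thetaP _ quot_system u.1 u.2) (wpP x) =
  wpP ((\sum_(u <- s) thetaP u.1 u.2) x).
Proof.
rewrite sum_thetaPE sum_thetaPE big_map [RHS](morphD_sum (@wpD _ IP)).
by apply: eq_bigr => u _; rewrite /= psi_quotE -wpPl.
Qed.

Lemma quot_condFS : condFS quot_system.
Proof.
move=> qs ps; have [[Th /FQ_sumP[s hs] hq] [Th' /FP_sumP[t ht] hp]] :=
  hFS [seq repr q | q <- qs] [seq repr p | p <- ps].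
split.
- exists (\sum_(u <- [seq (wpQ u.1, wpP u.2) | u <- s])
     @thetaQ _ quot_system u.1 u.2).
    by apply/FQ_sumP; exists [seq (wpQ u.1, wpP u.2) | u <- s].
  move=> q qqs; rewrite -[q]/(q : Qquot hFS) -[q](wpK (K := QI)) quot_thetaQE.
  by rewrite -hs hq // map_f.
- exists (\sum_(u <- [seq (wpP u.1, wpQ u.2) | u <- t])
     @thetaP _ quot_system u.1 u.2).
    by apply/FP_sumP; exists [seq (wpP u.1, wpQ u.2) | u <- t].
  move=> p pps; rewrite -[p](wpK (K := IP)) quot_thetaPE.
  by rewrite -ht hp // map_f.
Qed.

End QuotientSystem.

Arguments wpR {R A} I r.

Record Tpair (R : rngType) (A : rsystem R) (hFS : condFS A) := MkTpair {
  tp_I : inv_ideal A;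
  tp_J : ideal R;
  tp_sub : {subset tp_I <= tp_J};
  tp_faithful : faithful (quot_system hFS tp_I) (im_ideal tp_I tp_J) }.

Section TpairOfRep.
Variables (R : rngType) (A : rsystem R) (hFS : condFS A) (C : covrep A).
Local Notation P := (sysP A).
Local Notation Q := (sysQ A).
Local Notation S := (repP C).
Local Notation T := (repQ C).
Local Notation sigma := (repR C).

Definition ker_pred (x : R) : bool := sigma x == 0.

Fact ker_zmod_closed : zmod_closed ker_pred.
Proof.
split=> [|x y]; rewrite !unfold_in /ker_pred; first by rewrite (morphD0 (@repRD _ _ C)).
by move=> /eqP hx /eqP hy; rewrite (morphDB (@repRD _ _ C)) hx hy subrr.
Qed.
HB.instance Definition _ := GRing.isZmodClosed.Build R ker_pred ker_zmod_closed.

Fact ker_Ml r x : x \in ker_pred -> r · x \in ker_pred.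
Proof.
by rewrite !unfold_in /ker_pred repRM => /eqP ->; rewrite rmul0r.
Qed.
Fact ker_Mr r x : x \in ker_pred -> x · r \in ker_pred.
Proof.
by rewrite !unfold_in /ker_pred repRM => /eqP ->; rewrite rmul0l.
Qed.
Definition ker_ideal : ideal R :=
  @Ideal R (GRing.ZmodClosed.clone R ker_pred _) ker_Ml ker_Mr.

Lemma ker_idealP x : reflect (sigma x = 0) (x \in ker_ideal).
Proof. exact: eqP. Qed.

Fact ker_inv (p : P) (x : R) (q : Q) :
  x \in ker_ideal -> psi ((p <· x) ⊗ q) \in ker_ideal.
Proof.
move=> /ker_idealP hx; apply/ker_idealP.
by rewrite rep_psi repPr hx rmul0r rmul0l.
Qed.
Definition ker_inv_ideal : inv_ideal A := InvIdeal ker_inv.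
Local Notation I := ker_inv_ideal.

Definition omegaJ_pred (x : R) : bool :=
  `[< exists2 Theta, Theta \in FQ A & sigma x = piTS C Theta >].

Lemma omegaJ_sumP x : x \in omegaJ_pred <->
  exists s : seq (Q * P), sigma x = \sum_(u <- s) T u.1 · S u.2.
Proof.
split=> [/asboolP[Theta /FQ_sumP[s ->]]|[s hs]].
  by rewrite piTS_sum //; exists s.
apply/asboolP; exists (\sum_(u <- s) thetaQ u.1 u.2); last by rewrite piTS_sum.
by apply/FQ_sumP; exists s.
Qed.

Fact omegaJ_zmod_closed : zmod_closed omegaJ_pred.
Proof.
split=> [|x y].
  by apply/omegaJ_sumP; exists [::]; rewrite big_nil (morphD0 (@repRD _ _ C)).
move=> /omegaJ_sumP[s hs] /omegaJ_sumP[t ht]; apply/omegaJ_sumP.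
exists (s ++ [seq (- u.1, u.2) | u <- t]).
rewrite (morphDB (@repRD _ _ C)) hs ht big_cat big_map -sumrN; congr (_ + _).
by apply: eq_bigr => u _ /=; rewrite (morphDN (@repQD _ _ C)) rmulNl.
Qed.
HB.instance Definition _ :=
  GRing.isZmodClosed.Build R omegaJ_pred omegaJ_zmod_closed.

Fact omegaJ_Ml r x : x \in omegaJ_pred -> r · x \in omegaJ_pred.
Proof.
move=> /omegaJ_sumP[s hs]; apply/omegaJ_sumP.
exists [seq (r ·> u.1, u.2) | u <- s].
rewrite repRM hs rmul_sumr big_map; apply: eq_bigr => u _ /=.
by rewrite repQl rmulA.
Qed.
Fact omegaJ_Mr r x : x \in omegaJ_pred -> x · r \in omegaJ_pred.
Proof.
move=> /omegaJ_sumP[s hs]; apply/omegaJ_sumP.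
exists [seq (u.1, u.2 <· r) | u <- s].
rewrite repRM hs rmul_suml big_map; apply: eq_bigr => u _ /=.
by rewrite repPr rmulA.
Qed.
Definition omegaJ : ideal R :=
  @Ideal R (GRing.ZmodClosed.clone R omegaJ_pred _) omegaJ_Ml omegaJ_Mr.

Fact omega_sub : {subset I <= omegaJ}.
Proof.
move=> x /ker_idealP hx; apply/omegaJ_sumP; exists [::].
by rewrite hx big_nil.
Qed.

Lemma omegaJ_super (J : ideal R) : psi_compatible A J -> cp_invariant J C ->
  {subset J <= omegaJ}.
Proof.
by move=> hJ hC x xJ; apply/asboolP; exists (Delta A x); rewrite ?hJ ?hC.
Qed.

Lemma kerT q : T q = 0 <-> q \in QI I.
Proof.
split=> [hq|].
  have [s hs] := condFS_Q hFS [:: q].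
  rewrite [q]hs ?mem_head //; apply: rpred_sum => u _.
  by apply/QI_of_ract/ker_idealP; rewrite rep_psi hq rmul0r.
move=> /spanP; elim=> {q} [|_ [q [x [/ker_idealP hx ->]]]|q q' _ hq _ hq'].
- by rewrite (morphD0 (@repQD _ _ C)).
- by rewrite repQr hx rmul0r.
- by rewrite (morphDB (@repQD _ _ C)) hq hq' subrr.
Qed.

Lemma kerS p : p \in IP I -> S p = 0.
Proof.
move=> /spanP; elim=> {p} [|_ [x [p [/ker_idealP hx ->]]]|q q' _ hq _ hq'].
- by rewrite (morphD0 (@repPD _ _ C)).
- by rewrite repPl hx rmul0l.
- by rewrite (morphDB (@repPD _ _ C)) hq hq' subrr.
Qed.

Lemma omega_DeltaE x (s : seq (Q * P)) :
  sigma x = \sum_(u <- s) T u.1 · S u.2 ->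
  Delta (quot_system hFS I) (wpR I x) =
  \sum_(u <- [seq (wpQ hFS I u.1, wpP hFS I u.2) | u <- s])
     @thetaQ _ (quot_system hFS I) u.1 u.2.
Proof.
move=> hx; apply/funext; elim/quot_ind=> q; rewrite -/(wpQ hFS I q) quot_thetaQE.
rewrite /Delta -wpQl; apply/wp_eqP/kerT.
rewrite (morphDB (@repQD _ _ C)) repQl hx rmul_suml sum_thetaQE.
rewrite (morphD_sum (@repQD _ _ C)); apply/eqP; rewrite subr_eq0; apply/eqP.
by apply: eq_bigr => u _; rewrite repQr rep_psi rmulA.
Qed.

Fact omega_faithful : faithful (quot_system hFS I) (im_ideal I omegaJ).
Proof.
split=> [_ /im_predP[x /omegaJ_sumP[s hs] ->]|].
  rewrite (omega_DeltaE hs); apply/FQ_sumP.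
  by exists [seq (wpQ hFS I u.1, wpP hFS I u.2) | u <- s].
move=> _ /im_predP[x /omegaJ_sumP[s hs] ->] h0; apply/wp0P/ker_idealP.
have hT q : sigma x · T q = 0.
  rewrite -repQl; apply/kerT/wp0P.
  by have := congr1 (fun f => f (wpQ hFS I q)) h0; rewrite /Delta -wpQl.
have [e he] := condFS_P hFS [seq u.2 | u <- s].
have -> : sigma x = sigma x · \sum_(v <- e) T v.2 · S v.1.
  rewrite {1 2}hs rmul_suml big_seq [RHS]big_seq; apply: eq_bigr => u us.
  rewrite {1}(he u.2) ?map_f // (morphD_sum (@repPD _ _ C)) -rmulA rmul_sumr.
  congr (_ · _); apply: eq_bigr => v _.
  by rewrite repPl rep_psi rmulA.
by rewrite rmul_sumr big1 // => v _; rewrite rmulA hT rmul0l.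
Qed.

Definition omega : Tpair hFS := MkTpair omega_sub omega_faithful.

Definition quot_repP (p : Pquot I hFS) : target C := S (repr p).
Definition quot_repQ (q : Qquot I hFS) : target C := T (repr q).
Definition quot_repR (r : rquot I) : target C := sigma (repr r).

Lemma quot_repPE p : quot_repP (wpP hFS I p) = S p.
Proof. exact: (lift_wp (@repPD _ _ C) kerS). Qed.
Lemma quot_repQE q : quot_repQ (wpQ hFS I q) = T q.
Proof. by apply: (lift_wp (@repQD _ _ C)) => x /kerT. Qed.
Lemma quot_repRE r : quot_repR (wpR I r) = sigma r.
Proof. by apply: (lift_wp (@repRD _ _ C)) => x /ker_idealP. Qed.

Fact quot_repPD : {morph quot_repP : p p' / p + p'}.
Proof.
elim/quot_ind=> p; elim/quot_ind=> p'.
by rewrite -wpD -/(wpP hFS I _) !quot_repPE repPD.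
Qed.
Fact quot_repQD : {morph quot_repQ : q q' / q + q'}.
Proof.
elim/quot_ind=> p; elim/quot_ind=> p'.
by rewrite -wpD -/(wpQ hFS I _) !quot_repQE repQD.
Qed.
Fact quot_repR_hom : rng_hom quot_repR.
Proof.
split; elim/quot_ind=> r; elim/quot_ind=> s.
  by rewrite -wpD -/(wpR I _) !quot_repRE repRD.
by rewrite -wpM -/(wpR I _) !quot_repRE repRM.
Qed.
Fact quot_repPr p (r : rquot I) : quot_repP (p <· r) = quot_repP p · quot_repR r.
Proof.
move: p r; elim/quot_ind=> p; elim/quot_ind=> r.
by rewrite -/(wpP hFS I _) -/(wpR I r) -wpPr !quot_repPE quot_repRE repPr.
Qed.
Fact quot_repPl (r : rquot I) p : quot_repP (r ·> p) = quot_repR r · quot_repP p.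
Proof.
move: r p; elim/quot_ind=> r; elim/quot_ind=> p.
by rewrite -/(wpP hFS I _) -/(wpR I r) -wpPl !quot_repPE quot_repRE repPl.
Qed.
Fact quot_repQr q (r : rquot I) : quot_repQ (q <· r) = quot_repQ q · quot_repR r.
Proof.
move: q r; elim/quot_ind=> q; elim/quot_ind=> r.
by rewrite -/(wpQ hFS I _) -/(wpR I r) -wpQr !quot_repQE quot_repRE repQr.
Qed.
Fact quot_repQl (r : rquot I) q : quot_repQ (r ·> q) = quot_repR r · quot_repQ q.
Proof.
move: r q; elim/quot_ind=> r; elim/quot_ind=> q.
by rewrite -/(wpQ hFS I _) -/(wpR I r) -wpQl !quot_repQE quot_repRE repQl.
Qed.
Fact quot_rep_psi (p : sysP (quot_system hFS I)) (q : sysQ (quot_system hFS I)) :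
  quot_repR (psi (p ⊗ q)) = quot_repP p · quot_repQ q.
Proof.
move: p q; elim/quot_ind=> p; elim/quot_ind=> q.
rewrite -/(wpQ hFS I q) -/(wpP hFS I p) /= psi_quotE.
by rewrite quot_repRE quot_repPE quot_repQE rep_psi.
Qed.

Definition quot_rep : covrep (quot_system hFS I) :=
  @Covrep _ (quot_system hFS I) (target C) quot_repP quot_repQ quot_repR
    quot_repPD quot_repQD quot_repR_hom
    quot_repPr quot_repPl quot_repQr quot_repQl quot_rep_psi.

Lemma quot_rep_injective : injective (repR quot_rep).
Proof.
elim/quot_ind=> r; elim/quot_ind=> s.
rewrite -/(wpR I r) -/(wpR I s) /= !quot_repRE => h.
by apply/wp_eqP/ker_idealP; rewrite (morphDB (@repRD _ _ C)) h subrr.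
Qed.

Lemma quot_rep_invariant : cp_invariant (im_ideal I omegaJ) quot_rep.
Proof.
move=> _ /im_predP[x /omegaJ_sumP[s hs] ->].
rewrite (omega_DeltaE hs) piTS_sum; last exact: quot_condFS.
rewrite -/(wpR I x) /= quot_repRE hs big_map.
by apply: eq_bigr => u _; rewrite /= quot_repPE quot_repQE.
Qed.

Local Notation omega_CP := (CPrep (quot_system hFS (tp_I omega))
  (im_ideal (tp_I omega) (tp_J omega))).

Definition omega_eta : target omega_CP -> target C := CPlift quot_rep.

Definition omega_eta_spec (f : target omega_CP -> target C) :=
  [/\ rng_hom f,
      forall p, f (repP omega_CP (wpP hFS (tp_I omega) p)) = S p,
      forall q, f (repQ omega_CP (wpQ hFS (tp_I omega) q)) = T q &
      forall r, f (repR omega_CP (wpR (tp_I omega) r)) = sigma r].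

Lemma omega_etaP : omega_eta_spec omega_eta.
Proof.
have [h1 h2 h3 h4] := CPliftP (@quot_condFS _ _ hFS I) quot_rep_invariant.
split=> // [p|q|r]; rewrite /omega_eta ?h2 ?h3 ?h4 /=.
- exact: quot_repPE.
- exact: quot_repQE.
- exact: quot_repRE.
Qed.

Lemma omega_eta_unique f : omega_eta_spec f -> f =1 omega_eta.
Proof.
case=> h1 h2 h3 h4; have [g1 g2 g3 g4] := omega_etaP.
apply: CPring_hom_ext => //; elim/quot_ind=> x /=.
- by rewrite -/(wpP hFS I x) [LHS]h2 [RHS]g2.
- by rewrite -/(wpQ hFS I x) [LHS]h3 [RHS]g3.
- by rewrite -/(wpR I x) [LHS]h4 [RHS]g4.
Qed.

End TpairOfRep.

Arguments omega {R A} hFS C.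
Arguments omega_eta {R A} hFS C x.

Definition condK (R : rngType) (A : rsystem R) (hFS : condFS A) (J : ideal R) :=
  forall t : Tpair hFS, {subset J <= tp_J t} ->
    condL (quot_system hFS (tp_I t)) (im_ideal (tp_I t) (tp_J t)).

(* Main.v *)
From HB Require Import structures.
From mathcomp Require Import all_boot all_algebra.
From mathcomp Require Import boolp functions.
From mathcomp Require Import zify.
Require Import Defs.

(** Write [O] for the universal ring [CPring A J]. The three conditions are linked
    in a circle, from condition (K) to the injectivity of every [omega_eta], from
    there to the gradedness of every ideal, and back to condition (K).

    From (K) to injectivity ([condL_separates], [condK_injective]). Let [h] be a
    homomorphism from [O] that is injective on the coefficients [R], and such that
    [J] contains every [r] whose image is compact, that is, a sum of products
    [T q · S p]. By (FS), elements of positive degree have left units and elements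
    of negative degree right units made of compact operators, and multiplying by
    long words of letters on both sides compresses every homogeneous element into
    [R] ([hdeg_reduce]). So [h] is injective on each homogeneous part
    ([homogeneous_injective]). If [h] kills a sum of homogeneous elements that are
    not all zero, take one that spans as few consecutive degrees as possible. It
    can be moved to start in degree 0 and compressed until its bottom term is some
    [sigma r], while its top term, of degree [n], is [T^n w] for a tensor [w]. By
    minimality [r] determines [w]
    and conversely, and the map from [r] to [w] is an invariant cycle inside [J],
    against condition (L).

    From injectivity to gradedness ([injective_graded]). An ideal [H] of [O] is
    the kernel of the representation on [O / H]. If [omega_eta] is injective for
    it, then [H] is the kernel of the degree-preserving map [kappa] from [O] to
    the universal ring of the quotient system. The degrees of the latter are
    independent ([hdeg_independent]), as one sees by letting the ring act on
    families indexed by the integers, with a shift by the degree; so [H] is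
    graded.

    From gradedness to (K) ([graded_condK]). Suppose that a cycle [eta] on an ideal
    [I] inside [J] exists, in a quotient system. Multiplication by the cycle,
    [u (sigma x) = T^n (eta x)], ought to extend to a bimodule map of degree [n]
    on the ideal generated by [sigma I], and the span of all [y - u y] is then an
    ideal. It is not graded: otherwise it would contain [sigma x], but an
    equation [sigma x = \sum_d (y_d - u y_d)] telescopes along the degrees to
    [x = 0] ([cycle_difference_sigma]). There are two difficulties. First, [u] need
    not be well defined, because [T^n (eta x)] need not have compact right units.
    So the graph of [u] is used instead, together with the observation that it is
    the graph of an injective map up to elements that are killed by all long
    words ([cycle_graph_evanescent]). Second, one must know that [sigma x] and
    [T^n (eta x)] do not vanish in [O] for [x] nonzero in [I]. This is seen on
    sequences of tensors modulo those that are eventually zero: compact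
    coefficients act there as they should ([germ_invariant]), and [I] acts
    faithfully. *)

Set Implicit Arguments.
Unset Strict Implicit.
Unset Printing Implicit Defensive.

Import GRing.Theory.
Local Open Scope ring_scope.

Arguments repP {R A} c : simpl never.
Arguments repQ {R A} c : simpl never.
Arguments repR {R A} c : simpl never.
Arguments target {R A} c : simpl never.

(** * Supported elements and words in a covariant representation *)

Section Supports.
Variables (R : rngType) (A : rsystem R) (C : covrep A).
Local Notation P := (sysP A).
Local Notation Q := (sysQ A).
Local Notation S := (repP C).
Local Notation T := (repQ C).
Local Notation sigma := (repR C).
Local Notation B := (target C).
Implicit Types (x y : B) (p : P) (q : Q) (r : R).

(** The right ideal on which the compact operators [T q · S p] act from the left
    with local units. *)
Definition lsupp : zmodClosed B := span (fun x => exists q y, x = T q · y).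
Definition rsupp : zmodClosed B := span (fun x => exists y p, x = y · S p).

Lemma lsupp_T q y : T q · y \in lsupp.
Proof. by apply: mem_span; exists q, y. Qed.

Lemma rsupp_S y p : y · S p \in rsupp.
Proof. by apply: mem_span; exists y, p. Qed.

Lemma lsuppMr x y : x \in lsupp -> x · y \in lsupp.
Proof.
apply: (@span_map _ _ (fun a : B => a · y)) => [a b|_ [q [z ->]]].
  exact: rmulDl.
by rewrite -rmulA lsupp_T.
Qed.

Lemma rsuppMl x y : x \in rsupp -> y · x \in rsupp.
Proof.
apply: (@span_map _ _ (fun a : B => y · a)) => [a b|_ [z [p ->]]].
  exact: rmulDr.
by rewrite rmulA rsupp_S.
Qed.

Lemma lsupp_seq x : x \in lsupp ->
  exists l : seq (Q * B), x = \sum_(v <- l) T v.1 · v.2.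
Proof.
move=> /spanP; elim=> {x} [|_ [q [y ->]]|x y _ [l ->] _ [m ->]].
- by exists [::]; rewrite big_nil.
- by exists [:: (q, y)]; rewrite big_seq1.
- exists (l ++ [seq (v.1, - v.2) | v <- m]); rewrite big_cat big_map -sumrN.
  by congr (_ + _); apply: eq_bigr => v _; rewrite rmulNr.
Qed.

Lemma rsupp_seq x : x \in rsupp ->
  exists l : seq (B * P), x = \sum_(v <- l) v.1 · S v.2.
Proof.
move=> /spanP; elim=> {x} [|_ [y [p ->]]|x y _ [l ->] _ [m ->]].
- by exists [::]; rewrite big_nil.
- by exists [:: (y, p)]; rewrite big_seq1.
- exists (l ++ [seq (- v.1, v.2) | v <- m]); rewrite big_cat big_map -sumrN.
  by congr (_ + _); apply: eq_bigr => v _; rewrite rmulNl.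
Qed.

Hypothesis hFS : condFS A.

Lemma T_lsupp q : T q \in lsupp.
Proof.
have [s hs] := condFS_Q hFS [:: q].
rewrite [q]hs ?mem_head // (morphD_sum (@repQD _ _ C)).
by apply: rpred_sum => u _; rewrite repQr lsupp_T.
Qed.

Lemma S_rsupp p : S p \in rsupp.
Proof.
have [s hs] := condFS_P hFS [:: p].
rewrite [p]hs ?mem_head // (morphD_sum (@repPD _ _ C)).
by apply: rpred_sum => u _; rewrite repPl rsupp_S.
Qed.

(** Condition (FS), applied to the finitely many left factors of [x], provides
    a left unit of [x] in the span of the [T q · S p]. These units replace the
    missing identity of the ring throughout. *)
Lemma lsupp_unit x : x \in lsupp ->
  exists s : seq (Q * P), x = \sum_(u <- s) T u.1 · (S u.2 · x).
Proof.
move=> /lsupp_seq[l ->]; have [s hs] := condFS_Q hFS [seq v.1 | v <- l].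
exists s; under [RHS]eq_bigr => u _.
  rewrite !rmul_sumr; under eq_bigr => v _.
    rewrite !(rmulA (S _)) -rep_psi rmulA -repQr; over.
  over.
rewrite exchange_big /= big_seq [RHS]big_seq; apply: eq_bigr => v vl.
by rewrite -rmul_suml -(morphD_sum (@repQD _ _ C)) -hs ?map_f.
Qed.

Lemma rsupp_unit x : x \in rsupp ->
  exists s : seq (P * Q), x = \sum_(u <- s) x · T u.2 · S u.1.
Proof.
move=> /rsupp_seq[l ->]; have [s hs] := condFS_P hFS [seq v.2 | v <- l].
exists s; under [RHS]eq_bigr => u _.
  rewrite !rmul_suml; under eq_bigr => v _.
    rewrite -(rmulA v.1) -rep_psi -rmulA -repPl; over.
  over.
rewrite exchange_big /= big_seq [RHS]big_seq; apply: eq_bigr => v vl.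
by rewrite -rmul_sumr -(morphD_sum (@repPD _ _ C)) -hs ?map_f.
Qed.

Lemma lsupp_eq0 x : x \in lsupp -> (forall p, S p · x = 0) -> x = 0.
Proof.
by move=> /lsupp_unit[s hs] h; rewrite hs big1 // => u _; rewrite h rmul0r.
Qed.

Lemma rsupp_eq0 x : x \in rsupp -> (forall q, x · T q = 0) -> x = 0.
Proof.
by move=> /rsupp_unit[s hs] h; rewrite hs big1 // => u _; rewrite h rmul0l.
Qed.

Lemma lsupp_neq0 x : x \in lsupp -> x <> 0 -> exists p, S p · x <> 0.
Proof.
move=> hx; apply: contra_notP => h; apply: lsupp_eq0 => // p.
by apply: contrapT => hp; apply: h; exists p.
Qed.

Lemma rsupp_neq0 x : x \in rsupp -> x <> 0 -> exists q, x · T q <> 0.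
Proof.
move=> hx; apply: contra_notP => h; apply: rsupp_eq0 => // q.
by apply: contrapT => hq; apply: h; exists q.
Qed.

(** Words are listed from the letter next to [x] outwards: for
    [ps = [:: p1; ...; pk]], [Sw ps x] is [S pk · ... · S p1 · x]. *)
Fixpoint Sw (ps : seq P) x : B := if ps is p :: ps then Sw ps (S p · x) else x.
Fixpoint Tw (qs : seq Q) x : B := if qs is q :: qs then Tw qs (x · T q) else x.

Lemma SwD ps : {morph Sw ps : x y / x + y}.
Proof. by elim: ps => //= p ps IH x y; rewrite rmulDr IH. Qed.
Lemma TwD qs : {morph Tw qs : x y / x + y}.
Proof. by elim: qs => //= q qs IH x y; rewrite rmulDl IH. Qed.

Lemma SwMr ps x y : Sw ps (x · y) = Sw ps x · y.
Proof. by elim: ps x => //= p ps IH x; rewrite rmulA IH. Qed.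
Lemma TwMl qs x y : Tw qs (x · y) = x · Tw qs y.
Proof. by elim: qs y => //= q qs IH y; rewrite -rmulA IH. Qed.

Lemma SwTw ps qs x : Sw ps (Tw qs x) = Tw qs (Sw ps x).
Proof. by elim: qs x => //= q qs IH x; rewrite IH SwMr. Qed.

Lemma Sw_cat ps ps' x : Sw (ps ++ ps') x = Sw ps' (Sw ps x).
Proof. by elim: ps x => /=. Qed.
Lemma Tw_cat qs qs' x : Tw (qs ++ qs') x = Tw qs' (Tw qs x).
Proof. by elim: qs x => /=. Qed.

Lemma Sw0 ps : Sw ps 0 = 0. Proof. exact/morphD0/SwD. Qed.
Lemma Tw0 qs : Tw qs 0 = 0. Proof. exact/morphD0/TwD. Qed.

(** What [Sw ps (Tw qs (sigma r))] becomes once the facing letters have been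
    contracted by [psi]; see [Sw_Tw_sigma]. *)
Fixpoint psi_word (r : R) (ps : seq P) (qs : seq Q) : R :=
  match ps, qs with
  | p :: ps, q :: qs => psi_word (psi ((p <· r) ⊗ q)) ps qs
  | _, _ => r
  end.

Lemma Sw_Tw_sigma r ps qs : size ps = size qs ->
  Sw ps (Tw qs (sigma r)) = sigma (psi_word r ps qs).
Proof.
elim: ps qs r => [|p ps IH] [|q qs] r //= [hs].
by rewrite -TwMl rmulA -repPr -rep_psi IH.
Qed.

End Supports.
Arguments lsupp {R A} C.
Arguments rsupp {R A} C.

(** * Homogeneous elements and graded sub-bimodules *)

Section Degrees.
Variables (R : rngType) (A : rsystem R) (C : covrep A).
Local Notation P := (sysP A).
Local Notation Q := (sysQ A).
Local Notation S := (repP C).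
Local Notation T := (repQ C).
Local Notation sigma := (repR C).
Local Notation B := (target C).
Implicit Types (x y : B) (p : P) (q : Q) (r : R) (d e : int).

Inductive hmon : int -> B -> Prop :=
| hmonR r : hmon 0 (sigma r)
| hmonP p : hmon (-1) (S p)
| hmonQ q : hmon 1 (T q)
| hmonlR r d x : hmon d x -> hmon d (sigma r · x)
| hmonlP p d x : hmon d x -> hmon (d - 1) (S p · x)
| hmonlQ q d x : hmon d x -> hmon (d + 1) (T q · x).

(** In a universal ring this is [CPdeg] (see [hdeg_CPdeg] and [CPdeg_hdeg]); but
    it makes sense in every representation, and here products of degrees [d] and
    [e] have degree [d + e] without any case distinction on signs. *)
Definition hdeg d : zmodClosed B := span (hmon d).

Lemma hdegR r : sigma r \in hdeg 0. Proof. exact/mem_span/hmonR. Qed.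
Lemma hdegP p : S p \in hdeg (-1). Proof. exact/mem_span/hmonP. Qed.
Lemma hdegQ q : T q \in hdeg 1. Proof. exact/mem_span/hmonQ. Qed.

Lemma hdeg_lR r d x : x \in hdeg d -> sigma r · x \in hdeg d.
Proof.
apply: (@span_map _ _ (fun a : B => sigma r · a)); first exact: rmulDr.
by move=> y hy; apply: mem_span; exact: hmonlR.
Qed.
Lemma hdeg_lP p d e x : e = d - 1 -> x \in hdeg d -> S p · x \in hdeg e.
Proof.
move=> ->; apply: (@span_map _ _ (fun a : B => S p · a)); first exact: rmulDr.
by move=> y hy; apply: mem_span; exact: hmonlP.
Qed.
Lemma hdeg_lQ q d e x : e = d + 1 -> x \in hdeg d -> T q · x \in hdeg e.
Proof.
move=> ->; apply: (@span_map _ _ (fun a : B => T q · a)); first exact: rmulDr.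
by move=> y hy; apply: mem_span; exact: hmonlQ.
Qed.

(** It suffices to test [y] against single letters, since [x] is a product of
    letters; this yields products and right multiplications alike. *)
Lemma hmon_right d x y e :
  (forall r, sigma r · y \in hdeg e) -> (forall p, S p · y \in hdeg (e - 1)) ->
  (forall q, T q · y \in hdeg (e + 1)) -> hmon d x -> x · y \in hdeg (d + e).
Proof.
move=> hR hP hQ; elim=> {d x} [r|p|q|r d x _ IH|p d x _ IH|q d x _ IH].
- by rewrite add0r.
- by rewrite addrC.
- by rewrite addrC.
- by rewrite -rmulA hdeg_lR.
- by rewrite -rmulA (hdeg_lP _ _ IH) // addrAC.
- by rewrite -rmulA (hdeg_lQ _ _ IH) // addrAC.
Qed.

Lemma hdeg_right d x y e :
  (forall r, sigma r · y \in hdeg e) -> (forall p, S p · y \in hdeg (e - 1)) ->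
  (forall q, T q · y \in hdeg (e + 1)) -> x \in hdeg d -> x · y \in hdeg (d + e).
Proof.
move=> hR hP hQ; apply: (@span_map _ _ (fun a : B => a · y)) => [a b|z].
  exact: rmulDl.
exact: hmon_right.
Qed.

Lemma hdegM d e x y : x \in hdeg d -> y \in hdeg e -> x · y \in hdeg (d + e).
Proof.
move=> hx hy; apply: hdeg_right hx => [r|p|q].
- exact: hdeg_lR.
- exact: hdeg_lP hy.
- exact: hdeg_lQ hy.
Qed.

Lemma hdeg_rR r d x : x \in hdeg d -> x · sigma r \in hdeg d.
Proof.
move=> hx; rewrite -[d]addr0; apply: hdeg_right => // [s|p|q].
- by rewrite -repRM hdegR.
- by rewrite -repPr hdegP.
- by rewrite -repQr hdegQ.
Qed.
Lemma hdeg_rQ q d e x : e = d + 1 -> x \in hdeg d -> x · T q \in hdeg e.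
Proof.
move=> -> hx; apply: hdeg_right => // [s|p|q'].
- by rewrite -repQl hdegQ.
- by rewrite -rep_psi hdegR.
- exact: hdeg_lQ (hdegQ q).
Qed.
Lemma hdeg_rP p d e x : e = d - 1 -> x \in hdeg d -> x · S p \in hdeg e.
Proof.
move=> -> hx; apply: hdeg_right => // [s|p'|q].
- by rewrite -repPl hdegP.
- exact: hdeg_lP (hdegP p).
- exact: hdeg_lQ (hdegP p).
Qed.

Section Generated.
Variable G : B -> Prop.

Inductive gmon : int -> B -> Prop :=
| gmonG x : G x -> gmon 0 x
| gmonlR r d x : gmon d x -> gmon d (sigma r · x)
| gmonlP p d x : gmon d x -> gmon (d - 1) (S p · x)
| gmonlQ q d x : gmon d x -> gmon (d + 1) (T q · x)
| gmonrR r d x : gmon d x -> gmon d (x · sigma r)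
| gmonrP p d x : gmon d x -> gmon (d - 1) (x · S p)
| gmonrQ q d x : gmon d x -> gmon (d + 1) (x · T q).

(** The component of degree [d] of the sub-bimodule generated by [G], where the
    elements of [G] are given degree 0. *)
Definition gdeg d : zmodClosed B := span (gmon d).

Lemma gdegG x : G x -> x \in gdeg 0.
Proof. by move=> h; apply/mem_span/gmonG. Qed.

Lemma gdeg_lR r d x : x \in gdeg d -> sigma r · x \in gdeg d.
Proof.
apply: (@span_map _ _ (fun a : B => sigma r · a)); first exact: rmulDr.
by move=> y hy; apply: mem_span; exact: gmonlR.
Qed.
Lemma gdeg_lP p d x : x \in gdeg d -> S p · x \in gdeg (d - 1).
Proof.
apply: (@span_map _ _ (fun a : B => S p · a)); first exact: rmulDr.
by move=> y hy; apply: mem_span; exact: gmonlP.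
Qed.
Lemma gdeg_lQ q d x : x \in gdeg d -> T q · x \in gdeg (d + 1).
Proof.
apply: (@span_map _ _ (fun a : B => T q · a)); first exact: rmulDr.
by move=> y hy; apply: mem_span; exact: gmonlQ.
Qed.
Lemma gdeg_rR r d x : x \in gdeg d -> x · sigma r \in gdeg d.
Proof.
apply: (@span_map _ _ (fun a : B => a · sigma r)) => [a b|y hy].
  exact: rmulDl.
by apply: mem_span; exact: gmonrR.
Qed.
Lemma gdeg_rP p d x : x \in gdeg d -> x · S p \in gdeg (d - 1).
Proof.
apply: (@span_map _ _ (fun a : B => a · S p)) => [a b|y hy].
  exact: rmulDl.
by apply: mem_span; exact: gmonrP.
Qed.
Lemma gdeg_rQ q d x : x \in gdeg d -> x · T q \in gdeg (d + 1).
Proof.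
apply: (@span_map _ _ (fun a : B => a · T q)) => [a b|y hy].
  exact: rmulDl.
by apply: mem_span; exact: gmonrQ.
Qed.

Hypothesis G0 : G 0.
Hypothesis GB : forall x y, G x -> G y -> G (x - y).
Hypothesis Gpsi : forall p x q, G x -> G (S p · x · T q).

Lemma G_words ps qs x : size ps = size qs -> G x -> G (Sw ps (Tw qs x)).
Proof.
elim: ps qs x => [|p ps IH] [|q qs] x //= [hs] hx.
by rewrite -TwMl rmulA; apply: IH => //; exact: Gpsi.
Qed.

(** The letters of long words absorb all the factors of an element of the
    generated sub-bimodule, so that only [G] remains. *)
Lemma gdeg_reduce d x : x \in gdeg d -> exists N, forall ps qs,
  (N <= size ps)%N -> (N <= size qs)%N -> (size ps)%:Z = (size qs)%:Z + d ->
  G (Sw ps (Tw qs x)).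
Proof.
move=> /spanP; elim=> {x} [|x|x y _ [N hN] _ [M hM]].
- by exists 0%N => ps qs *; rewrite Tw0 Sw0.
- elim=> {d x} [x hx|r d x _ [N hN]|p d x _ [N hN]|q d x _ [N hN]
    |r d x _ [N hN]|p d x _ [N hN]|q d x _ [N hN]].
  + by exists 0%N => ps qs _ _ hs; apply: G_words => //; lia.
  + exists N.+1 => [[|p ps]] //= qs h1 h2 hs.
    rewrite TwMl rmulA -repPr.
    by apply: (hN ((p <· r) :: ps)) => //=; lia.
  + exists N => ps qs h1 h2 hs; rewrite TwMl.
    by apply: (hN (p :: ps)) => //=; lia.
  + exists N.+2 => [[|p [|p' ps]]] //= qs h1 h2 hs.
    rewrite TwMl (rmulA (S p)) -rep_psi rmulA -repPr.
    by apply: (hN ((p' <· _) :: ps)) => //=; lia.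
  + exists N.+1 => ps [|q qs] //= h1 h2 hs.
    rewrite -rmulA -repQl.
    by apply: (hN ps ((r ·> q) :: qs)) => //=; lia.
  + exists N.+2 => ps [|q [|q' qs]] //= h1 h2 hs.
    rewrite -(rmulA x) -rep_psi -(rmulA x) -repQl.
    by apply: (hN ps ((_ ·> q') :: qs)) => //=; lia.
  + exists N => ps qs h1 h2 hs.
    by apply: (hN ps (q :: qs)) => //=; lia.
- exists (maxn N M) => ps qs h1 h2 hs.
  rewrite (morphDB (TwD qs)) (morphDB (SwD ps)).
  by apply: GB; [apply: hN|apply: hM] => //; lia.
Qed.
End Generated.

Hypothesis hFS : condFS A.

(** The letters are themselves in the sub-bimodule generated by [sigma R]: by (FS),
    [T q] is a sum of terms [T q' · sigma r], and dually for [S p]. *)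
Lemma hdeg_gdeg d : {subset hdeg d <= gdeg (fun x => exists r, x = sigma r) d}.
Proof.
apply: span_sub => x; elim=> {d x} [r|p|q|r d x _ IH|p d x _ IH|q d x _ IH].
- by apply: gdegG; exists r.
- have [s hs] := condFS_P hFS [:: p].
  rewrite [p]hs ?mem_head // (morphD_sum (@repPD _ _ C)).
  apply: rpred_sum => u _; rewrite repPl -[-1]add0r.
  by apply: gdeg_rP; apply: gdegG; eexists.
- have [s hs] := condFS_Q hFS [:: q].
  rewrite [q]hs ?mem_head // (morphD_sum (@repQD _ _ C)).
  apply: rpred_sum => u _; rewrite repQr -[1]add0r.
  by apply: gdeg_lQ; apply: gdegG; eexists.
- exact: gdeg_lR.
- exact: gdeg_lP.
- exact: gdeg_lQ.
Qed.

(** Long words compress every homogeneous element into the coefficient ring.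
    This takes the place of the filtration of the core by the powers of the
    compact operators. *)
Lemma hdeg_reduce d x : x \in hdeg d -> exists N, forall ps qs,
  (N <= size ps)%N -> (N <= size qs)%N -> (size ps)%:Z = (size qs)%:Z + d ->
  exists r, Sw ps (Tw qs x) = sigma r.
Proof.
move=> /hdeg_gdeg; apply: gdeg_reduce.
- by exists 0; rewrite (morphD0 (@repRD _ _ C)).
- by move=> _ _ [r ->] [s ->]; exists (r - s); rewrite (morphDB (@repRD _ _ C)).
- move=> p _ q [r ->]; exists (psi ((p <· r) ⊗ q)).
  by rewrite rep_psi repPr.
Qed.

End Degrees.
Arguments hdeg {R A} C d.
Arguments gdeg {R A} C G d.

(** * Tensor powers and normal forms *)

Section NormalForms.
Variables (R : rngType) (A : rsystem R) (C : covrep A).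
Local Notation P := (sysP A).
Local Notation Q := (sysQ A).
Local Notation S := (repP C).
Local Notation T := (repQ C).
Local Notation sigma := (repR C).
Local Notation B := (target C).
Implicit Types (x y : B) (p : P) (q : Q) (r : R) (d e : int).

Lemma TpowD n : {morph @Tpow R A C n : v w / v + w}.
Proof. exact: (Tpow_lin C n).1. Qed.
Lemma Tpowl n r (w : tpow Q n) : Tpow C (r ·> w) = sigma r · Tpow C w.
Proof. exact: (Tpow_lin C n).2. Qed.
Lemma SpowD n : {morph @Spow R A C n : v w / v + w}.
Proof. exact: (Spow_lin C n).1. Qed.
Lemma Spowl n r (w : tpow P n) : Spow C (r ·> w) = sigma r · Spow C w.
Proof. exact: (Spow_lin C n).2. Qed.

Lemma Sp_add p n : {morph @Sp R A p n : v w / v + w}.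
Proof.
apply: tliftD; split=> [m m' v|m v v'|m r v].
- by rewrite psiDr lactDl.
- by rewrite lactDr.
- by rewrite psir lactA.
Qed.

Lemma Tpowr n (w : tpow Q n) r : Tpow C (w <· r) = Tpow C w · sigma r.
Proof.
elim: n w => [|n IH]; first by move=> q; exact: repQr.
apply: tensor_ext => [v w|v w|q w].
- by rewrite ractDl TpowD.
- by rewrite TpowD rmulDl.
- by rewrite ract_tpure !Tpow_pure IH rmulA.
Qed.

Lemma Tpow_snoc n (w : tpow Q n) q : Tpow C (tsnoc w q) = Tpow C w · T q.
Proof.
elim: n w => [|n IH]; first by move=> q0; exact: (Tpow_pure C (n := 0)).
apply: tensor_ext => [v w|v w|q0 w].
- by rewrite tsnocDl TpowD.
- by rewrite TpowD rmulDl.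
- by rewrite tsnoc_pure (Tpow_pure _ (n := n.+1)) IH Tpow_pure rmulA.
Qed.

Lemma S_Tpow p n (w : tpow Q n.+1) : S p · Tpow C w = Tpow C (Sp p w).
Proof.
move: w; apply: tensor_ext => [v w|v w|q w].
- by rewrite TpowD rmulDr.
- by rewrite Sp_add TpowD.
- by rewrite Tpow_pure SpE Tpowl rep_psi rmulA.
Qed.

Lemma hdeg_Tpow n (w : tpow Q n) : Tpow C w \in hdeg C n.+1%:Z.
Proof.
elim: n w => [|n IH]; first by move=> q; exact: hdegQ.
apply: tensor_ind => [|x|x y|q w].
- by rewrite (morphD0 (@TpowD _)) rpred0.
- by rewrite (morphDN (@TpowD _)) rpredN.
- by rewrite TpowD; exact: rpredD.
- by rewrite Tpow_pure (hdeg_lQ _ _ (IH w)) //; lia.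
Qed.

Lemma hdeg_Spow n (w : tpow P n) : Spow C w \in hdeg C (- n.+1%:Z).
Proof.
elim: n w => [|n IH]; first by move=> q; exact: hdegP.
apply: tensor_ind => [|x|x y|q w].
- by rewrite (morphD0 (@SpowD _)) rpred0.
- by rewrite (morphDN (@SpowD _)) rpredN.
- by rewrite SpowD; exact: rpredD.
- by rewrite Spow_pure (hdeg_lP _ _ (IH w)) //; lia.
Qed.

Lemma hdeg_TSpow j k (w : tpow Q j) (v : tpow P k) :
  Tpow C w · Spow C v \in hdeg C (j%:Z - k%:Z).
Proof.
have hw := hdeg_Tpow w; elim: k v => [|k IH].
  by move=> p; apply: (hdeg_rP _ _ hw); lia.
apply: tensor_ind => [|x|x y|p v].
- by rewrite (morphD0 (@SpowD _)) rmul0r rpred0.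
- by rewrite (morphDN (@SpowD _)) rmulNr rpredN.
- by rewrite SpowD rmulDr; exact: rpredD.
suff h (y : B) d e : e = d - k.+1%:Z -> y \in hdeg C d ->
    y · Spow C v \in hdeg C e.
  rewrite Spow_pure rmulA; apply: (h _ j%:Z); first by lia.
  by apply: (hdeg_rP _ _ hw); lia.
clear; elim: k v y d e => [|k IH].
  by move=> p y d e he hy; apply: (hdeg_rP _ he hy).
move=> v y d e he hy; move: v; apply: tensor_ind => [|x|x z|p v].
- by rewrite (morphD0 (@SpowD _)) rmul0r rpred0.
- by rewrite (morphDN (@SpowD _)) rmulNr rpredN.
- by rewrite SpowD rmulDr; exact: rpredD.
rewrite Spow_pure rmulA; apply: (IH _ _ (d - 1)); first by lia.
exact: hdeg_rP hy.
Qed.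

(** The spanning elements of the graded parts, indexed without subtracting
    exponents in the types of the tensors. *)
Inductive nform : int -> B -> Prop :=
| nformR r : nform 0 (sigma r)
| nformQ j (w : tpow Q j) : nform j.+1%:Z (Tpow C w)
| nformP k (v : tpow P k) : nform (- k.+1%:Z) (Spow C v)
| nformQP j k (w : tpow Q j) (v : tpow P k) :
    nform (j%:Z - k%:Z) (Tpow C w · Spow C v).

Lemma nform_hdeg d : {subset span (nform d) <= hdeg C d}.
Proof.
apply: span_sub => _ [r|j w|k v|j k w v].
- exact: hdegR.
- exact: hdeg_Tpow.
- exact: hdeg_Spow.
- exact: hdeg_TSpow.
Qed.

Lemma nform_lR r d x : x \in span (nform d) -> sigma r · x \in span (nform d).
Proof.
apply: (@span_map _ _ (fun a : B => sigma r · a)); first exact: rmulDr.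
move=> _ [s|j w|k v|j k w v]; rewrite ?rmulA -?repRM -?Tpowl -?Spowl;
  apply: mem_span; by constructor.
Qed.

Lemma nform_lQ q d x : x \in span (nform d) -> T q · x \in span (nform (d + 1)).
Proof.
apply: (@span_map _ _ (fun a : B => T q · a)); first exact: rmulDr.
move=> _ [s|j w|k v|j k w v].
- by rewrite -repQr add0r; apply: mem_span; exact: (nformQ (j := 0)).
- rewrite -Tpow_pure; have -> : j.+1%:Z + 1 = j.+2%:Z by lia.
  by apply: mem_span; exact: (nformQ (j := j.+1)).
- have -> : - k.+1%:Z + 1 = 0%:Z - k%:Z by lia.
  by apply: mem_span; exact: (nformQP (j := 0)).
- rewrite rmulA -Tpow_pure; have -> : j%:Z - k%:Z + 1 = j.+1%:Z - k%:Z by lia.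
  by apply: mem_span; exact: (nformQP (j := j.+1)).
Qed.

Lemma nform_lP p d x : x \in span (nform d) -> S p · x \in span (nform (d - 1)).
Proof.
apply: (@span_map _ _ (fun a : B => S p · a)); first exact: rmulDr.
move=> _ [s|j w|k v|j k w v].
- by rewrite -repPr sub0r; apply: mem_span; exact: (nformP (k := 0)).
- case: j w => [|j] w.
    by rewrite -rep_psi subrr; apply: mem_span; exact: nformR.
  rewrite S_Tpow; have -> : j.+2%:Z - 1 = j.+1%:Z by lia.
  by apply: mem_span; exact: nformQ.
- rewrite -Spow_pure; have -> : - k.+1%:Z - 1 = - k.+2%:Z by lia.
  by apply: mem_span; exact: (nformP (k := k.+1)).
- rewrite rmulA; case: j w => [|j] w.
    rewrite -rep_psi -Spowl; have -> : 0%:Z - k%:Z - 1 = - k.+1%:Z by lia.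
    by apply: mem_span; exact: nformP.
  rewrite S_Tpow; have -> : j.+1%:Z - k%:Z - 1 = j%:Z - k%:Z by lia.
  by apply: mem_span; exact: nformQP.
Qed.

Lemma hdeg_nform d : {subset hdeg C d <= span (nform d)}.
Proof.
apply: span_sub => x; elim=> {d x} [r|p|q|r d x _|p d x _|q d x _].
- by apply: mem_span; exact: nformR.
- by apply: mem_span; exact: (nformP (k := 0)).
- by apply: mem_span; exact: (nformQ (j := 0)).
- exact: nform_lR.
- exact: nform_lP.
- exact: nform_lQ.
Qed.

Hypothesis hFS : condFS A.

Lemma Tpow_lsupp n (w : tpow Q n) : Tpow C w \in lsupp C.
Proof.
case: n w => [|n]; first by move=> q; exact: T_lsupp.
apply: tensor_ind => [|x|x y|q w].
- by rewrite (morphD0 (@TpowD _)) rpred0.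
- by rewrite (morphDN (@TpowD _)) rpredN.
- by rewrite TpowD; exact: rpredD.
- by rewrite Tpow_pure lsupp_T.
Qed.

Lemma Spow_rsupp n (w : tpow P n) : Spow C w \in rsupp C.
Proof.
elim: n w => [|n IH]; first by move=> q; exact: S_rsupp.
apply: tensor_ind => [|x|x y|q w].
- by rewrite (morphD0 (@SpowD _)) rpred0.
- by rewrite (morphDN (@SpowD _)) rpredN.
- by rewrite SpowD; exact: rpredD.
- by rewrite Spow_pure; apply: rsuppMl.
Qed.

Lemma hdeg_lsupp d x : 0 < d -> x \in hdeg C d -> x \in lsupp C.
Proof.
move=> hd /hdeg_nform; move: x; apply: span_sub => x hx.
case: hx hd => {d x} // [j w|j k w v] _; first exact: Tpow_lsupp.
exact/lsuppMr/Tpow_lsupp.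
Qed.

Lemma hdeg_rsupp d x : d < 0 -> x \in hdeg C d -> x \in rsupp C.
Proof.
move=> hd /hdeg_nform; move: x; apply: span_sub => x hx.
case: hx hd => {d x} // [j w|j k w v] _; first exact: Spow_rsupp.
exact/rsuppMl/Spow_rsupp.
Qed.

(** Only the coefficient ring prevents the elements of degree 0 from having units
    on both sides. *)
Lemma hdeg0_split x : x \in hdeg C 0 -> exists r y,
  [/\ x = sigma r + y, y \in lsupp C & y \in rsupp C].
Proof.
move=> /hdeg_nform /spanP; elim=> {x} [|x|x y _ [r [x' [-> h1 h2]]] _ [s [y' [-> h3 h4]]]].
- by exists 0, 0; rewrite (morphD0 (@repRD _ _ C)) addr0 !rpred0.
- move: {1 3}0 (erefl (0 : int)) => d hd hx; case: hx hd => {d x} // [r|j k w v] _.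
    by exists r, 0; rewrite addr0 !rpred0.
  exists 0, (Tpow C w · Spow C v); rewrite (morphD0 (@repRD _ _ C)) add0r; split=> //.
    exact/lsuppMr/Tpow_lsupp.
  exact/rsuppMl/Spow_rsupp.
- exists (r - s), (x' - y'); rewrite (morphDB (@repRD _ _ C)) !rpredB //; split=> //.
  by rewrite opprD addrACA.
Qed.

(** Peeling off one left unit at a time recovers [y] from its reductions by words
    of [n + 1] letters of [P], as a tensor of [n + 1] letters of [Q]. *)
Lemma hdeg_Tpow_sigma n y : y \in hdeg C n.+1%:Z ->
  (forall ps, size ps = n.+1 -> exists r, Sw ps y = sigma r) ->
  exists w : tpow Q n, y = Tpow C w.
Proof.
have hn m : 0 < m.+1%:Z by [].
elim: n y => [|n IH] y hy hw.
  have [s ->] := lsupp_unit hFS (hdeg_lsupp (hn _) hy).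
  have /choice[g hg] p : exists r, S p · y = sigma r.
    by have [r] := hw [:: p] erefl; exists r.
  exists (\sum_(u <- s) (u.1 <· g u.2)).
  rewrite [Tpow C _](morphD_sum (@repQD _ _ C)).
  by apply: eq_bigr => u _; rewrite hg repQr.
have [s ->] := lsupp_unit hFS (hdeg_lsupp (hn _) hy).
have /choice[g hg] p : exists w : tpow Q n, S p · y = Tpow C w.
  apply: IH => [|ps hs]; first by apply: hdeg_lP hy; lia.
  by apply: (hw (p :: ps)); rewrite /= hs.
exists (\sum_(u <- s) (u.1 ⊗ g u.2)); rewrite (morphD_sum (@TpowD n.+1)).
by apply: eq_bigr => u _; rewrite hg Tpow_pure.
Qed.

End NormalForms.

Section UniversalDegrees.
Variables (R : rngType) (A : rsystem R) (J : ideal R).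
Local Notation C := (CPrep A J).

Lemma CPdeg_hdeg d : {subset CPdeg A J d <= hdeg C d}.
Proof.
move=> x hx; apply: nform_hdeg; move: x hx.
case: d => [[|n]|n]; apply: span_sub => _ [[r ->]|[k [w [v ->]]]];
  apply: mem_span.
- exact: nformR.
- by rewrite -[Posz 0](subrr k%:Z); exact: nformQP.
- exact: nformQ.
- have -> : Posz n.+1 = (n + k).+1%:Z - k%:Z by lia.
  exact: nformQP.
- by rewrite NegzE; exact: nformP.
- have -> : Negz n = k%:Z - (n + k).+1%:Z by lia.
  exact: nformQP.
Qed.

Lemma hdeg_CPdeg d : {subset hdeg C d <= CPdeg A J d}.
Proof.
move=> x /hdeg_nform; move: x; apply: span_sub => _ [r|j w|k v|j k w v].
- by apply: mem_span; left; exists r.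
- by apply: mem_span; left; exists w.
- by rewrite -NegzE; apply: mem_span; left; exists v.
have [hjk|hjk|hjk] := ltngtP j k.
- have := subnK hjk; rewrite addnS; move: (k - j.+1)%N => n hn; subst k.
  have -> : j%:Z - (n + j).+1%:Z = Negz n by lia.
  by apply: mem_span; right; exists j, w, v.
- have := subnK hjk; rewrite addnS; move: (j - k.+1)%N => n hn; subst j.
  have -> : (n + k).+1%:Z - k%:Z = Posz n.+1 by lia.
  by apply: mem_span; right; exists k, w, v.
- by subst k; rewrite subrr; apply: mem_span; right; exists j, w, v.
Qed.

End UniversalDegrees.

(** * The uniqueness theorem under condition (L) *)

Definition span_ideal (R : rngType) (X : R -> Prop)
    (Xl : forall r x, X x -> X (r · x)) (Xr : forall r x, X x -> X (x · r)) :
  ideal R :=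
  @Ideal R (span X)
    (fun r => @span_map _ _ (fun a : R => r · a) X (span X) (rmulDr r)
       (fun x hx => mem_span (Xl r x hx)))
    (fun r => @span_map _ _ (fun a : R => a · r) X (span X)
       (fun a b => rmulDl a b r) (fun x hx => mem_span (Xr r x hx))).

Lemma tensor_seq (R : rngType) (M N : bimodType R) (x : tensor M N) :
  exists l : seq (M * N), x = \sum_(v <- l) (v.1 ⊗ v.2).
Proof.
have tN (m : M) (n : N) : (- m) ⊗ n = - (m ⊗ n).
  exact: (@morphDN _ _ (fun a : M => a ⊗ n) (fun a b => tpureDl a b n)).
elim/tensor_ind: x => [|x [l ->]|x y [l ->] [l' ->]|m n].
- by exists [::]; rewrite big_nil.
- exists [seq (- v.1, v.2) | v <- l]; rewrite big_map -sumrN.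
  by apply: eq_bigr => v _; rewrite tN.
- by exists (l ++ l'); rewrite big_cat.
- by exists [:: (m, n)]; rewrite big_seq1.
Qed.

Section Separation.
Variables (R : rngType) (A : rsystem R) (hFS : condFS A).
Local Notation P := (sysP A).
Local Notation Q := (sysQ A).

Lemma psi_sepQ (q : Q) : (forall p, psi (p ⊗ q) = 0) -> q = 0.
Proof.
move=> h; have [s hs] := condFS_Q hFS [:: q].
by rewrite [q]hs ?mem_head // big1 // => u _; rewrite h ract0r.
Qed.

(** (FS) writes [w] as the sum of the [u.1 ⊗ Sp u.2 w], so the contractions
    determine [w]. *)
Lemma tpow_sep n (w : tpow Q n.+1) : (forall p : P, Sp p w = 0) -> w = 0.
Proof.
move=> h; have [l hl] := tensor_seq w.
have [s hs] := condFS_Q hFS [seq v.1 | v <- l].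
suff -> : w = \sum_(u <- s) (u.1 ⊗ Sp u.2 w).
  rewrite big1 // => u _; rewrite h.
  exact: (@morphD0 _ _ (fun a : tpow Q n => u.1 ⊗ a) (tpureDr u.1)).
rewrite {2}hl; under eq_bigr => u _.
  rewrite (morphD_sum (@Sp_add _ _ u.2 n)).
  rewrite (@morphD_sum _ _ (fun a : tpow Q n => u.1 ⊗ a) (tpureDr u.1)).
  under eq_bigr => v _ do rewrite SpE -tpureA.
  over.
rewrite exchange_big hl /= big_seq [RHS]big_seq; apply: eq_bigr => v vl.
rewrite -(@morphD_sum _ _ (fun a : Q => a ⊗ v.2) (fun a b => tpureDl a b v.2)).
by rewrite -hs ?map_f.
Qed.

Lemma Tpow_eq0 (C : covrep A) n (w : tpow Q n) :
  (forall r, repR C r = 0 -> r = 0) -> Tpow C w = 0 -> w = 0.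
Proof.
move=> hR; elim: n w => [|n IH] w hw.
  apply: psi_sepQ => p; apply: hR.
  by rewrite rep_psi (hw : repQ C w = 0) rmul0r.
by apply: tpow_sep => p; apply: IH; rewrite -S_Tpow hw rmul0r.
Qed.

Lemma cp_invariantP (J : ideal R) (C : covrep A) :
  psi_compatible A J ->
  (cp_invariant J C <-> forall x s, x \in J ->
    Delta A x = \sum_(u <- s) thetaQ u.1 u.2 ->
    repR C x = \sum_(u <- s) repQ C u.1 · repP C u.2).
Proof.
move=> hJ; split=> [hC x s xJ hs|hC x xJ].
  by rewrite -hC // hs piTS_sum.
have /FQ_sumP[s hs] := hJ x xJ.
by rewrite (hC x s xJ hs) hs piTS_sum.
Qed.

Lemma cp_invariant_sum (J : ideal R) (C : covrep A) x :
  psi_compatible A J -> cp_invariant J C -> x \in J ->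
  exists s : seq (Q * P), repR C x = \sum_(u <- s) repQ C u.1 · repP C u.2.
Proof.
move=> hJ hC xJ; have /FQ_sumP[s hs] := hJ x xJ; exists s.
by move/(cp_invariantP _ hJ): hC; apply.
Qed.

Lemma iter_ideal_inv (I : inv_ideal A) (J : ideal R) :
  {subset I <= J} -> {subset I <= iter_ideal_infty A J}.
Proof.
move=> hIJ x xI; apply/asboolP => k; elim: k x xI => [|k IH] x xI.
  exact: hIJ.
apply/andP; split; last exact: hIJ.
by apply/asboolP => p q; apply: IH; exact: inv_psi.
Qed.

End Separation.

Section Uniqueness.
Variables (R : rngType) (A : rsystem R) (J : ideal R) (hFS : condFS A).
Local Notation P := (sysP A).
Local Notation Q := (sysQ A).
Hypothesis hJ : psi_compatible A J.
Variable D : covrep A.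
Hypothesis hD : cp_invariant J D.
Hypothesis injD : forall r, repR D r = 0 -> r = 0.
Hypothesis maxD : forall r (s : seq (Q * P)),
  repR D r = \sum_(u <- s) repQ D u.1 · repP D u.2 -> r \in J.
Local Notation C := (CPrep A J).
Local Notation S := (repP C).
Local Notation T := (repQ C).
Local Notation sigma := (repR C).
Local Notation B := (target C).
Local Notation h := (CPlift D : B -> target D).
Implicit Types (x y : B) (p : P) (q : Q) (r : R) (d e : int).

Let hAdd : {morph h : x y / x + y}.
Proof. by have [[]] := CPliftP hFS hD. Qed.
Let hMul x y : h (x · y) = h x · h y.
Proof. by have [[_ hM] _ _ _] := CPliftP hFS hD; exact: hM. Qed.
Let hP p : h (S p) = repP D p.
Proof. by have [_ hp _ _] := CPliftP hFS hD; exact: hp. Qed.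
Let hQ q : h (T q) = repQ D q.
Proof. by have [_ _ hq _] := CPliftP hFS hD; exact: hq. Qed.
Let hR r : h (sigma r) = repR D r.
Proof. by have [_ _ _ hr] := CPliftP hFS hD; exact: hr. Qed.
Let h0 : h 0 = 0. Proof. exact: morphD0. Qed.
Let hMl0 x y : h x = 0 -> h (y · x) = 0.
Proof. by rewrite hMul => ->; rewrite rmul0r. Qed.
Let hMr0 x y : h x = 0 -> h (x · y) = 0.
Proof. by rewrite hMul => ->; rewrite rmul0l. Qed.

Let sigma_eq0 r : sigma r = 0 -> r = 0.
Proof. by move=> hr; apply: injD; rewrite -hR hr. Qed.

Lemma lift_words_eq0 ps qs x : h x = 0 -> h (Sw ps (Tw qs x)) = 0.
Proof.
elim: ps qs x => [|p ps IH] qs x hx /=.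
  by elim: qs x hx => //= q qs IH x hx; apply/IH/hMr0.
by rewrite -TwMl; apply/IH/hMl0.
Qed.

(** Sandwiching the supported part [y] of [x = sigma r + y] between its units
    shows that [y], hence also [D]'s value at [r], is compact; so [r] belongs to
    [J] by maximality, and then all of [x] is supported on both sides. *)
Lemma core_sandwich_eq0 x : x \in hdeg C 0 -> h x = 0 ->
  (forall p q, S p · x · T q = 0) -> x = 0.
Proof.
move=> hx hx0 hpq; have [r [y [xE yl yr]]] := hdeg0_split hFS hx.
have [s hs] := lsupp_unit hFS yl; have [t ht] := rsupp_unit hFS yr.
(* [y = e y f] for its units [e] and [f], and [e x f = 0], so [y = - e (sigma r) f]. *)
pose l := [seq (u.1 <· - psi ((u.2 <· r) ⊗ v.2), v.1) | u <- s, v <- t].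
have hy : y = \sum_(w <- l) T w.1 · S w.2.
  rewrite big_allpairs_dep /= {1}hs; apply: eq_bigr => u _.
  rewrite ht !rmul_sumr; apply: eq_bigr => v _.
  rewrite repQr !rmulA -(rmulA (T u.1)) -(rmulA (T u.1)) (morphDN (@repRD _ _ C)).
  congr (_ · _ · _); rewrite rep_psi repPr.
  apply/eqP; rewrite -addr_eq0 addrC -(rmulA (S _)) -(rmulA (S _)) -rmulDr -rmulDl.
  by rewrite -xE rmulA hpq.
have e0 : repR D r + \sum_(w <- l) repQ D w.1 · repP D w.2 = 0.
  rewrite -[RHS]hx0 xE hAdd hR hy (morphD_sum hAdd); congr (_ + _).
  by apply: eq_bigr => w _; rewrite hMul hQ hP.
have rJ : r \in J.
  apply: (maxD (s := [seq (- w.1, w.2) | w <- l])); rewrite big_map.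
  rewrite -[LHS](addrK (\sum_(w <- l) repQ D w.1 · repP D w.2)) e0 sub0r -sumrN.
  by apply: eq_bigr => w _; rewrite (morphDN (@repQD _ _ D)) rmulNl.
have [m hm] := cp_invariant_sum hFS hJ (CPrep_invariant hJ) rJ.
apply: (lsupp_eq0 hFS) => [|p].
  rewrite xE rpredD // hm; apply: rpred_sum => u _; exact: lsupp_T.
apply: (rsupp_eq0 hFS) => [|q]; last exact: hpq.
apply: rsuppMl; rewrite xE rpredD // hm; apply: rpred_sum => u _.
exact: rsupp_S.
Qed.

Lemma core_words_eq0 N x : x \in hdeg C 0 -> h x = 0 ->
  (forall ps qs, size ps = N -> size qs = N -> Sw ps (Tw qs x) = 0) -> x = 0.
Proof.
elim: N x => [|N IH] x hx hx0 hw; first exact: (hw [::] [::]).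
apply: core_sandwich_eq0 => // p q; apply: IH => [||ps qs hps hqs].
- by apply: (@hdeg_rQ _ _ _ _ (-1)) => //; apply: hdeg_lP hx.
- exact/hMr0/hMl0.
- have := hw (p :: ps) (q :: qs); rewrite /= hps hqs => /(_ erefl erefl).
  by rewrite -TwMl rmulA.
Qed.

Lemma core_injective x : x \in hdeg C 0 -> h x = 0 -> x = 0.
Proof.
move=> hx hx0; have [N hN] := hdeg_reduce hFS hx.
apply: (@core_words_eq0 N) => // ps qs hps hqs.
have [||| r hr] := hN ps qs; rewrite ?hps ?hqs ?addr0 //.
suff r0 : r = 0 by rewrite hr r0 (morphD0 (@repRD _ _ C)).
by apply: injD; rewrite -hR -hr; apply: lift_words_eq0.
Qed.

(** A letter of the right kind moves the degree one step towards 0 without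
    killing the element, because positive degrees are supported on the left and
    negative ones on the right. *)
Lemma homogeneous_injective d x : x \in hdeg C d -> h x = 0 -> x = 0.
Proof.
have hpos n y : y \in hdeg C n%:Z -> h y = 0 -> y = 0.
  elim: n y => [|n IH] y hy hy0; first exact: core_injective.
  apply: (lsupp_eq0 hFS) => [|p]; first exact: (hdeg_lsupp hFS _ hy).
  by apply: IH; [apply: hdeg_lP hy; lia|exact: hMl0].
have hneg n y : y \in hdeg C (- n%:Z) -> h y = 0 -> y = 0.
  elim: n y => [|n IH] y hy hy0; first exact: core_injective.
  apply: (rsupp_eq0 hFS) => [|q]; first exact: (hdeg_rsupp hFS _ hy).
  by apply: IH; [apply: hdeg_rQ hy; lia|exact: hMr0].
by case: d => n; rewrite ?NegzE; [exact: hpos|exact: hneg].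
Qed.

(** The components of a kernel element, in [m + 1] consecutive degrees starting
    at [a]. The degrees are not assumed independent: [separates] for all [m]
    says that they are, even modulo the kernel. *)
Definition kernel_family (m : nat) (a : int) (f : nat -> B) :=
  (forall i, f i \in hdeg C (a + i%:Z)) /\ h (\sum_(i < m.+1) f i) = 0.

Definition separates (m : nat) := forall a f, kernel_family m a f ->
  forall i, (i <= m)%N -> f i = 0.

Lemma separates0 : separates 0.
Proof.
move=> a f [hf]; rewrite big_ord1 => hf0 [|//] _.
exact: homogeneous_injective (hf 0) hf0.
Qed.

Section MinimalFamily.
Variable m : nat.
Hypothesis sep : separates m.
Local Notation fam := (kernel_family m.+1).

(** A family with vanishing bottom is a shorter family, to which minimality
    applies. *)
Lemma family_bottom_eq0 a f : fam a f -> f 0%N = 0 ->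
  forall i, (i <= m.+1)%N -> f i = 0.
Proof.
move=> [hf hf0] f0 [//|i] hi; apply: (sep (a := a + 1) (f := f \o succn)) => //.
split=> [j|].
  by have := hf j.+1; congr (_ \in hdeg C _); lia.
by rewrite big_ord_recl f0 add0r in hf0.
Qed.

Lemma family_top_eq0 a f : fam a f -> f m.+1 = 0 -> f 0%N = 0.
Proof.
move=> [hf hf0] fm; apply: (sep (a := a) (f := f)) => //; split=> //.
by rewrite big_ord_recr /= fm addr0 in hf0.
Qed.

Lemma family_map a b f (g : B -> B) : {morph g : x y / x + y} ->
  (forall x, h x = 0 -> h (g x) = 0) ->
  (forall i x, x \in hdeg C (a + i) -> g x \in hdeg C (b + i)) ->
  fam a f -> fam b (g \o f).
Proof.
move=> gD g0 gd [hf hf0]; split=> [i|]; first exact/gd/hf.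
by rewrite -(morphD_sum gD) g0.
Qed.

Lemma family_lP p a f : fam a f -> fam (a - 1) (fun i => S p · f i).
Proof.
apply: (family_map (g := fun x => S p · x)) => [x y|x|i x hx].
- exact: rmulDr.
- exact: hMl0.
- by apply: hdeg_lP hx; lia.
Qed.

Lemma family_rQ q a f : fam a f -> fam (a + 1) (fun i => f i · T q).
Proof.
apply: (family_map (g := fun x => x · T q)) => [x y|x|i x hx].
- exact: rmulDl.
- exact: hMr0.
- by apply: hdeg_rQ hx; lia.
Qed.

Lemma family_sandwich p q a f : fam a f -> fam a (fun i => S p · f i · T q).
Proof.
by move=> hf; rewrite -[a](subrK 1); apply/family_rQ/family_lP.
Qed.

Lemma family_words ps qs a f : size ps = size qs -> fam a f ->
  fam a (fun i => Sw ps (Tw qs (f i))).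
Proof.
elim: ps qs f => [|p ps IH] [|q qs] f //= [hs] hf.
have := IH qs _ hs (family_sandwich p q hf).
by congr (fam a _); apply/funext => i; rewrite -TwMl rmulA.
Qed.

Lemma family_lR r a f : fam a f -> fam a (fun i => sigma r · f i).
Proof.
apply: (family_map (g := fun x => sigma r · x)) => [x y|x|i x hx].
- exact: rmulDr.
- exact: hMl0.
- exact: hdeg_lR hx.
Qed.

Lemma family_rR r a f : fam a f -> fam a (fun i => f i · sigma r).
Proof.
apply: (family_map (g := fun x => x · sigma r)) => [x y|x|i x hx].
- exact: rmulDl.
- exact: hMr0.
- exact: hdeg_rR hx.
Qed.

Lemma familyB a f g : fam a f -> fam a g -> fam a (fun i => f i - g i).
Proof.
move=> [hf hf0] [hg hg0]; split=> [i|]; first exact: rpredB.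
by rewrite sumrB (morphDB hAdd) hf0 hg0 subrr.
Qed.

(** A nonzero element of degree other than 0 is not killed by all letters of the
    kind that moves its degree towards 0. *)
Lemma family_shift a f : fam a f -> f 0%N <> 0 ->
  exists2 g, fam 0 g & g 0%N <> 0.
Proof.
have hpos n g : fam n%:Z g -> g 0%N <> 0 -> exists2 g, fam 0 g & g 0%N <> 0.
  elim: n g => [|n IH] g hg g0; first by exists g.
  have [|p hp] := lsupp_neq0 hFS _ g0.
    by apply: (hdeg_lsupp hFS _ (hg.1 0)); lia.
  apply: (IH (fun i => S p · g i)) => //.
  by have := family_lP p hg; congr (fam _ _); lia.
have hneg n g : fam (- n%:Z) g -> g 0%N <> 0 -> exists2 g, fam 0 g & g 0%N <> 0.
  elim: n g => [|n IH] g hg g0; first by exists g.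
  have [|q hq] := rsupp_neq0 hFS _ g0.
    by apply: (hdeg_rsupp hFS _ (hg.1 0)); lia.
  apply: (IH (fun i => g i · T q)) => //.
  by have := family_rQ q hg; congr (fam _ _); lia.
by case: a => n; rewrite ?NegzE; [exact: hpos|exact: hneg].
Qed.

(** If all [S p · f 0 · T q] vanished, then so would [S p · f 0], which has degree
    [-1] and so has right units. But then each family [S p · f i] would vanish by
    minimality, and with it the top of [f], which has left units. *)
Lemma family_sandwich_neq0 f : fam 0 f -> f 0%N <> 0 ->
  exists p q, S p · f 0%N · T q <> 0.
Proof.
move=> hf; apply: contra_notP => hpq.
apply: (family_top_eq0 hf); apply: (lsupp_eq0 hFS) => [|p].
  by apply: (hdeg_lsupp hFS _ (hf.1 m.+1)); lia.
apply: (family_bottom_eq0 (family_lP p hf)) => //.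
apply: (rsupp_eq0 hFS) => [|q].
  by apply: (hdeg_rsupp hFS _ ((family_lP p hf).1 0)); lia.
by apply: contrapT => h1; apply: hpq; exists p, q.
Qed.

Lemma family_words_neq0 N f : fam 0 f -> f 0%N <> 0 -> exists ps qs,
  [/\ size ps = N, size qs = N & Sw ps (Tw qs (f 0%N)) <> 0].
Proof.
elim: N f => [|N IH] f hf f0; first by exists [::], [::].
have [p [q hpq]] := family_sandwich_neq0 hf f0.
have [ps [qs [hps hqs hw]]] := IH _ (family_sandwich p q hf) hpq.
exists (p :: ps), (q :: qs); rewrite /= hps hqs; split=> //.
by rewrite -TwMl rmulA.
Qed.

(** The relation underlying the cycle: [w] is the top component of an element
    of the kernel with bottom component [sigma r]. Minimality makes it the graph
    of an injective map. *)
Definition cycle_rel r (w : tpow Q m) := exists f,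
  [/\ fam 0 f, f 0%N = sigma r & f m.+1 = Tpow C w].

Lemma cycle_relB r s v w : cycle_rel r v -> cycle_rel s w ->
  cycle_rel (r - s) (v - w).
Proof.
move=> [f [hf f0 fm]] [g [hg g0 gm]]; exists (fun i => f i - g i); split.
- exact: familyB.
- by rewrite f0 g0 (morphDB (@repRD _ _ C)).
- by rewrite fm gm (morphDB (@TpowD _ _ C m)).
Qed.

Lemma cycle_rel_l s r w : cycle_rel r w -> cycle_rel (s · r) (s ·> w).
Proof.
move=> [f [hf f0 fm]]; exists (fun i => sigma s · f i); split.
- exact: family_lR.
- by rewrite f0 repRM.
- by rewrite fm Tpowl.
Qed.

Lemma cycle_rel_r s r w : cycle_rel r w -> cycle_rel (r · s) (w <· s).
Proof.
move=> [f [hf f0 fm]]; exists (fun i => f i · sigma s); split.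
- exact: family_rR.
- by rewrite f0 repRM.
- by rewrite fm Tpowr.
Qed.

Lemma cycle_rel_psi p q r w : cycle_rel r w ->
  cycle_rel (psi ((p <· r) ⊗ q)) (Sp p (tsnoc w q)).
Proof.
move=> [f [hf f0 fm]]; exists (fun i => S p · f i · T q); split.
- exact: family_sandwich.
- by rewrite f0 -repPr rep_psi.
- by rewrite fm -S_Tpow Tpow_snoc rmulA.
Qed.

Lemma cycle_rel0l w : cycle_rel 0 w -> w = 0.
Proof.
move=> [f [hf f0 fm]]; apply: (Tpow_eq0 hFS sigma_eq0); rewrite -fm.
by apply: (family_bottom_eq0 hf) => //; rewrite f0 (morphD0 (@repRD _ _ C)).
Qed.

Lemma cycle_rel0r r : cycle_rel r 0 -> r = 0.
Proof.
move=> [f [hf f0 fm]]; apply: sigma_eq0; rewrite -f0; apply: (family_top_eq0 hf).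
by rewrite fm (morphD0 (@TpowD _ _ C m)).
Qed.

Lemma cycle_rel_fun r v w : cycle_rel r v -> cycle_rel r w -> v = w.
Proof.
move=> hv hw; apply/eqP; rewrite -subr_eq0; apply/eqP/cycle_rel0l.
by rewrite -(subrr r); exact: cycle_relB.
Qed.

Fact cycle_idealMl s r : (exists w, cycle_rel r w) -> exists w, cycle_rel (s · r) w.
Proof. by case=> w hw; exists (s ·> w); exact: cycle_rel_l. Qed.
Fact cycle_idealMr s r : (exists w, cycle_rel r w) -> exists w, cycle_rel (r · s) w.
Proof. by case=> w hw; exists (w <· s); exact: cycle_rel_r. Qed.

Definition cycle_ideal : ideal R := span_ideal cycle_idealMl cycle_idealMr.

Lemma cycle_idealP r : r \in cycle_ideal <-> exists w, cycle_rel r w.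
Proof.
split=> [/spanP|[w hw]]; last by apply: mem_span; exists w.
elim=> {r} [|r //|r s _ [v hv] _ [w hw]].
  exists 0, (fun=> 0); split.
  - by split=> [i|]; rewrite ?rpred0 // big1_eq.
  - by rewrite (morphD0 (@repRD _ _ C)).
  - by rewrite (morphD0 (@TpowD _ _ C m)).
by exists (v - w); exact: cycle_relB.
Qed.

Fact cycle_inv p r q : r \in cycle_ideal -> psi ((p <· r) ⊗ q) \in cycle_ideal.
Proof.
move=> /cycle_idealP[w hw]; apply/cycle_idealP; exists (Sp p (tsnoc w q)).
exact: cycle_rel_psi.
Qed.
Definition cycle_inv_ideal : inv_ideal A := InvIdeal cycle_inv.

Lemma cycle_ideal_cycle : psi_cycle cycle_inv_ideal.
Proof.
have /choice[eta he] (x : ideal_sort cycle_inv_ideal) :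
    exists w, cycle_rel (val x) w by apply/cycle_idealP/(valP x).
exists m, eta; split.
- split=> [x y|r x|x r].
  + apply/eqP; rewrite -subr_eq0; apply/eqP/cycle_rel0l.
    have v0 : val (0 : ideal_sort cycle_inv_ideal) = 0 by [].
    have vD : val (x + y) = val x + val y by [].
    have e0 : eta 0 = 0 by apply: cycle_rel0l; rewrite -v0.
    have := cycle_relB (he (x + y)) (cycle_relB (he x) (cycle_relB (he 0) (he y))).
    by rewrite e0 v0 vD !sub0r !opprK subrr.
  + by apply: cycle_rel_fun (he _) _; exact: cycle_rel_l.
  + by apply: cycle_rel_fun (he _) _; exact: cycle_rel_r.
- move=> x y hxy; apply: val_inj; apply/eqP; rewrite -subr_eq0; apply/eqP.
  by apply: cycle_rel0r; have := cycle_relB (he x) (he y); rewrite hxy subrr.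
- move=> p x q; apply: cycle_rel_fun (he _).
  exact: cycle_rel_psi.
Qed.

(** All components but the bottom one have positive degree, so that [D]'s value
    at [r] has a left unit and is compact. *)
Lemma cycle_ideal_sub : {subset cycle_inv_ideal <= J}.
Proof.
move=> r /cycle_idealP[w [f [[hf hf0] f0 _]]].
move: hf0; rewrite big_ord_recl /= f0; set y := \sum_(i < _) _ => hf0.
have yl : y \in lsupp C.
  by apply: rpred_sum => i _; apply: (hdeg_lsupp hFS _ (hf _)).
have [s hs] := lsupp_unit hFS yl.
apply: (maxD (s := [seq (u.1, u.2 <· r) | u <- s])); rewrite big_map /=.
have hy : h y = - repR D r.
  by apply/eqP; rewrite -addr_eq0 addrC -hR -hAdd; apply/eqP.
rewrite -[LHS]opprK -hy hs (morphD_sum hAdd) -sumrN; apply: eq_bigr => u _.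
by rewrite !hMul hQ hP hy !rmulNr opprK repPr.
Qed.

Hypothesis hL : condL A J.

(** A nonzero family of minimal length gives a cycle: moved to degree 0 and
    compressed by long words, its bottom lies in the coefficient ring and its top
    in a tensor power of [Q], and the bottom determines the top. Such a cycle is
    excluded by condition (L). *)
Lemma separatesS : separates m.+1.
Proof.
move=> a f hf; apply: (family_bottom_eq0 hf); apply: contrapT => hf0.
have [{hf hf0}g hg g0] := family_shift hf hf0.
apply: hL; exists cycle_inv_ideal; split.
- have [N hN] := hdeg_reduce hFS (hg.1 0%N).
  have [M hM] := hdeg_reduce hFS (hg.1 m.+1).
  have [ps [qs [hps hqs hw]]] := family_words_neq0 (maxn N M) hg g0.
  have hfam := family_words (etrans hps (esym hqs)) hg.
  have [||| r hr] := hN ps qs; rewrite ?hps ?hqs //; try lia.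
  have [||w hw'] := hdeg_Tpow_sigma hFS (n := m) (y := Sw ps (Tw qs (g m.+1))).
  + by have := hfam.1 m.+1; rewrite add0r.
  + move=> vs hvs; rewrite -Sw_cat; apply: hM; rewrite ?size_cat; lia.
  exists r; first by apply/cycle_idealP; exists w; eexists; split; first exact: hfam.
  by apply/eqP => r0; apply: hw; rewrite hr r0 (morphD0 (@repRD _ _ C)).
- exact: cycle_ideal_cycle.
- by apply: iter_ideal_inv; exact: cycle_ideal_sub.
Qed.
End MinimalFamily.

Theorem condL_separates : condL A J -> forall m, separates m.
Proof.
by move=> hL; elim=> [|m IH]; [exact: separates0|exact: separatesS].
Qed.

End Uniqueness.

(** * Representations by endomorphisms *)

Section EndoRing.
Variables (V : zmodType) (K : zmodClosed V).

Definition endo_pred (f : V -> V) : bool :=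
  `[< {morph f : x y / x + y} /\ forall x, x \in K -> f x \in K >].

Fact endo_zmod_closed : zmod_closed endo_pred.
Proof.
split=> [|f g].
  by rewrite unfold_in; apply/asboolP; split=> [x y|x _]; rewrite ?addr0 // rpred0.
rewrite !unfold_in => /asboolP[fD fK] /asboolP[gD gK]; apply/asboolP.
have e z : (f - g) z = f z - g z by [].
by split=> [x y|x xK]; rewrite !e; [rewrite fD gD opprD addrACA|apply: rpredB; auto].
Qed.
HB.instance Definition _ :=
  GRing.isZmodClosed.Build (V -> V) endo_pred endo_zmod_closed.

Definition endo := {f : V -> V | f \in endo_pred}.
HB.instance Definition _ := SubChoice.on endo.
HB.instance Definition _ := [SubChoice_isSubZmodule of endo by <:].

Lemma endoD (f : endo) : {morph val f : x y / x + y}.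
Proof. by have /asboolP[] := valP f. Qed.
Lemma endoK (f : endo) x : x \in K -> val f x \in K.
Proof. by have /asboolP[_ h] := valP f; exact: h. Qed.

Definition mk_endo f (fD : {morph f : x y / x + y})
    (fK : forall x, x \in K -> f x \in K) : endo :=
  exist _ f (asboolT (conj fD fK)).

Definition endo_mul (f g : endo) : endo :=
  @mk_endo (val f \o val g)
    (fun x y => etrans (congr1 (val f) (endoD g x y)) (endoD f _ _))
    (fun x xK => endoK f (endoK g xK)).

Lemma endo_eq (f g : endo) : (forall x, val f x = val g x) -> f = g.
Proof. by move=> h; apply/val_inj/funext. Qed.

Lemma endo_addE (f g : endo) x : val (f + g) x = val f x + val g x.
Proof. by []. Qed.
Lemma endo_subE (f g : endo) x : val (f - g) x = val f x - val g x.
Proof. by []. Qed.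

Fact endo_mulA : associative endo_mul.
Proof. by move=> f g h; apply: endo_eq. Qed.
Fact endo_mulDl : left_distributive endo_mul +%R.
Proof. by move=> f g h; apply: endo_eq. Qed.
Fact endo_mulDr : right_distributive endo_mul +%R.
Proof. by move=> f g h; apply: endo_eq => x; exact: endoD. Qed.
HB.instance Definition _ :=
  Zmodule_isRng.Build endo endo_mulA endo_mulDl endo_mulDr.

Lemma endo_mulE (f g : endo) x : val (f · g) x = val f (val g x).
Proof. by []. Qed.

Lemma endo_sumE T (s : seq T) (F : T -> endo) x :
  val (\sum_(t <- s) F t) x = \sum_(t <- s) val (F t) x.
Proof. exact: (@morphD_sum _ _ (fun f : endo => val f x) (fun f g => erefl)). Qed.

Fact into_idealMl (f g : endo) :
  (forall x, val g x \in K) -> forall x, val (f · g) x \in K.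
Proof. by move=> h x; exact: (endoK f (h x)). Qed.
Fact into_idealMr (f g : endo) :
  (forall x, val g x \in K) -> forall x, val (g · f) x \in K.
Proof. by move=> h x; exact: (h (val f x)). Qed.

(** Modulo this ideal, an endomorphism is known by its action on [V / K]. *)
Definition into_ideal : ideal endo := span_ideal into_idealMl into_idealMr.

Lemma into_idealP (f : endo) : f \in into_ideal <-> forall x, val f x \in K.
Proof.
split=> [/spanP|h]; last exact: mem_span.
elim=> {f} [x|f h //|f g _ hf _ hg x]; first exact: rpred0.
by rewrite endo_subE; apply: rpredB.
Qed.

End EndoRing.

Section EndoRep.
Variables (R : rngType) (A : rsystem R) (V : zmodType) (K : zmodClosed V).
Local Notation P := (sysP A).
Local Notation Q := (sysQ A).
Variables (LP : P -> V -> V) (LQ : Q -> V -> V) (LR : R -> V -> V).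
Hypotheses (LPD : forall p, {morph LP p : x y / x + y})
  (LQD : forall q, {morph LQ q : x y / x + y})
  (LRD : forall r, {morph LR r : x y / x + y}).
Hypotheses (LPK : forall p x, x \in K -> LP p x \in K)
  (LQK : forall q x, x \in K -> LQ q x \in K)
  (LRK : forall r x, x \in K -> LR r x \in K).
Hypotheses (ePD : forall p p' x, LP (p + p') x = LP p x + LP p' x)
  (eQD : forall q q' x, LQ (q + q') x = LQ q x + LQ q' x)
  (eRD : forall r s x, LR (r + s) x = LR r x + LR s x)
  (eRM : forall r s x, LR (r · s) x = LR r (LR s x))
  (ePr : forall p r x, LP (p <· r) x = LP p (LR r x))
  (ePl : forall r p x, LP (r ·> p) x = LR r (LP p x))
  (eQr : forall q r x, LQ (q <· r) x = LQ q (LR r x))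
  (eQl : forall r q x, LQ (r ·> q) x = LR r (LQ q x))
  (epsi : forall p q x, LR (psi (p ⊗ q)) x = LP p (LQ q x)).

Definition endo_rep : covrep A.
Proof.
refine (@Covrep R A (endo K) (fun p => mk_endo (LPD p) (LPK p))
  (fun q => mk_endo (LQD q) (LQK q)) (fun r => mk_endo (LRD r) (LRK r))
  _ _ _ _ _ _ _ _).
- by move=> p p'; apply: endo_eq => x; exact: ePD.
- by move=> q q'; apply: endo_eq => x; exact: eQD.
- split=> r s; apply: endo_eq => x; [exact: eRD|exact: eRM].
- by move=> p r; apply: endo_eq => x; exact: ePr.
- by move=> r p; apply: endo_eq => x; exact: ePl.
- by move=> q r; apply: endo_eq => x; exact: eQr.
- by move=> r q; apply: endo_eq => x; exact: eQl.
- by move=> p q; apply: endo_eq => x; exact: epsi.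
Defined.

End EndoRep.

Section PushRep.
Variables (R : rngType) (A : rsystem R) (C : covrep A) (B : rngType).
Variables (f : target C -> B) (fH : rng_hom f).
Let fD := rng_homD fH.
Let fM := rng_homM fH.

Definition push_rep : covrep A.
Proof.
refine (@Covrep R A B (f \o repP C) (f \o repQ C) (f \o repR C)
  _ _ _ _ _ _ _ _) => /=.
- by move=> p p'; rewrite /= repPD fD.
- by move=> q q'; rewrite /= repQD fD.
- by split=> r s; rewrite /= ?repRD ?repRM ?fD ?fM.
- by move=> p r; rewrite /= repPr fM.
- by move=> r p; rewrite /= repPl fM.
- by move=> q r; rewrite /= repQr fM.
- by move=> r q; rewrite /= repQl fM.
- by move=> p q; rewrite /= rep_psi fM.
Defined.

Lemma push_invariant (J : ideal R) : condFS A -> psi_compatible A J ->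
  cp_invariant J C -> cp_invariant J push_rep.
Proof.
move=> hFS hJ /(cp_invariantP hFS _ hJ) h; apply/cp_invariantP => // x s xJ hs.
rewrite -[LHS]/(f (repR C x)) (h x s) // (morphD_sum fD).
by apply: eq_bigr => u _; rewrite fM.
Qed.
End PushRep.

Lemma wp_hom (R : rngType) (I : ideal R) : rng_hom (wp I : R -> rquot I).
Proof. by split=> x y; [exact: wpD|exact: wpM]. Qed.

(** * The grading of the universal ring *)

Lemma morphD_int (U V : zmodType) (f : U -> V) : {morph f : x y / x + y} ->
  forall x k, f (x *~ k) = f x *~ k.
Proof.
move=> fD x; have fn n : f (x *+ n) = f x *+ n.
  by elim: n => [|n IH]; rewrite ?mulr0n ?morphD0 // !mulrS fD IH.
by case=> n; rewrite ?NegzE ?mulrNz -!pmulrn ?morphDN // fn.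
Qed.

Section UnitAction.
Variable B : rngType.
Implicit Types (x y : B) (v w : B * int).

(** The left action of [B] on its unitization [B * int], in which no nonzero
    element acts as zero. *)
Definition uact x v : B * int := (x · v.1 + x *~ v.2, 0).

Lemma uactDr x : {morph uact x : v w / v + w}.
Proof.
move=> v w; congr pair; rewrite /= ?addr0 //.
by rewrite rmulDr mulrzDr addrACA.
Qed.
Lemma uactDl x y v : uact (x + y) v = uact x v + uact y v.
Proof.
congr pair; rewrite /= ?addr0 //.
by rewrite rmulDl mulrzDl addrACA.
Qed.
Lemma uactM x y v : uact (x · y) v = uact x (uact y v).
Proof.
congr pair; rewrite /= mulr0z addr0 rmulDr rmulA; congr (_ + _).
exact/esym/(@morphD_int _ _ (fun a : B => x · a))/rmulDr.
Qed.
Lemma uact0l v : uact 0 v = 0.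
Proof. by congr pair; rewrite /= rmul0l mul0rz addr0. Qed.
End UnitAction.

Section Grading.
Variables (R : rngType) (A : rsystem R) (J : ideal R) (hFS : condFS A).
Hypothesis hJ : psi_compatible A J.
Local Notation P := (sysP A).
Local Notation Q := (sysQ A).
Local Notation C := (CPrep A J).
Local Notation S := (repP C).
Local Notation T := (repQ C).
Local Notation sigma := (repR C).
Local Notation B := (target C).
Implicit Types (x y : B) (p : P) (q : Q) (r : R) (d e : int).

Local Notation V := (int -> B * int).
Local Notation K := (span (fun _ : V => False)).

(** Acting on families indexed by [int], an element of degree [d] also shifts
    the index by [d]; this is the ring of Laurent polynomials over [B], realized
    by operators on the unitization of [B] so that no element is lost. *)
Definition shift_act (d : int) (x : B) (f : V) : V := fun n => uact x (f (n - d)).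

Lemma shift_actDr d x : {morph shift_act d x : f g / f + g}.
Proof. by move=> f g; apply/funext => n; exact: uactDr. Qed.
Lemma shift_actDl d x y f : shift_act d (x + y) f = shift_act d x f + shift_act d y f.
Proof. by apply/funext => n; exact: uactDl. Qed.
Lemma shift_actM d e x y f :
  shift_act (d + e) (x · y) f = shift_act d x (shift_act e y f).
Proof. by apply/funext => n; rewrite /shift_act uactM opprD addrA. Qed.
Lemma shift_actK d x f : f \in K -> shift_act d x f \in K.
Proof. by apply: span_map => //; exact: shift_actDr. Qed.

Definition shift_rep : covrep A.
Proof.
refine (@endo_rep R A V K (fun p => shift_act (-1) (S p))
  (fun q => shift_act 1 (T q)) (fun r => shift_act 0 (sigma r))
  (fun p => shift_actDr (-1) (S p)) (fun q => shift_actDr 1 (T q))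
  (fun r => shift_actDr 0 (sigma r)) (fun p => @shift_actK (-1) (S p))
  (fun q => @shift_actK 1 (T q)) (fun r => @shift_actK 0 (sigma r))
  _ _ _ _ _ _ _ _ _).
- by move=> p p' f; rewrite repPD shift_actDl.
- by move=> q q' f; rewrite repQD shift_actDl.
- by move=> r s f; rewrite repRD shift_actDl.
- by move=> r s f; rewrite repRM -shift_actM.
- by move=> p r f; rewrite repPr -shift_actM.
- by move=> r p f; rewrite repPl -shift_actM.
- by move=> q r f; rewrite repQr -shift_actM.
- by move=> r q f; rewrite repQl -shift_actM.
- by move=> p q f; rewrite rep_psi -shift_actM.
Defined.

Lemma shift_rep_invariant : cp_invariant J shift_rep.
Proof.
apply/cp_invariantP => // r s rJ hs; apply: endo_eq => f; rewrite endo_sumE.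
have /(cp_invariantP hFS _ hJ)/(_ r s rJ hs) h := CPrep_invariant hJ.
rewrite -[LHS]/(shift_act 0 (sigma r) f) h.
have hD : {morph (fun x : B => shift_act 0 x f) : x y / x + y}.
  by move=> x y; exact: shift_actDl.
rewrite (morphD_sum hD); apply: eq_bigr => u _.
exact: (shift_actM 1 (-1)).
Qed.

Local Notation L := (CPlift shift_rep : B -> target shift_rep).

Lemma shift_lift d x f : x \in hdeg C d -> val (L x) f = shift_act d x f.
Proof.
have [[LD LM] LP LQ LR] := CPliftP hFS shift_rep_invariant.
move=> /spanP; elim=> {x} [|x|x y _ hx _ hy].
- by rewrite (morphD0 LD); apply/funext => n; rewrite /shift_act uact0l.
- move=> hx; elim: hx f => {d x} [r|p|q|r d x _ IH|p d x _ IH|q d x _ IH] f.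
  + by rewrite LR.
  + by rewrite LP.
  + by rewrite LQ.
  + by rewrite LM LR endo_mulE IH -[d in RHS]add0r shift_actM.
  + by rewrite LM LP endo_mulE IH addrC shift_actM.
  + by rewrite LM LQ endo_mulE IH addrC shift_actM.
- rewrite (morphDB LD) endo_subE hx hy.
  by rewrite (@morphDB _ _ (fun z : B => shift_act d z f)) // => a b;
    exact: shift_actDl.
Qed.

(** The homogeneous component of degree [n], read off from the action on the
    unit placed at index 0. *)
Definition component (n : int) (x : B) : B :=
  (val (L x) (fun k => (0, (k == 0)%:R)) n).1.

Lemma componentD n : {morph component n : x y / x + y}.
Proof.
have [[LD _] _ _ _] := CPliftP hFS shift_rep_invariant.
by move=> x y; rewrite /component LD endo_addE.
Qed.

Lemma component_hdeg n d x : x \in hdeg C d -> component n x = if n == d then x else 0.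
Proof.
move=> hx; rewrite /component (shift_lift _ hx) /shift_act subr_eq0.
case: eqP => _ /=; first by rewrite rmul0r add0r mulr1z.
by rewrite rmul0r add0r mulr0z.
Qed.

Lemma component_sum (s : seq int) (f : int -> B) n : uniq s ->
  (forall d, f d \in hdeg C d) ->
  component n (\sum_(d <- s) f d) = if n \in s then f n else 0.
Proof.
move=> us hf; rewrite (morphD_sum (@componentD n)).
under eq_bigr => d _ do rewrite (component_hdeg n (hf d)).
case: ifP => [ns|/negP ns]; last first.
  by rewrite big_seq big1 // => d ds; case: eqP => // e; case: ns; rewrite e.
rewrite (bigD1_seq n) //= eqxx big1 ?addr0 // => d.
by rewrite eq_sym => /negPf ->.
Qed.

Lemma hdeg_independent (s : seq int) (f : int -> B) : uniq s ->
  (forall d, f d \in hdeg C d) -> \sum_(d <- s) f d = 0 ->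
  {in s, forall d, f d = 0}.
Proof.
move=> us hf h0 d ds; have := component_sum d us hf.
by rewrite h0 ds (morphD0 (@componentD d)) => ->.
Qed.

End Grading.

(** * Homogeneous decompositions *)

Lemma span_graded (V : zmodType) (G : int -> zmodClosed V) x :
  x \in span (fun x => exists d, x \in G d) ->
  exists (s : seq int) (f : int -> V),
    [/\ uniq s, forall d, f d \in G d, forall d, d \notin s -> f d = 0 &
        x = \sum_(d <- s) f d].
Proof.
move=> hx; have [l [hl ->]] : exists l : seq (int * V),
    {in l, forall v, v.2 \in G v.1} /\ x = \sum_(v <- l) v.2.
  move/spanP: hx; elim=> {x} [|x [d hd]|x y _ [l [hl ->]] _ [m [hm ->]]].
  - by exists [::]; rewrite big_nil.
  - by exists [:: (d, x)]; rewrite big_seq1; split=> // v; rewrite inE => /eqP ->.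
  - exists (l ++ [seq (v.1, - v.2) | v <- m]); split.
      move=> v; rewrite mem_cat => /orP[/hl //|/mapP[w /hm hw ->]].
      by rewrite /= rpredN.
    by rewrite big_cat big_map -sumrN.
pose s := undup [seq v.1 | v <- l].
exists s, (fun d => \sum_(v <- l | v.1 == d) v.2); split.
- exact: undup_uniq.
- move=> d; rewrite big_seq_cond; apply: rpred_sum => v /andP[vl /eqP <-].
  exact: hl.
- move=> d; rewrite mem_undup => ds; rewrite big_seq_cond big1 // => v.
  by case/andP=> vl /eqP vd; case/negP: ds; rewrite -vd map_f.
rewrite (exchange_big_dep xpredT) //= big_seq [RHS]big_seq.
apply: eq_bigr => v vl; rewrite big_mkcond (bigD1_seq v.1) ?undup_uniq //=.
  by rewrite eqxx big1 ?addr0 // => d; rewrite eq_sym => /negPf ->.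
by rewrite mem_undup map_f.
Qed.

Section UniversalDecomposition.
Variables (R : rngType) (A : rsystem R) (J : ideal R).
Local Notation C := (CPrep A J).
Local Notation B := (target C).

Lemma hdeg_total (x : B) : x \in span (fun x => exists d, x \in hdeg C d).
Proof.
set K := span _; move: x; apply: (@CPring_generated _ _ _ K) => [x y|p|q|r].
- move=> hx hy; move: x hx.
  apply: (@span_map _ _ (fun a : B => a · y)) => [a b|x [d hx]].
    exact: rmulDl.
  move: y hy; apply: (@span_map _ _ (fun a : B => x · a)) => [a b|y [e hy]].
    exact: rmulDr.
  by apply: mem_span; exists (d + e); exact: hdegM.
- by apply: mem_span; exists (-1); exact: (hdegP C).
- by apply: mem_span; exists 1; exact: (hdegQ C).
- by apply: mem_span; exists 0; exact: (hdegR C).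
Qed.

Lemma hdeg_decomposition (x : B) : exists (s : seq int) (f : int -> B),
  [/\ uniq s, forall d, f d \in hdeg C d, forall d, d \notin s -> f d = 0 &
      x = \sum_(d <- s) f d].
Proof. exact/span_graded/hdeg_total. Qed.

End UniversalDecomposition.

Section GradedIdeals.
Variables (R : rngType) (A : rsystem R) (J : ideal R) (hFS : condFS A).
Hypothesis hJ : psi_compatible A J.
Local Notation C := (CPrep A J).
Local Notation B := (target C).

(** Homogeneous components are unique, so a graded ideal contains the components
    of its elements in any homogeneous decomposition. *)
Lemma graded_idealP (H : ideal (CPring A J)) :
  graded_ideal H <->
  forall (s : seq int) (f : int -> CPring A J), uniq s ->
    (forall d, f d \in hdeg C d) -> \sum_(d <- s) f d \in H ->
    {in s, forall d, f d \in H}.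
Proof.
split=> [[_ hH _] s f us hf /hH[s' [g [us' hg e]]] d ds|h].
- have gH e' : g e' \in H by have /andP[] := hg e'.
  have gd e' : g e' \in hdeg C e' by have /andP[_ /CPdeg_hdeg] := hg e'.
  have := congr1 (component d) e.
  rewrite (component_sum hFS hJ d us hf) (component_sum hFS hJ d us' gd) ds => ->.
  by case: ifP => // _; exact: rpred0.
- split.
  + by move=> d x /andP[].
  + move=> x xH; have [s [f [us hf f0 xE]]] := hdeg_decomposition x.
    exists s, f; split=> // d; apply/andP; split; last exact: hdeg_CPdeg.
    have [ds|/f0 ->] := boolP (d \in s); last exact: rpred0.
    by apply: (h s f) => //; rewrite -xE.
  + move=> s f us hf; apply: (hdeg_independent hFS hJ) => // d.
    by apply: CPdeg_hdeg; case/andP: (hf d).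
Qed.

End GradedIdeals.

(** * Passage to quotient systems *)

Section PullBack.
Variables (R : rngType) (A : rsystem R) (hFS : condFS A) (I : inv_ideal A).
Local Notation AI := (quot_system hFS I).
Local Notation P := (sysP A).
Local Notation Q := (sysQ A).

Definition pull_rep (D : covrep AI) : covrep A.
Proof.
refine (@Covrep R A (target D) (fun p => repP D (wpP hFS I p))
  (fun q => repQ D (wpQ hFS I q)) (fun r => repR D (wpR I r))
  _ _ _ _ _ _ _ _).
- by move=> p p'; rewrite /wpP wpD repPD.
- by move=> q q'; rewrite /wpQ wpD repQD.
- split=> r s; first by rewrite /wpR wpD repRD.
  by rewrite /wpR wpM repRM.
- by move=> p r; rewrite wpPr repPr.
- by move=> r p; rewrite wpPl repPl.
- by move=> q r; rewrite wpQr repQr.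
- by move=> r q; rewrite wpQl repQl.
- by move=> p q; rewrite -psi_quotE -rep_psi.
Defined.

Lemma pull_invariant (J J' : ideal R) (D : covrep AI) :
  psi_compatible A J -> psi_compatible AI (im_ideal I J') ->
  {subset J <= J'} -> cp_invariant (im_ideal I J') D ->
  cp_invariant J (pull_rep D).
Proof.
move=> hJ hJ' sJ /(cp_invariantP (@quot_condFS _ _ hFS I) _ hJ') h.
apply/cp_invariantP => // x s xJ hs.
rewrite -[LHS]/(repR D (wpR I x)).
rewrite (h _ [seq (wpQ hFS I u.1, wpP hFS I u.2) | u <- s]).
- by rewrite big_map.
- by apply/im_predP; exists x; rewrite ?sJ.
apply/funext; elim/quot_ind=> q.
apply: etrans (esym (@quot_thetaQE _ _ hFS I s q)); rewrite -hs.
exact/esym/wpQl.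
Qed.

Section Kappa.
Variables J J' : ideal R.
Hypotheses (hJ : psi_compatible A J) (hJ' : psi_compatible AI (im_ideal I J')).
Hypothesis sJ : {subset J <= J'}.
Local Notation C := (CPrep A J).
Local Notation D := (CPrep AI (im_ideal I J')).

(** This comparison map preserves degrees and is onto in each degree, so that
    questions about graded ideals move to the quotient system, where the kernel
    of the representation has become trivial. *)
Definition kappa : target C -> target D := CPlift (pull_rep D).

Lemma kappaP : [/\ rng_hom kappa,
  forall p, kappa (repP C p) = repP D (wpP hFS I p),
  forall q, kappa (repQ C q) = repQ D (wpQ hFS I q) &
  forall r, kappa (repR C r) = repR D (wpR I r)].
Proof.
apply: (CPliftP hFS (C := pull_rep D)).
exact/(pull_invariant hJ hJ' sJ)/CPrep_invariant.
Qed.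

Lemma kappa_hdeg d x : x \in hdeg C d -> kappa x \in hdeg D d.
Proof.
have [[kD kM] kP kQ kR] := kappaP.
apply: span_map => //; move=> y hy; elim: hy => {d x y}.
- by move=> r; rewrite kR; exact: (hdegR D).
- by move=> p; rewrite kP; exact: (hdegP D).
- by move=> q; rewrite kQ; exact: (hdegQ D).
- by move=> r d x _ IH; rewrite kM kR; exact: (@hdeg_lR _ _ D).
- by move=> p d x _ IH; rewrite kM kP; exact: (@hdeg_lP _ _ D _ _ _ _ erefl IH).
- by move=> q d x _ IH; rewrite kM kQ; exact: (@hdeg_lQ _ _ D _ _ _ _ erefl IH).
Qed.

Lemma kappa_hdeg_surj d y : y \in hdeg D d -> exists2 x, x \in hdeg C d & kappa x = y.
Proof.
have [[kD kM] kP kQ kR] := kappaP.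
move=> /spanP; elim=> {y} [|y|y z _ [u hu <-] _ [v hv <-]].
- by exists 0; rewrite ?rpred0 // (morphD0 kD).
- elim=> {d y}.
  + elim/quot_ind=> r; exists (repR C r); [exact: hdegR|exact: kR].
  + elim/quot_ind=> p; exists (repP C p); [exact: hdegP|exact: kP].
  + elim/quot_ind=> q; exists (repQ C q); [exact: hdegQ|exact: kQ].
  + elim/quot_ind=> r d _ _ [x hx <-]; exists (repR C r · x); first exact: hdeg_lR.
    by rewrite kM kR.
  + elim/quot_ind=> p d _ _ [x hx <-]; exists (repP C p · x).
      exact: hdeg_lP hx.
    by rewrite kM kP.
  + elim/quot_ind=> q d _ _ [x hx <-]; exists (repQ C q · x).
      exact: hdeg_lQ hx.
    by rewrite kM kQ.
- by exists (u - v); rewrite ?rpredB // (morphDB kD).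
Qed.
End Kappa.
End PullBack.

(** * From condition (K) to injectivity to graded ideals *)

Section Implications.
Variables (R : rngType) (A : rsystem R) (hFS : condFS A) (J : ideal R).
Hypothesis hJ : faithful A J.

(** Brings an arbitrary finite set of degrees into the form of an interval, with
    zeros in the gaps, to which [separates] applies. *)
Lemma window_sum (V : zmodType) (s : seq int) (f : int -> V) : uniq s ->
  exists (a : int) (m : nat), {in s, forall d, exists2 i : 'I_m.+1, d = a + i%:Z &
    (if a + i%:Z \in s then f (a + i%:Z) else 0) = f d} /\
  \sum_(i < m.+1) (if a + i%:Z \in s then f (a + i%:Z) else 0) = \sum_(d <- s) f d.
Proof.
move=> us; pose M := (\sum_(d <- s) `|d|%N)%N.
have hM (d : int) : d \in s -> (`|d| <= M)%N.
  by move=> ds; rewrite /M (bigD1_seq d) //= leq_addr.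
have hi (d : int) : d \in s -> exists2 i : 'I_(M + M).+1,
    d = - M%:Z + i%:Z & (i : nat) = absz (d + M%:Z).
  move=> ds; have hd := hM d ds.
  have lt : (absz (d + M%:Z)%R < (M + M).+1)%N by lia.
  by exists (Ordinal lt) => //=; lia.
exists (- M%:Z), (M + M)%N; split=> [d ds|].
  by have [i di _] := hi d ds; exists i => //; rewrite -di ds.
have -> : \sum_(d <- s) f d =
    \sum_(d <- s) \sum_(i < (M + M).+1) (if - M%:Z + i%:Z == d then f d else 0).
  rewrite big_seq [RHS]big_seq; apply: eq_bigr => d ds.
  have [i di _] := hi d ds; rewrite (bigD1 i) //= -di eqxx big1 ?addr0 // => j ji.
  case: eqP => // e; case/eqP: ji; apply: val_inj => /=.
  by move: e; rewrite di; lia.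
rewrite exchange_big /=; apply: eq_bigr => i _.
case: ifP => [hs|/negP hs].
  rewrite (bigD1_seq (- M%:Z + i%:Z)) //= eqxx big1 ?addr0 // => d.
  by rewrite eq_sym => /negPf ->.
rewrite big_seq big1 // => d ds; case: eqP => // e; case: hs; by rewrite e.
Qed.

(** The second ideal of [omega] is by definition as large as possible, and the
    quotient map loses nothing of this. *)
Lemma im_omegaJ_max (C : covrep A) r
    (s : seq (Qquot (ker_inv_ideal C) hFS * Pquot (ker_inv_ideal C) hFS)) :
  repR (quot_rep hFS C) r =
    \sum_(u <- s) repQ (quot_rep hFS C) u.1 · repP (quot_rep hFS C) u.2 ->
  r \in im_ideal (ker_inv_ideal C) (omegaJ hFS C).
Proof.
move=> e; apply/im_predP; exists (repr r); last by rewrite wpK.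
apply/(omegaJ_sumP hFS); exists [seq (repr u.1, repr u.2) | u <- s].
by rewrite big_map; exact: e.
Qed.

(** A representation factors through the quotient by its kernel ideal, where it
    is injective on coefficients and the ideal of [omega] is maximal; condition
    (K) supplies condition (L) for this quotient system. *)
Lemma condK_injective : condK hFS J ->
  forall C : covrep A, cp_invariant J C -> injective (omega_eta hFS C).
Proof.
move=> hK C hC; set I := ker_inv_ideal C.
have hFSI := @quot_condFS _ _ hFS I.
have [hcomp _] := omega_faithful hFS C.
have hinv := @quot_rep_invariant _ _ hFS C.
have [[eD _] _ _ _] := CPliftP hFSI hinv.
have injD r : repR (quot_rep hFS C) r = 0 -> r = 0.
  move=> hr; apply: (@quot_rep_injective _ _ hFS C); rewrite hr.
  by rewrite (morphD0 (@repRD _ _ _)).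
have hL := hK (omega hFS C) (omegaJ_super hFS hJ.1 hC).
have sep := condL_separates hFSI hcomp hinv injD (@im_omegaJ_max C) hL.
move=> x y hxy; apply/eqP; rewrite -subr_eq0; apply/eqP.
have {}hxy : CPlift (quot_rep hFS C) (x - y) = 0.
  by rewrite (morphDB eD); apply/eqP; rewrite subr_eq0; apply/eqP.
have [s [f [us hf _ xE]]] := hdeg_decomposition (x - y).
have [a [m [hs hsum]]] := window_sum f us.
rewrite xE big_seq big1 // => d ds; have [i _ <-] := hs d ds.
apply: (sep m a (fun i => if a + i%:Z \in s then f (a + i%:Z) else 0)).
  by split=> [j|]; [case: ifP; rewrite ?rpred0|rewrite hsum -xE].
by rewrite -ltnS.
Qed.

(** The quotient by [H] is a representation; if its [omega_eta] is injective, then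
    [H] is the kernel of the degree-preserving map [kappa]. *)
Lemma injective_graded :
  (forall C : covrep A, cp_invariant J C -> injective (omega_eta hFS C)) ->
  forall H : ideal (CPring A J), graded_ideal H.
Proof.
move=> hinj H; apply/(graded_idealP hFS hJ.1) => s f us hf hH d ds.
pose C := push_rep (C := CPrep A J) (wp_hom H).
have hC : cp_invariant J C.
  by apply: push_invariant => //; [exact: hJ.1|exact/CPrep_invariant/hJ.1].
have [eH eP eQ eR] := omega_etaP hFS C.
have [hcomp _] := omega_faithful hFS C.
have sJ := omegaJ_super hFS hJ.1 hC.
have [kH kP kQ kR] := kappaP hJ.1 hcomp sJ.
have ek x : omega_eta hFS C (@kappa _ _ hFS (ker_inv_ideal C) J (omegaJ hFS C) x) = wp H x.
  move: x; apply: CPring_hom_ext.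
  - split=> x y; first by rewrite (rng_homD kH) (rng_homD eH).
    by rewrite (rng_homM kH) (rng_homM eH).
  - exact: wp_hom.
  - by move=> p; rewrite /= [X in omega_eta _ _ X]kP eP.
  - by move=> q; rewrite /= [X in omega_eta _ _ X]kQ eQ.
  - by move=> r; rewrite /= [X in omega_eta _ _ X]kR eR.
apply/wp0P; rewrite -ek.
have k0 : @kappa _ _ hFS (ker_inv_ideal C) J (omegaJ hFS C) (\sum_(d <- s) f d) = 0.
  apply: (hinj C hC); rewrite ek (morphD0 (rng_homD eH)).
  exact/wp0P.
rewrite (morphD_sum (rng_homD kH)) in k0.
have -> := hdeg_independent (@quot_condFS _ _ hFS _) hcomp us _ k0 ds.
  by rewrite (morphD0 (rng_homD eH)).
by move=> e; exact/(kappa_hdeg hJ.1 hcomp sJ)/hf.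
Qed.

End Implications.

(** * Germs at infinity *)

Section TensorSequences.
Variables (R : rngType) (Q : bimodType R).

Definition tseq := forall k, tpow Q k.
HB.instance Definition _ := gen_eqMixin tseq.
HB.instance Definition _ := gen_choiceMixin tseq.
Implicit Types f g : tseq.

Definition tseq_add f g : tseq := fun k => f k + g k.
Definition tseq_opp f : tseq := fun k => - f k.
Definition tseq_zero : tseq := fun k => 0.

Lemma tseqP f g : (forall k, f k = g k) -> f = g.
Proof. exact: functional_extensionality_dep. Qed.

Fact tseq_addA : associative tseq_add.
Proof. by move=> f g h; apply: tseqP => k; exact: addrA. Qed.
Fact tseq_addC : commutative tseq_add.
Proof. by move=> f g; apply: tseqP => k; exact: addrC. Qed.
Fact tseq_add0 : left_id tseq_zero tseq_add.
Proof. by move=> f; apply: tseqP => k; exact: add0r. Qed.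
Fact tseq_addN : left_inverse tseq_zero tseq_opp tseq_add.
Proof. by move=> f; apply: tseqP => k; exact: addNr. Qed.
HB.instance Definition _ := GRing.isZmodule.Build tseq
  tseq_addA tseq_addC tseq_add0 tseq_addN.

Lemma tseq_subE f g k : (f - g) k = f k - g k.
Proof. by []. Qed.

Lemma tseq_sumE T (s : seq T) (F : T -> tseq) k :
  (\sum_(t <- s) F t) k = \sum_(t <- s) F t k.
Proof. exact: (@morphD_sum _ _ (fun f : tseq => f k) (fun f g => erefl)). Qed.

(** Germs at infinity are sequences modulo these. *)
Definition vanishing : zmodClosed tseq :=
  span (fun f => exists N, forall k, (N <= k)%N -> f k = 0).

Lemma vanishingP f : f \in vanishing <-> exists N, forall k, (N <= k)%N -> f k = 0.
Proof.
split=> [/spanP|h]; last exact: mem_span.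
elim=> {f} [|f //|f g _ [N hN] _ [M hM]]; first by exists 0%N.
exists (maxn N M) => k; rewrite geq_max => /andP[h1 h2].
by rewrite tseq_subE hN // hM // subr0.
Qed.

End TensorSequences.

Section Germs.
Variables (R : rngType) (A : rsystem R) (J : ideal R) (hFS : condFS A).
Hypothesis hJ : faithful A J.
Local Notation P := (sysP A).
Local Notation Q := (sysQ A).
Local Notation V := (tseq Q).
Implicit Types (f : V) (p : P) (q : Q) (r : R).

Definition annihilate p f : V := fun k => Sp p (f k.+1).
Definition create q f : V := fun k =>
  match k return tpow Q k with 0 => 0 | k.+1 => q ⊗ f k end.
Definition multiply r f : V := fun k => r ·> f k.

Lemma Sp_lact p r n (w : tpow Q n.+1) : Sp p (r ·> w) = Sp (p <· r) w.
Proof.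
move: w; apply: tensor_ext => [v w|v w|q w].
- by rewrite lactDr Sp_add.
- exact: Sp_add.
- by rewrite lact_tpure !SpE tpureA.
Qed.

Lemma lact_Sp p r n (w : tpow Q n.+1) : Sp (r ·> p) w = r ·> Sp p w.
Proof.
move: w; apply: tensor_ext => [v w|v w|q w].
- exact: Sp_add.
- by rewrite Sp_add lactDr.
- by rewrite !SpE psil lactA.
Qed.

Lemma Sp_addl p p' n (w : tpow Q n.+1) : Sp (p + p') w = Sp p w + Sp p' w.
Proof.
move: w; apply: tensor_ext => [v w|v w|q w].
- exact: Sp_add.
- by rewrite !Sp_add addrACA.
- by rewrite !SpE psiDl lactDl.
Qed.

(** The creation and annihilation operators on sequences of tensors. *)
Definition fock_rep : covrep A.
Proof.
refine (@endo_rep R A V (vanishing Q) annihilate create multiply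
  _ _ _ _ _ _ _ _ _ _ _ _ _ _ _).
- by move=> p f g; apply: tseqP => k; exact: Sp_add.
- by move=> q f g; apply: tseqP => -[|k]; [exact/esym/addr0|exact: tpureDr].
- by move=> r f g; apply: tseqP => k; exact: lactDr.
- move=> p f /vanishingP[N hN]; apply/vanishingP; exists N => k hk.
  by rewrite /annihilate hN ?(morphD0 (@Sp_add _ _ p k)) // leqW.
- move=> q f /vanishingP[N hN]; apply/vanishingP; exists N.+1 => -[|k] //= hk.
  rewrite hN //; exact: (@morphD0 _ _ (fun a : tpow Q k => q ⊗ a) (tpureDr q)).
- move=> r f /vanishingP[N hN]; apply/vanishingP; exists N => k hk.
  by rewrite /multiply hN // lact0r.
- by move=> p p' f; apply: tseqP => k; exact: Sp_addl.
- by move=> q q' f; apply: tseqP => -[|k]; [exact/esym/addr0|exact: tpureDl].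
- by move=> r s f; apply: tseqP => k; exact: lactDl.
- by move=> r s f; apply: tseqP => k; exact: lactA.
- by move=> p r f; apply: tseqP => k; exact/esym/Sp_lact.
- by move=> r p f; apply: tseqP => k; exact: lact_Sp.
- by move=> q r f; apply: tseqP => -[|k] //; exact: tpureA.
- move=> r q f; apply: tseqP => -[|k]; first exact/esym/lact0r.
  exact/esym/lact_tpure.
- by move=> p q f; apply: tseqP => k; exact/esym/SpE.
Defined.

Local Notation E := fock_rep.

Definition germ_rep : covrep A :=
  push_rep (C := E) (wp_hom (into_ideal (vanishing Q))).

(** A compact [Delta x] agrees with [x] on all positive tensor powers; on germs
    at infinity the discrepancy in the lowest power is invisible. *)
Lemma germ_invariant : cp_invariant J germ_rep.
Proof.
apply/(cp_invariantP hFS _ hJ.1) => x s xJ hs.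
pose F := \sum_(u <- s) repQ E u.1 · repP E u.2.
have -> : \sum_(u <- s) repQ germ_rep u.1 · repP germ_rep u.2 =
    wp (into_ideal (vanishing Q)) F.
  rewrite [RHS](morphD_sum (@wpD _ _)); apply: eq_bigr => u _.
  exact/esym/wpM.
apply/wp_eqP/into_idealP => f; apply/vanishingP; exists 1%N => -[//|k] _.
rewrite endo_subE endo_sumE tseq_subE tseq_sumE.
apply/eqP; rewrite subr_eq0; apply/eqP.
rewrite -[LHS]/(x ·> f k.+1 : tpow Q k.+1).
rewrite -[RHS]/(\sum_(u <- s) (u.1 ⊗ Sp u.2 (f k.+1) : tpow Q k.+1)).
move: (f k.+1); apply: tensor_ext => [v w|v w|q w].
- exact: lactDr.
- by rewrite -big_split; apply: eq_bigr => u _; rewrite Sp_add tpureDr.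
rewrite lact_tpure; have -> : x ·> q = \sum_(u <- s) u.1 <· psi (u.2 ⊗ q).
  by rewrite -sum_thetaQE -hs.
rewrite (@morphD_sum _ _ (fun a : Q => a ⊗ w) (fun a b => tpureDl a b w)).
by apply: eq_bigr => u _; rewrite SpE tpureA.
Qed.

Local Notation C := (CPrep A J).

Lemma CPlift_germ_eq0 (x : target E) (y : target C) :
  CPlift germ_rep y = wp (into_ideal (vanishing Q)) x -> y = 0 ->
  forall f, val x f \in vanishing Q.
Proof.
have [[gD _] _ _ _] := CPliftP hFS germ_invariant.
move=> h y0; apply/into_idealP; apply/wp0P; rewrite -h y0.
exact: morphD0 gD.
Qed.

Lemma CPlift_germ_Tpow n (w : tpow Q n) :
  CPlift germ_rep (Tpow C w) = wp (into_ideal (vanishing Q)) (Tpow E w).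
Proof.
have [[gD gM] gP gQ gR] := CPliftP hFS germ_invariant.
elim: n w => [|n IH] w; first exact: gQ.
move: w; apply: tensor_ext => [v w|v w|q w].
- by rewrite (@TpowD _ _ C n.+1) gD.
- by rewrite (@TpowD _ _ E n.+1) wpD.
- by rewrite !Tpow_pure gM IH [X in X · _]gQ [RHS]wpM.
Qed.

Lemma Tpow_local n (w : tpow Q n) k f g : f k = g k ->
  val (Tpow E w) f (n.+1 + k)%N = val (Tpow E w) g (n.+1 + k)%N.
Proof.
move=> fg; elim: n w => [|n IH] w; first by rewrite /= fg.
move: w; apply: tensor_ext => [v w|v w|q w].
- by rewrite (@TpowD _ _ E n.+1).
- by rewrite (@TpowD _ _ E n.+1).
by rewrite Tpow_pure -[LHS]/(q ⊗ val (Tpow E w) f (n.+1 + k)%N) IH.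
Qed.

Lemma Tpow_tsnoc n (w : tpow Q n) f : val (Tpow E w) f n.+1 = tsnoc w (f 0%N).
Proof.
elim: n w => [//|n IH]; apply: tensor_ext => [v w|v w|q w].
- by rewrite (@TpowD _ _ E n.+1).
- exact: tsnocDl.
by rewrite Tpow_pure tsnoc_pure -IH.
Qed.

(** By [Tpow_local] the value at one index depends on one entry only. If every
    index had a sequence on which the value is nonzero there, then choosing the
    entries independently would give one sequence whose image never vanishes. *)
Lemma Tpow_eq0_at n (w : tpow Q n) : Tpow C w = 0 ->
  exists k, forall f, val (Tpow E w) f (n.+1 + k)%N = 0.
Proof.
move=> h; have hv := CPlift_germ_eq0 (CPlift_germ_Tpow w) h.
apply: contrapT => hk.
have /choice[F hF] k : exists f, val (Tpow E w) f (n.+1 + k)%N <> 0.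
  apply: contrapT => hf; apply: hk; exists k => f; apply: contrapT => hne.
  by apply: hf; exists f.
have /vanishingP[N hN] := hv (fun k => F k k).
apply: (hF N); rewrite -(@Tpow_local _ w N (fun k => F k k)) //.
by apply: hN; rewrite leq_addl.
Qed.

Lemma sigma_eq0_at r : repR C r = 0 -> exists k, forall w : tpow Q k, r ·> w = 0.
Proof.
move=> h; have [_ _ _ gR] := CPliftP hFS germ_invariant.
have hv := CPlift_germ_eq0 (x := repR E r) (gR r) h.
apply: contrapT => hk.
have hw k : {w : tpow Q k | r ·> w <> 0}.
  apply: cid; apply: contrapT => hf; apply: hk; exists k => w.
  by apply: contrapT => hne; apply: hf; exists w.
have /vanishingP[N hN] := hv (fun k => projT1 (hw k)).
exact: (projT2 (hw N)) (hN N _).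
Qed.

Section Faithful.
Variable I : inv_ideal A.
Hypothesis IJ : {subset I <= J}.

Lemma ideal_sandwich_eq0 r : r \in I -> (forall p q, psi ((p <· r) ⊗ q) = 0) -> r = 0.
Proof.
move=> rI h; apply: hJ.2; first exact: IJ.
apply/funext => q; apply: (psi_sepQ hFS) => p; rewrite -tpureA; exact: h.
Qed.

(** An ideal inside [J] acts faithfully on [Q], and by invariance on all tensor
    powers of [Q]. *)
Lemma psi_word_eq0 k r : r \in I ->
  (forall (ps : seq P) (qs : seq Q), size ps = k -> size qs = k ->
    psi_word r ps qs = 0) -> r = 0.
Proof.
elim: k r => [|k IH] r rI h; first exact: (h [::] [::]).
apply: ideal_sandwich_eq0 => // p q; apply: IH => [|ps qs hps hqs]; first exact: inv_psi.
by apply: (h (p :: ps) (q :: qs)); rewrite /= ?hps ?hqs.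
Qed.

Lemma psi_word_in r (ps : seq P) (qs : seq Q) : r \in I -> psi_word r ps qs \in I.
Proof.
by elim: ps qs r => [|p ps IH] [|q qs] r //= rI; apply: IH; exact: inv_psi.
Qed.

(** The universal representation could a priori collapse some coefficients; on the
    ideals that carry cycles it does not, since these act faithfully on all tensor
    powers and hence on germs. *)
Lemma ideal_sigma_eq0 r : r \in I -> repR C r = 0 -> r = 0.
Proof.
move=> rI /sigma_eq0_at[k hk]; elim: k r rI hk => [|k IH] r rI hk.
  by apply: hJ.2; [exact: IJ|apply/funext => q; exact: hk].
apply: ideal_sandwich_eq0 => // p q; apply: IH => [|w]; first exact: inv_psi.
by rewrite tpureA -SpE -lact_tpure hk (morphD0 (@Sp_add _ _ p k)).
Qed.

Variables (n : nat) (eta : ideal_sort I -> tpow Q n).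
Hypothesis eta_inj : injective eta.
Hypothesis etaD : {morph eta : x y / x + y}.
Hypothesis eta_psi : forall p x q, Sp p (tsnoc (eta x) q) = eta (inv_elt p x q).

Lemma eta_eq0 x : eta x = 0 -> val x = 0.
Proof.
by move=> h; have -> : x = 0 by apply: eta_inj; rewrite h (morphD0 etaD).
Qed.

(** By [eta_psi], applying letters on both sides moves the index at which
    [Tpow E (eta x)] vanishes down to its lowest value, where the operator is
    [tsnoc (eta x)], and one more letter leads back to the injective map [eta]. *)
Lemma ideal_Tpow_eq0 x : Tpow C (eta x) = 0 -> val x = 0.
Proof.
move=> /Tpow_eq0_at[k]; elim: k x => [|k IH] x hx.
  apply: ideal_sandwich_eq0 (valP x) _ => p q; apply: (@eta_eq0 (inv_elt p x q)).
  have hn m f : m = (n.+1 + 0)%N -> val (Tpow E (eta x)) f m = 0 by move=> ->.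
  pose f : V := fun k => match k return tpow Q k with 0 => q | _.+1 => 0 end.
  by rewrite -eta_psi -[q]/(f 0%N) -Tpow_tsnoc hn ?addn0 // (morphD0 (@Sp_add _ _ p n)).
apply: ideal_sandwich_eq0 (valP x) _ => p q; apply: (IH (inv_elt p x q)) => f.
have hn m g : m = (n.+1 + k.+1)%N -> val (Tpow E (eta x)) g m = 0 by move=> ->.
rewrite -eta_psi -S_Tpow Tpow_snoc.
rewrite -[LHS]/(Sp p (val (Tpow E (eta x)) (create q f) (n.+1 + k).+1)).
by rewrite hn ?addnS // (morphD0 (@Sp_add _ _ p _)).
Qed.
End Faithful.
End Germs.

(** * The ideal of a cycle *)

Section ProductRng.
Variables B1 B2 : rngType.

Definition prod_mul (x y : B1 * B2) := (x.1 · y.1, x.2 · y.2).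
Fact prod_mulA : associative prod_mul.
Proof. by move=> x y z; rewrite /prod_mul /= !rmulA. Qed.
Fact prod_mulDl : left_distributive prod_mul +%R.
Proof. by move=> x y z; rewrite /prod_mul /= !rmulDl. Qed.
Fact prod_mulDr : right_distributive prod_mul +%R.
Proof. by move=> x y z; rewrite /prod_mul /= !rmulDr. Qed.
HB.instance Definition _ :=
  Zmodule_isRng.Build (B1 * B2)%type prod_mulA prod_mulDl prod_mulDr.

End ProductRng.

Section ProductRep.
Variables (R : rngType) (A : rsystem R) (C1 C2 : covrep A).

Definition prod_rep : covrep A.
Proof.
refine (@Covrep R A (target C1 * target C2)%type
  (fun p => (repP C1 p, repP C2 p)) (fun q => (repQ C1 q, repQ C2 q))
  (fun r => (repR C1 r, repR C2 r)) _ _ _ _ _ _ _ _).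
- by move=> p p'; rewrite !repPD.
- by move=> q q'; rewrite !repQD.
- by split=> r s; rewrite ?repRD ?repRM.
- by move=> p r; rewrite !repPr.
- by move=> r p; rewrite !repPl.
- by move=> q r; rewrite !repQr.
- by move=> r q; rewrite !repQl.
- by move=> p q; rewrite !rep_psi.
Defined.

Lemma prod_Sw ps (b : target prod_rep) : Sw ps b = (Sw ps b.1, Sw ps b.2).
Proof. by elim: ps b => [|p ps IH] b /=; [case: b|rewrite IH]. Qed.
Lemma prod_Tw qs (b : target prod_rep) : Tw qs b = (Tw qs b.1, Tw qs b.2).
Proof. by elim: qs b => [|p ps IH] b /=; [case: b|rewrite IH]. Qed.

End ProductRep.

Section Evanescent.
Variables (R : rngType) (A : rsystem R) (C : covrep A).
Local Notation B := (target C).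
Implicit Types (x y : B) (ps : seq (sysP A)) (qs : seq (sysQ A)).

(** Up to such elements, multiplication by a cycle is well defined and injective;
    see [cycle_graph_evanescent]. *)
Definition evanescent x := exists N, forall ps qs,
  (N <= size ps)%N -> (N <= size qs)%N -> Sw ps (Tw qs x) = 0.

(** Two long words contain words next to [x] of matching lengths. *)
Lemma evanescent_degree (d : int) x :
  (exists N, forall ps qs, (N <= size ps)%N -> (N <= size qs)%N ->
     (size ps)%:Z = (size qs)%:Z + d -> Sw ps (Tw qs x) = 0) ->
  evanescent x.
Proof.
move=> [N hN]; exists (N + absz d)%N => ps qs hps hqs.
have [i [j [hi hj Ni Nj ij]]] : exists i j : nat,
    [/\ (i <= size ps)%N, (j <= size qs)%N, (N <= i)%N, (N <= j)%N &
        i%:Z = j%:Z + d].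
  have [hd|hd] := boolP (0 <= d); first by exists (N + absz d)%N, N; split; lia.
  by exists N, (N + absz d)%N; split; lia.
rewrite -(cat_take_drop i ps) -(cat_take_drop j qs) Sw_cat Tw_cat.
rewrite (SwTw (take i ps)) hN ?Tw0 ?Sw0 // ?size_takel //.
Qed.

Lemma evanescent0 : evanescent 0.
Proof. by exists 0%N => ps qs _ _; rewrite Tw0 Sw0. Qed.

Lemma evanescentB x y : evanescent x -> evanescent y -> evanescent (x - y).
Proof.
move=> [N hN] [M hM]; exists (maxn N M) => ps qs; rewrite !geq_max.
move=> /andP[h1 h2] /andP[h3 h4].
by rewrite (morphDB (TwD qs)) (morphDB (SwD ps)) hN // hM // subr0.
Qed.
End Evanescent.

Section Stable.
Variables (R : rngType) (A : rsystem R) (J : ideal R).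
Local Notation C := (CPrep A J).
Variable K : zmodClosed (CPring A J).

Lemma stable_Ml :
  (forall p x, x \in K -> repP C p · x \in K) ->
  (forall q x, x \in K -> repQ C q · x \in K) ->
  (forall r x, x \in K -> repR C r · x \in K) ->
  forall y x, x \in K -> y · x \in K.
Proof.
move=> hP hQ hR; pose X (y : CPring A J) := forall x, x \in K -> y · x \in K.
have XP y : y \in span X -> X y.
  move/spanP; elim=> {y} [x|//|y z _ hy _ hz x] hx; first by rewrite rmul0l rpred0.
  by rewrite rmulBl rpredB ?hy ?hz.
move=> y; apply: (XP); move: y; apply: CPring_generated => [y z hy hz|p|q|r].
- by apply: mem_span => x hx; rewrite -rmulA; exact: (XP _ hy _ (XP _ hz _ hx)).
- exact/mem_span/hP.
- exact/mem_span/hQ.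
- exact/mem_span/hR.
Qed.

Lemma stable_Mr :
  (forall p x, x \in K -> x · repP C p \in K) ->
  (forall q x, x \in K -> x · repQ C q \in K) ->
  (forall r x, x \in K -> x · repR C r \in K) ->
  forall y x, x \in K -> x · y \in K.
Proof.
move=> hP hQ hR; pose X (y : CPring A J) := forall x, x \in K -> x · y \in K.
have XP y : y \in span X -> X y.
  move/spanP; elim=> {y} [x|//|y z _ hy _ hz x] hx; first by rewrite rmul0r rpred0.
  by rewrite rmulBr rpredB ?hy ?hz.
move=> y; apply: (XP); move: y; apply: CPring_generated => [y z hy hz|p|q|r].
- by apply: mem_span => x hx; rewrite rmulA; exact: (XP _ hz _ (XP _ hy _ hx)).
- exact/mem_span/hP.
- exact/mem_span/hQ.
- exact/mem_span/hR.
Qed.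

End Stable.

Section CycleIdeal.
Variables (R : rngType) (A : rsystem R) (J : ideal R) (hFS : condFS A).
Hypothesis hJ : faithful A J.
Variable I : inv_ideal A.
Hypothesis IJ : {subset I <= J}.
Variables (n : nat) (eta : ideal_sort I -> tpow (sysQ A) n).
Hypothesis eta_hom : bimod_hom eta.
Hypothesis eta_inj : injective eta.
Hypothesis eta_psi : forall p x q, Sp p (tsnoc (eta x) q) = eta (inv_elt p x q).
Local Notation P := (sysP A).
Local Notation Q := (sysQ A).
Local Notation C := (CPrep A J).
Local Notation CC := (prod_rep C C).
Local Notation B := (target C).
Implicit Types (d : int) (b : target CC).

Definition cycle_pair b := exists x : ideal_sort I,
  b = (repR C (val x), Tpow C (eta x)).

(** The pairs [(y, u y)] with [y] of degree [d], where [u] is the multiplication by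
    the cycle. This need not be the graph of a map, but up to evanescent elements
    it is the graph of an injective one. *)
Definition cycle_graph d : zmodClosed (target CC) := gdeg CC cycle_pair d.

Lemma cycle_graph_degrees d b : b \in cycle_graph d ->
  b.1 \in hdeg C d /\ b.2 \in hdeg C (d + n.+1%:Z).
Proof.
move=> /spanP; elim=> {b} [|b|b c _ [h1 h2] _ [h3 h4]].
- by rewrite !rpred0.
- elim=> {d b} [_ [x ->]|r d b _ [h1 h2]|p d b _ [h1 h2]|q d b _ [h1 h2]
    |r d b _ [h1 h2]|p d b _ [h1 h2]|q d b _ [h1 h2]].
  + by rewrite add0r; split; [exact: hdegR|exact: hdeg_Tpow].
  + by split; exact: hdeg_lR.
  + by rewrite addrAC; split; [exact: hdeg_lP h1|exact: hdeg_lP h2].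
  + by rewrite addrAC; split; [exact: hdeg_lQ h1|exact: hdeg_lQ h2].
  + by split; exact: hdeg_rR.
  + by rewrite addrAC; split; [exact: hdeg_rP h1|exact: hdeg_rP h2].
  + by rewrite addrAC; split; [exact: hdeg_rQ h1|exact: hdeg_rQ h2].
- by split; exact: rpredB.
Qed.

Lemma cycle_pair0 : cycle_pair 0.
Proof.
exists 0; rewrite (morphD0 (bimod_homD eta_hom)) (morphD0 (@TpowD _ _ C n)).
by rewrite (morphD0 (@repRD _ _ C)).
Qed.

Lemma cycle_pairB b c : cycle_pair b -> cycle_pair c -> cycle_pair (b - c).
Proof.
move=> [x ->] [y ->]; exists (x - y).
rewrite (morphDB (bimod_homD eta_hom)) (morphDB (@TpowD _ _ C n)).
by rewrite [val (x - y)]/(val x - val y) (morphDB (@repRD _ _ C)).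
Qed.

Lemma cycle_pair_psi p b q : cycle_pair b ->
  cycle_pair (repP CC p · b · repQ CC q).
Proof.
move=> [x ->]; exists (inv_elt p x q); congr pair => /=.
  by rewrite rep_psi repPr.
by rewrite -eta_psi -S_Tpow Tpow_snoc rmulA.
Qed.

(** Long words turn a pair of the graph into [(sigma x, T (eta x))], and either
    entry of such a pair determines [x]. *)
Lemma cycle_graph_evanescent d b : b \in cycle_graph d ->
  evanescent (C := C) b.1 <-> evanescent (C := C) b.2.
Proof.
move=> /(gdeg_reduce cycle_pair0 cycle_pairB cycle_pair_psi)[N hN].
split=> -[M hM]; apply: (@evanescent_degree _ _ _ d); exists (maxn N M) => ps qs;
  rewrite !geq_max => /andP[h1 h2] /andP[h3 h4] h5;
  have [x] := hN ps qs h1 h3 h5; rewrite prod_Tw prod_Sw => -[e1 e2].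
- rewrite e2; have x0 : x = 0.
    apply: val_inj; apply: (ideal_sigma_eq0 hFS hJ IJ (valP x)).
    by rewrite -e1 hM.
  by rewrite x0 (morphD0 (bimod_homD eta_hom)) (morphD0 (@TpowD _ _ C n)).
- rewrite e1; suff -> : val x = 0 by exact: (morphD0 (@repRD _ _ C)).
  apply: (ideal_Tpow_eq0 hFS hJ IJ eta_inj (bimod_homD eta_hom) eta_psi).
  by rewrite -e2 hM.
Qed.

Definition cycle_difference (x : B) :=
  exists d, exists2 b, b \in cycle_graph d & x = b.1 - b.2.

Fact cycle_difference_Ml (y x : CPring A J) :
  x \in span cycle_difference -> y · x \in span cycle_difference.
Proof.
apply: stable_Ml => [p|q|r]; apply: span_map; try exact: rmulDr;
  move=> _ [d [b hb ->]]; apply: mem_span.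
- exists (d - 1), (repP CC p · b); first exact: gdeg_lP.
  exact: rmulBr.
- exists (d + 1), (repQ CC q · b); first exact: gdeg_lQ.
  exact: rmulBr.
- exists d, (repR CC r · b); first exact: gdeg_lR.
  exact: rmulBr.
Qed.

Fact cycle_difference_Mr (y x : CPring A J) :
  x \in span cycle_difference -> x · y \in span cycle_difference.
Proof.
apply: stable_Mr => [p|q|r].
- apply: (@span_map _ _ (fun a : B => a · repP C p)) => [a c|]; first exact: rmulDl.
  move=> _ [d [b hb ->]]; apply: mem_span.
  by exists (d - 1), (b · repP CC p); [exact: gdeg_rP|exact: rmulBl].
- apply: (@span_map _ _ (fun a : B => a · repQ C q)) => [a c|]; first exact: rmulDl.
  move=> _ [d [b hb ->]]; apply: mem_span.
  by exists (d + 1), (b · repQ CC q); [exact: gdeg_rQ|exact: rmulBl].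
- apply: (@span_map _ _ (fun a : B => a · repR C r)) => [a c|]; first exact: rmulDl.
  move=> _ [d [b hb ->]]; apply: mem_span.
  by exists d, (b · repR CC r); [exact: gdeg_rR|exact: rmulBl].
Qed.

Definition cycle_difference_ideal : ideal (CPring A J) :=
  @Ideal (CPring A J) (span cycle_difference)
    cycle_difference_Ml cycle_difference_Mr.

Lemma cycle_difference_family (x : B) : x \in cycle_difference_ideal ->
  exists (s : seq int) (f : int -> target CC),
    [/\ uniq s, forall d, f d \in cycle_graph d,
        forall d, d \notin s -> f d = 0 &
        x = \sum_(d <- s) (f d).1 - \sum_(d <- s) (f d).2].
Proof.
move=> hx.
have [b hb xE] : exists2 b, b \in span (fun b => exists d, b \in cycle_graph d) &
    x = b.1 - b.2.
  move/spanP: hx; elim=> {x} [|_ [d [b hb ->]]|x y _ [b hb ->] _ [c hc ->]].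
  - by exists 0; rewrite ?rpred0 // subr0.
  - by exists b => //; apply: mem_span; exists d.
  - exists (b - c); first exact: rpredB.
    rewrite -[(b - c).1]/(b.1 - c.1) -[(b - c).2]/(b.2 - c.2).
    by rewrite [in LHS]opprD addrACA -opprD.
have [s [f [us hf f0 bE]]] := span_graded hb.
exists s, f; split=> //; rewrite xE bE; congr (_ - _).
  exact: (@morphD_sum _ _ (fun b : target CC => b.1) (fun _ _ => erefl)).
exact: (@morphD_sum _ _ (fun b : target CC => b.2) (fun _ _ => erefl)).
Qed.

(** Suppose [sigma r = \sum_d (y_d - u y_d)] with [(y_d, u y_d)] in the graph.
    With [N] the degree of [u], comparing components gives [y_k = u y_(k - N)] for
    [k] other than 0, and [sigma r = y_0 - u y_(- N)]. Almost all [y_d] vanish and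
    [u] preserves and reflects evanescence; so going up from low degrees shows
    that [u y_(- N)] is evanescent, and going down from high degrees that [y_0]
    is. Hence so is [sigma r], which forces [r = 0]. *)
Theorem cycle_difference_sigma r : r \in I ->
  repR C r \in cycle_difference_ideal -> r = 0.
Proof.
move=> rI /cycle_difference_family[s [f [us hf f0 rE]]].
pose N := n.+1%:Z; pose y d := (f d).1; pose z d := (f d).2.
have hy d : y d \in hdeg C d by have [] := cycle_graph_degrees (hf d).
have hz d : z (d - N) \in hdeg C d.
  by have [_] := cycle_graph_degrees (hf (d - N)); rewrite subrK.
have y0 d : d \notin s -> y d = 0 by rewrite /y => /f0 ->.
have z0 d : d \notin s -> z d = 0 by rewrite /z => /f0 ->.
(* The components of [rE]; the second entry of [f d] has degree [d + N]. *)
have hcomp_k k : y k - z (k - N) = if k == 0 then repR C r else 0.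
  rewrite -(component_hdeg hFS hJ.1 k (hdegR C r)) rE (morphDB (@componentD _ _ _ hFS hJ.1 k)).
  rewrite (component_sum hFS hJ.1 k us hy); congr (_ - _).
    by case: ifP => // /negbT /y0.
  have -> : \sum_(d <- s) (f d).2 = \sum_(d <- [seq d + N | d <- s]) z (d - N).
    by rewrite big_map; apply: eq_bigr => d _; rewrite addrK.
  rewrite (component_sum hFS hJ.1) ?map_inj_uniq //; last exact: addIr.
  case: ifP => // /negbT hk; apply: z0; apply: contra hk => hk.
  by apply/mapP; exists (k - N); rewrite ?subrK.
have hev d : evanescent (C := C) (y d) <-> evanescent (C := C) (z d).
  exact: cycle_graph_evanescent (hf d).
have step k : k != 0 -> y k = z (k - N).
  move=> k0; apply/eqP; rewrite -subr_eq0 hcomp_k (negPf k0); exact/eqP.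
pose M := (\sum_(d <- s) absz d)%N.
have hM d : d \in s -> (absz d <= M)%N.
  by move=> ds; rewrite /M (bigD1_seq d) //= leq_addr.
have descend (p : nat -> Prop) m : p m -> (forall j, p j.+1 -> p j) -> p 0%N.
  by move=> pm h; elim: m pm => // m IH /h.
have ev0 : evanescent (C := C) 0 by exact: evanescent0.
have zlow : evanescent (C := C) (z (- N)).
  have := @descend (fun j => evanescent (C := C) (z (- (j.+1%:Z * N)))) M.
  rewrite mul1r; apply.
    rewrite z0 //; apply/negP => /hM; rewrite /N; nia.
  move=> j hj; apply/hev; rewrite step; last by rewrite /N; nia.
  by move: hj; congr (evanescent (z _)); rewrite /N; lia.
have yhigh : evanescent (C := C) (y 0).
  have := @descend (fun j => evanescent (C := C) (y (j%:Z * N))) M.+1.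
  rewrite mul0r; apply.
    rewrite y0 //; apply/negP => /hM; rewrite /N; nia.
  move=> j hj; apply/hev; move: hj; rewrite step; last by rewrite /N; nia.
  by congr (evanescent (z _)); rewrite /N; lia.
have [K hK] : evanescent (C := C) (repR C r).
  have := hcomp_k 0; rewrite eqxx sub0r => <-; exact: evanescentB.
apply: (psi_word_eq0 hFS hJ IJ (k := K)) => // ps qs hps hqs.
apply: (ideal_sigma_eq0 hFS hJ IJ (psi_word_in _ _ rI)).
by rewrite -Sw_Tw_sigma ?hK ?hps ?hqs.
Qed.

End CycleIdeal.

Section GradedToK.
Variables (R : rngType) (A : rsystem R) (hFS : condFS A) (J : ideal R).
Hypothesis hJ : faithful A J.

(** If a cycle exists, then [sigma x] and its image [T (eta x)] under the cycle
    differ by an element of [cycle_difference_ideal]. They have different degrees,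
    so the preimage of this ideal cannot be graded without containing the preimage
    of [sigma x]. *)
Lemma graded_condK : (forall H : ideal (CPring A J), graded_ideal H) -> condK hFS J.
Proof.
move=> hgr t sJ [I0 [[x xI x0] [n [eta [eta_hom eta_inj eta_psi]]] I0J]].
set AI := quot_system hFS (tp_I t) in I0 xI eta eta_hom eta_inj eta_psi I0J.
have hFSI : condFS AI := @quot_condFS _ _ hFS (tp_I t).
have hf : faithful AI (im_ideal (tp_I t) (tp_J t)) := tp_faithful t.
have IJ : {subset I0 <= im_ideal (tp_I t) (tp_J t)}.
  by move=> r /I0J/asboolP/(_ 0%N).
have [[kD kM] kP kQ kR] := kappaP hJ.1 hf.1 sJ.
set k := kappa _ _ _ in kD kM kP kQ kR.
set H' := cycle_difference_ideal (im_ideal (tp_I t) (tp_J t)) eta.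
pose X (z : CPring A J) := k z \in H'.
have Xl r z : X z -> X (r · z) by rewrite /X kM => hz; exact: idealMl.
have Xr r z : X z -> X (z · r) by rewrite /X kM => hz; exact: idealMr.
have HP z : z \in span_ideal Xl Xr -> k z \in H'.
  by move/spanP; elim=> {z} [|//|z z' _ h _ h']; rewrite ?(morphD0 kD) ?rpred0 //
    (morphDB kD) rpredB.
pose D := CPrep AI (im_ideal (tp_I t) (tp_J t)).
pose x' : ideal_sort I0 := exist _ x xI.
have [g gd ge] := kappa_hdeg_surj hJ.1 hf.1 sJ (hdegR D x).
have [g' gd' ge'] := kappa_hdeg_surj hJ.1 hf.1 sJ (hdeg_Tpow D (eta x')).
pose f (d : int) : CPring A J := if d == 0 then g else if d == n.+1%:Z then - g' else 0.
have us : uniq [:: 0; n.+1%:Z] by [].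
have fd d : f d \in hdeg (CPrep A J) d.
  rewrite /f; case: eqP => [->|_] //; case: eqP => [->|_]; last exact: rpred0.
  by rewrite rpredN.
have hsum : \sum_(d <- [:: 0; n.+1%:Z]) f d = g - g'.
  by rewrite !big_cons big_nil addr0 /f !eqxx.
have /(graded_idealP hFS hJ.1)/(_ _ _ us fd) hH := hgr (span_ideal Xl Xr).
rewrite hsum in hH.
have hm : g - g' \in span_ideal Xl Xr.
  apply: mem_span; rewrite /X (morphDB kD) [k g]ge [k g']ge'; apply: mem_span.
  exists 0, (repR D x, Tpow D (eta x')) => //.
  by apply: gdegG; exists x'.
have /HP := hH hm 0 (mem_head _ _); rewrite [k (f 0)]ge => hx.
move/eqP: x0; apply.
exact: (cycle_difference_sigma hFSI hf IJ eta_hom eta_inj eta_psi xI hx).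
Qed.

End GradedToK.

(** * The equivalence *)

Theorem theorem6p2 (R : rngType) (A : rsystem R) (hFS : condFS A)
    (J : ideal R) (hJ : faithful A J) :
  ((forall H : ideal (CPring A J), graded_ideal H) <-> condK hFS J) /\
  (condK hFS J <->
   (forall C : covrep A, cp_invariant J C -> injective (omega_eta hFS C))).
Proof.
have graded_of_injective := @injective_graded _ _ hFS _ hJ.
have injective_of_K := @condK_injective _ _ hFS _ hJ.
have K_of_graded := @graded_condK _ _ hFS _ hJ.
by split; split; auto.
Qed.
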